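(* There exist $A_0>0$ and constants $0<c_1\le c_2<\infty$ such that the following holds. Suppose that $A=A(n)$ satisfies $A_0\le A(n)$ for all $n$ and $A(n)=o(n^{1/30})$ as $n\to\infty$, and that $p=p(n)=\frac1n+\frac{\lambda}{n^{4/3}}$, where $\lambda=\lambda(n)\in\mathbb{R}$ satisfies $|\lambda(n)|\le A(n)/3$. Then for all sufficiently large $n$ and any vertex $v\in[n]$ of the random graph $G(n,p)$, $$\text{(a)}\qquad \frac{c_1}{A^{1/2}n^{1/3}}e^{-\frac{A^3}{8}+\frac{\lambda A^2}{2}-\frac{\lambda^2A}{2}} \le \mathbb{P}\big(|C(v)|>An^{2/3}\big)\le \frac{c_2}{A^{1/2}n^{1/3}}e^{-\frac{A^3}{8}+\frac{\lambda A^2}{2}-\frac{\lambda^2A}{2}}$$ and $$\text{(b)}\qquad \frac{c_1}{A^{3/2}}e^{-\frac{A^3}{8}+\frac{\lambda A^2}{2}-\frac{\lambda^2A}{2}} \le \mathbb{P}\big(|\mathcal{C}_{\max}|>An^{2/3}\big)\le \frac{c_2}{A^{3/2}}e^{-\frac{A^3}{8}+\frac{\lambda A^2}{2}-\frac{\lambda^2A}{2}}.$$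
   Context: $[n]=\{1,\dots,n\}$. $G(n,p)$ is the Erd\H{o}s-R\'enyi random graph on vertex set $[n]$: each edge of the complete graph on $[n]$ is retained independently with probability $p$ and deleted with probability $1-p$. $C(v)$ is the connected component of $G(n,p)$ containing $v$, $\mathcal{C}_{\max}$ is a largest connected component, and $|\cdot|$ denotes the number of vertices. *)

(* Defs.v *)
From HB Require Import structures.
From mathcomp Require Import all_boot all_order all_algebra.
From mathcomp Require Import all_classical all_reals all_analysis.
Import Order.TTheory GRing.Theory Num.Theory.
Import numFieldNormedType.Exports.

Set Implicit Arguments.
Unset Strict Implicit.
Unset Printing Implicit Defensive.

Local Open Scope ring_scope.

(* The vertex set [n] is 'I_n, and a simple graph on it is its set of edges,
   an edge being a set of two vertices. *)
Definition complete_edges (n : nat) : {set {set 'I_n}} :=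
  [set e : {set 'I_n} | #|e| == 2]%SET.

Definition adj (n : nat) (E : {set {set 'I_n}}) : rel 'I_n :=
  fun u v => ([set u; v]%SET \in E).

Definition component (n : nat) (E : {set {set 'I_n}}) (v : 'I_n) : {set 'I_n} :=
  [set w : 'I_n | connect (adj E) v w]%SET.

Definition max_component_size (n : nat) (E : {set {set 'I_n}}) : nat :=
  \max_(v < n) #|component E v|.

Definition gnp_weight (R : realType) (n : nat) (p : R)
    (E : {set {set 'I_n}}) : R :=
  \prod_(e in complete_edges n) (if e \in E then p else 1 - p).

(* A polynomial in p, and a probability when 0 <= p <= 1. *)
Definition gnp_prob (R : realType) (n : nat) (p : R)
    (Q : pred {set {set 'I_n}}) : R :=
  \sum_(E in powerset (complete_edges n) | Q E) gnp_weight p E.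

Lemma gnp_weight_ge0 (R : realType) (n : nat) (p : R) (E : {set {set 'I_n}}) :
  0 <= p <= 1 -> 0 <= gnp_weight p E.
Proof.
move=> /andP[p0 p1]; apply: prodr_ge0 => e _.
by case: ifP => _ //; rewrite subr_ge0.
Qed.

Lemma gnp_probT (R : realType) (n : nat) (p : R) : @gnp_prob R n p predT = 1.
Proof.
pose K := complete_edges n.
pose F (e : {set 'I_n}) : R := if e \in K then p else 0.
pose G (e : {set 'I_n}) : R := if e \in K then 1 - p else 1.
have <- : \prod_e (F e + G e) = 1.
  by apply: big1 => e _; rewrite /F /G; case: ifP => _; rewrite ?add0r // addrC subrK.
rewrite bigA_distr /gnp_prob [RHS](bigID (fun E => E \in powerset K)) /=.
rewrite [X in _ = _ + X]big1 ?addr0.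
  apply: eq_big => [E|E]; first by rewrite andbT.
  rewrite andbT inE => /fintype.subsetP sEK; rewrite /gnp_weight big_mkcond /=.
  apply: eq_bigr => e _; rewrite /F /G -/K; case: ifP => // eK.
  by case: ifP => // /sEK; rewrite eK.
move=> E; rewrite inE => /fintype.subsetPn[e eE eK].
by rewrite (bigD1 e) //= eE /F (negbTE eK) mul0r.
Qed.

(* Main.v *)
(* The component of a vertex has size k with probability
   C(n-1,k-1) P(G(k,p) is connected) q^(k(n-k)), where q = 1 - p. Exploring G(k,p)
   vertex by vertex shows that it is connected with probability
   (1-q^k)^(k-1) rho, where rho is the probability that a walk with known
   transition probabilities, conditioned to end at 0, stays positive. Explicit
   sub- and supersolutions of the recursion for rho pin it between constant
   multiples of (pk)^2. The remaining factor
   C(n-1,k-1) (1-q^k)^(k-1) q^(k(n-k)) is estimated up to constants by Stirling's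
   formula when k is of order A n^(2/3), and its successive quotients beyond that
   point are at most exp(-c (A n^(-1/3))^2), so the tail sum is comparable to
   its first (A n^(-1/3))^(-2) terms, which gives (a). For (b), let Y be the number of
   components larger than A n^(2/3): then 2Y - Y^2 <= 1[Y >= 1] <= Y, the mean of Y
   follows from the size law, and removing a large component only decreases (up
   to a constant) the probability of finding another one, so that E(Y^2) - E(Y) is
   at most E(Y) / 2 as soon as A_0 is large. *)

(* All factors but [rho] are explicit. If [p k] were negligible, [rho] would be the ballot value
   1/k. Otherwise the conditioned walk drifts upwards at rate of order d = [p k] at its start and,
   read backwards, also at its end. Staying positive near either end costs a factor of order d,
   whence d^2, which dominates 1/k once p^2 k^3 >= 1. A single linear barrier does not capture both
   ends. The horizon is therefore cut in half: a linear bound starts the induction at half time, and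
   corrections exponential in the height accumulate over the other half. Conditioning keeps the
   undiscovered vertices independent, so each step is binomial and such barriers have closed-form
   expectations.

   The scale is t = n^(-1/3), with a size k measured by x = k t^2. Exponents are of order up to a^3,
   yet bounds up to constants require them with bounded error. Logarithms are therefore kept to
   second order; the cubic remainders add up to order a^4 t, which the growth condition on A
   controls. *)
Require Import Defs.
From HB Require Import structures.
From mathcomp Require Import all_boot all_order all_algebra.
From mathcomp Require Import reals.
From mathcomp Require Import ring lra zify.
Import Order.TTheory GRing.Theory Num.Theory.

Set Implicit Arguments.
Unset Strict Implicit.
Unset Printing Implicit Defensive.

Local Open Scope ring_scope.

(** * The exploration walk *)

(* The expectation of [g] at a binomial variable with parameters [m] and [x]. *)
Definition binE (R : comNzRingType) (m : nat) (x : R) (g : nat -> R) : R :=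
  \sum_(i < m.+1) 'C(m, i)%:R * (1 - x) ^+ (m - i) * x ^+ i * g i.

(* The probability that an exploration with [s] vertices still to be processed,
   [m] of them undiscovered, never runs out of discovered vertices before all
   [s] are processed: each step consumes one discovered vertex and discovers
   each of the others with probability [p]. In particular G(k,p) is connected
   with probability [reach p k k.-1]. *)
Fixpoint reach (R : comNzRingType) (p : R) (s m : nat) : R :=
  if s is s'.+1 then
    if (m <= s')%N then
      \sum_(i < m.+1) 'C(m, i)%:R * p ^+ (m - i) * (1 - p) ^+ i * reach p s' i
    else 0
  else (m == 0)%:R.

Lemma reachS (R : comNzRingType) (p : R) s m : reach p s.+1 m =
  if (m <= s)%N then
    \sum_(i < m.+1) 'C(m, i)%:R * p ^+ (m - i) * (1 - p) ^+ i * reach p s i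
  else 0.
Proof. by []. Qed.

(* [1 - (1 - p) ^+ s] is the probability that a given vertex is hit in [s] steps,
   so [rho] is [reach] conditioned on every undiscovered vertex being hit. *)
Definition rho (R : fieldType) (p : R) (s m : nat) : R :=
  reach p s m / (1 - (1 - p) ^+ s) ^+ m.

Section BinE.
Variable R : comNzRingType.
Implicit Types (x c : R) (g : nat -> R).

Lemma binE_cst m x c : binE m x (fun=> c) = c.
Proof.
rewrite /binE -mulr_suml -[RHS]mul1r; congr (_ * _).
have /(congr1 (fun z => z ^+ m)) : (1 - x) + x = 1 by ring.
rewrite expr1n exprDn => E; rewrite -[RHS]E; apply: eq_bigr => i _.
by rewrite -mulrA mulr_natl.
Qed.

Lemma binE_id m x : binE m x (fun i => i%:R) = m%:R * x.
Proof.
case: m => [|m]; first by rewrite /binE big_ord1 mulr0 mul0r.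
rewrite /binE big_ord_recl mulr0 add0r.
transitivity ((m.+1)%:R * x * binE m x (fun=> 1)); last by rewrite binE_cst mulr1.
rewrite /binE mulr_sumr; apply: eq_bigr => i _ /=.
rewrite /bump /= add1n subSS mulr1 exprS.
have /(congr1 (fun z : nat => z%:R : R)) := mul_bin_diag m.+1 i.
rewrite /= !natrM => E.
transitivity (('C(m.+1, i.+1)%:R * i.+1%:R) * ((1 - x) ^+ (m - i) * (x * x ^+ i))); first by ring.
by rewrite [_ * (i.+1)%:R]mulrC -E; ring.
Qed.

Lemma binED m x g1 g2 : binE m x (fun i => g1 i + g2 i) = binE m x g1 + binE m x g2.
Proof. by rewrite /binE -big_split; apply: eq_bigr => i _; rewrite mulrDr. Qed.

Lemma binEZ m x c g : binE m x (fun i => c * g i) = c * binE m x g.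
Proof. by rewrite /binE mulr_sumr; apply: eq_bigr => i _; rewrite mulrCA. Qed.

End BinE.

(** The height of the walk is [s - i], so this binomial generating function evaluates the
    exponential part of the barriers; [binE_id] evaluates the linear part. *)
Lemma binE_exp_sub (R : comNzRingType) m s (x c : R) : (m <= s)%N ->
  binE m x (fun i => c ^+ (s - i)) = c ^+ (s - m) * (1 - (1 - x) * (1 - c)) ^+ m.
Proof.
move=> ms; have -> : 1 - (1 - x) * (1 - c) = (1 - x) * c + x by ring.
rewrite exprDn mulr_sumr; apply: eq_bigr => i _.
have im : (i <= m)%N by rewrite -ltnS.
have -> : (s - i = (s - m) + (m - i))%N by lia.
by rewrite exprD exprMn -[_ *+ 'C(m, i)]mulr_natl; ring.
Qed.

Lemma le_binE (R : numDomainType) m (x : R) g1 g2 : 0 <= x <= 1 ->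
  (forall i, (i <= m)%N -> g1 i <= g2 i) -> binE m x g1 <= binE m x g2.
Proof.
move=> /andP[x0 x1] H; apply: ler_sum => i _; apply: ler_wpM2l; last first.
  by apply: H; rewrite -ltnS.
by rewrite !mulr_ge0 ?exprn_ge0 ?subr_ge0 ?ler0n.
Qed.

Lemma expr_sub1_mul_le (R : realFieldType) (x : R) n : 0 <= x <= 1 ->
  (1 - x) ^+ n * (1 + n%:R * x) <= 1.
Proof.
move=> /andP[x0 x1]; elim: n => [|n IH]; first by rewrite mul0r addr0 expr0 mulr1.
apply: le_trans IH; rewrite exprSr -mulrA; apply: ler_wpM2l.
  by rewrite exprn_ge0 // subr_ge0.
have := ler0n R n; rewrite -natr1; move: (n%:R : R) => c c0; nra.
Qed.

Lemma expr_sub1_ge (R : realFieldType) (x : R) n : 0 <= x <= 1 ->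
  1 - n%:R * x <= (1 - x) ^+ n.
Proof.
move=> /andP[x0 x1]; elim: n => [|n IH]; first by rewrite mul0r subr0 expr0.
rewrite exprS; have : (1 - x) * (1 - n%:R * x) <= (1 - x) * (1 - x) ^+ n.
  by apply: ler_wpM2l => //; rewrite subr_ge0.
apply: le_trans; have := ler0n R n; rewrite -natr1; move: (n%:R : R) => c c0; nra.
Qed.

(* The probability that a vertex is not hit in the first of [s.+1] steps, given that
   it is hit in one of them. *)
Definition stay_prob (R : fieldType) (p : R) (s : nat) : R :=
  (1 - p) * (1 - (1 - p) ^+ s) / (1 - (1 - p) ^+ s.+1).

Section Walk.
Variables (R : realFieldType) (p : R).
Hypotheses (p_gt0 : 0 < p) (p_lt1 : p < 1).
Local Notation q := (1 - p).
Local Notation stay := (stay_prob p).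

Lemma q_in : 0 < q /\ q < 1.
Proof. by move: p_gt0 p_lt1 => h1 h2; split; lra. Qed.

Lemma qX_lt1 s : (0 < s)%N -> q ^+ s < 1.
Proof. by have [h1 h2] := q_in => h; rewrite exprn_ilt1 ?(ltW h1) // -lt0n. Qed.

Lemma one_sub_qX_gt0 s : 0 < 1 - q ^+ s.+1.
Proof. by rewrite subr_gt0 qX_lt1. Qed.

Lemma reach_ge0 s m : 0 <= reach p s m.
Proof.
elim: s m => [|s IH] m /=; first by rewrite ler0n.
case: ifP => // _; apply: sumr_ge0 => i _.
by have [h1 h2] := q_in; rewrite !mulr_ge0 ?exprn_ge0 ?ler0n ?(ltW p_gt0) ?(ltW h1).
Qed.

Lemma rho_ge0 s m : 0 <= rho p s m.
Proof.
rewrite mulr_ge0 ?reach_ge0 // invr_ge0 exprn_ge0 //.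
case: s => [|s]; first by rewrite expr0 subrr.
exact/ltW/one_sub_qX_gt0.
Qed.

Lemma rho_diag s : rho p s.+1 s.+1 = 0.
Proof. by rewrite /rho /= ltnn mul0r. Qed.

(** Conditioned on all being hit eventually, undiscovered vertices remain independent, so the number
    left after one step is binomial with parameter [stay]. The denominators of [rho] implement this
    conditioning. *)
Lemma rho_rec s m : (m <= s.+1)%N -> rho p s.+2 m = binE m (stay s.+1) (rho p s.+1).
Proof.
move=> ms; have h1 := one_sub_qX_gt0 s; have h2 := one_sub_qX_gt0 s.+1.
rewrite {1}/rho reachS ms mulr_suml; apply: eq_bigr => i _.
have im : (i <= m)%N by rewrite -ltnS.
move: (nat_of_ord i) im => j jm.
have -> : (1 - q ^+ s.+2) ^+ m = (1 - q ^+ s.+2) ^+ (m - j) * (1 - q ^+ s.+2) ^+ j.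
  by rewrite -exprD subnK.
rewrite /rho.
have -> : 1 - stay s.+1 = p / (1 - q ^+ s.+2).
  rewrite /stay_prob; apply: (mulIf (lt0r_neq0 h2)); rewrite mulrBl !divfK ?lt0r_neq0 //.
  by rewrite !exprS; ring.
rewrite /stay_prob !exprMn !exprVn.
have n1 : (1 - q ^+ s.+1) ^+ j != 0 by rewrite expf_neq0 // lt0r_neq0.
have n2 : (1 - q ^+ s.+2) ^+ j != 0 by rewrite expf_neq0 // lt0r_neq0.
have n3 : (1 - q ^+ s.+2) ^+ (m - j) != 0 by rewrite expf_neq0 // lt0r_neq0.
move: n1 n2 n3; set A := _ ^+ j; set B := _ ^+ j; set D := _ ^+ (m - j) => n1 n2 n3.
by rewrite invfM; field; rewrite n1 n2 n3.
Qed.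

Lemma stayC s : 1 - stay s = p / (1 - q ^+ s.+1).
Proof.
have h := lt0r_neq0 (one_sub_qX_gt0 s).
rewrite /stay_prob; apply: (mulIf h); rewrite mulrBl !divfK //.
by rewrite !exprS; ring.
Qed.

Lemma stay_itv s : 0 <= stay s <= 1.
Proof.
have [q0 q1] := q_in; have h := one_sub_qX_gt0 s.
apply/andP; split.
  rewrite divr_ge0 ?(ltW h) // mulr_ge0 ?(ltW q0) // subr_ge0.
  by rewrite exprn_ile1 ?ltW.
by rewrite -subr_ge0 stayC divr_ge0 // ltW.
Qed.

Lemma one_sub_qX_ge s : p * s%:R <= 1 -> s%:R * p / 2 <= 1 - q ^+ s.
Proof.
move=> ps; have [q0 q1] := q_in.
have /(@expr_sub1_mul_le _ _ s) : 0 <= p <= 1 by rewrite !ltW.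
have := exprn_ge0 s (ltW q0); move: (q ^+ s) => z.
have : 0 <= p * s%:R by rewrite mulr_ge0 ?ler0n ?(ltW p_gt0).
move: ps; rewrite [s%:R * p]mulrC; move: (p * s%:R) => t; nra.
Qed.

(** The right-hand side equals [s * (1 - q ^+ s.+1) - s.+1 * (q * (1 - q ^+ s))], so it measures how
    far [stay s] lies below its ballot value [s / s.+1]. Its increment is [p * (1 - q ^+ s.+1)], and
    summing these gives the bound. This gap is the drift exploited by the lower barrier. *)
Lemma stay_defect_ge s : p * s%:R <= 1 ->
  p ^+ 2 * s%:R * (s%:R + 1) / 4 <= p * s%:R - q * (1 - q ^+ s).
Proof.
elim: s => [|s IH] ps; first by rewrite expr0 subrr !(mulr0, mul0r) subr0.
have := ler_wpM2l (ltW p_gt0) (one_sub_qX_ge ps).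
have ps' : p * s%:R <= 1.
  by apply: le_trans ps; rewrite ler_wpM2l ?(ltW p_gt0) // ler_nat.
move: {IH}(IH ps'); rewrite [q ^+ s.+1]exprS -[s.+1%:R]natr1; move: (s%:R : R) => c; move: (_ ^+ s) => z.
lra.
Qed.

Lemma stay_le s : (0 < s)%N -> s.+1%:R * stay s <= s%:R.
Proof.
move=> s0; have h := one_sub_qX_gt0 s.
rewrite /stay_prob mulrA ler_pdivrMr //; rewrite -subr_ge0.
have [q0 q1] := q_in.
have : 0 <= p * s%:R - q * (1 - q ^+ s).
  elim: (s) => [|j IH]; first by rewrite expr0 subrr !mulr0 subr0.
  have := exprn_ge0 j (ltW q0); have : q ^+ j <= 1 by rewrite exprn_ile1 ?ltW.
  move: IH; rewrite [q ^+ j.+1]exprS -[j.+1%:R]natr1; move: (_ ^+ j) => z; move: (j%:R : R) => c.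
  move: p_gt0 p_lt1 => p0 p1; nra.
by rewrite [q ^+ s.+1]exprS -[s.+1%:R]natr1; congr (0 <= _); ring.
Qed.

Lemma stay_le_strong s : (0 < s)%N -> p * s%:R <= 1 ->
  stay s <= s%:R / s.+1%:R * (1 - p / 4).
Proof.
move=> s0 ps; have h := one_sub_qX_gt0 s.
have s1 : (0 : R) < s.+1%:R by rewrite ltr0n.
rewrite /stay_prob ler_pdivrMr //.
have -> : s%:R / s.+1%:R * (1 - p / 4) * (1 - q ^+ s.+1) =
    s%:R * (1 - p / 4) * (1 - q ^+ s.+1) / s.+1%:R.
  by move: s1; move: (s.+1%:R : R) => D D0; field; rewrite lt0r_neq0.
rewrite ler_pdivlMr //.
have hD := stay_defect_ge ps.
have hB : 1 - q ^+ s.+1 <= s.+1%:R * p.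
  have /(@expr_sub1_ge _ _ s.+1) : 0 <= p <= 1 by rewrite !ltW.
  by lra.
have : s%:R * p / 4 * (1 - q ^+ s.+1) <= s%:R * p / 4 * (s.+1%:R * p).
  by rewrite ler_wpM2l // !mulr_ge0 ?invr_ge0 ?ler0n ?(ltW p_gt0).
move: hD; rewrite [q ^+ s.+1]exprS -[s.+1%:R]natr1; move: (_ ^+ s) => z; move: (s%:R : R) => c.
move: p_gt0 => p0; nra.
Qed.

Lemma hazard_le s : s.+1%:R * (1 - stay s) <= 1 + s.+1%:R * p.
Proof.
have h := one_sub_qX_gt0 s; rewrite stayC mulrA ler_pdivrMr //.
have /(@expr_sub1_mul_le _ _ s.+1) : 0 <= p <= 1 by rewrite !ltW.
lra.
Qed.

Lemma rho1 m : (m <= 1)%N -> rho p 1 m = (m == 0)%:R.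
Proof.
case: m => [|[|//]] _; last by rewrite rho_diag.
by rewrite /rho reachS /= big_ord1 bin0 !expr0 !mulr1 divr1 /=.
Qed.

(** The ballot value [1 - m / s] solves the recursion exactly in the limit p = 0, where [stay s] is
    [s / s.+1]. For positive [p] the parameter [stay] is smaller, which makes it a subsolution. *)
Lemma rho_ge_linear s m : (0 < s)%N -> (m <= s)%N -> 1 - m%:R / s%:R <= rho p s m.
Proof.
case: s => // s _; elim: s m => [|s IH] m.
  by move=> m1; rewrite rho1 // divr1; case: m m1 => [|[|//]] _; rewrite ?subr0 ?subrr.
rewrite leq_eqVlt => /predU1P[->|ms].
  by rewrite divff ?pnatr_eq0 // subrr rho_diag.
rewrite rho_rec //.
apply: (@le_trans _ _ (binE m (stay s.+1) (fun i => 1 + (- (s.+1%:R)^-1) * i%:R))).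
  rewrite binED binE_cst binEZ binE_id; rewrite mulNr lerD2l lerN2 mulrCA.
  apply: ler_wpM2l; first exact: ler0n.
  rewrite mulrC ler_pdivrMr ?ltr0n // mulrC ler_pdivlMr ?ltr0n // mulrC.
  exact: stay_le.
apply: le_binE; first exact: stay_itv.
by move=> i im; rewrite mulNr mulrC; apply: IH; exact: leq_trans im _.
Qed.

(** The slopes satisfy c_s * [stay s.+1] = c_(s+1), so the linear function solves the recursion
    exactly. It is nonnegative on the diagonal, where [rho] vanishes, hence it dominates. *)
Lemma rho_le_linear s m : (m <= s.+1)%N ->
  rho p s.+1 m <= 1 - m%:R * (p * q ^+ s / (1 - q ^+ s.+1)).
Proof.
elim: s m => [|s IH] m.
  move=> m1; rewrite rho1 // expr0 expr1 mulr1 opprB addrCA subrr addr0.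
  rewrite divff ?lt0r_neq0 // mulr1.
  by case: m m1 => [|[|//]] _; rewrite ?subr0 ?subrr.
have [q0 q1] := q_in.
rewrite leq_eqVlt => /predU1P[->|ms].
  rewrite rho_diag subr_ge0 mulrA ler_pdivrMr ?one_sub_qX_gt0 // mul1r.
  move: (s.+1) => {IH}j; elim: j => [|j IH]; first by rewrite expr0 expr1; lra.
  have : (j.+1%:R + 1) * (p * q ^+ j.+1) <= q * (1 - q ^+ j.+1) + p * q ^+ j.+1.
    by move: (ler_wpM2l (ltW q0) IH); rewrite exprS; lra.
  have : q ^+ j.+1 <= 1 by rewrite exprn_ile1 ?ltW.
  rewrite -[j.+2%:R]natr1 [q ^+ j.+2]exprS; move: (_ ^+ j.+1) => z.
  by move: p_gt0 p_lt1 => p0 p1; nra.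
rewrite rho_rec //.
set c := p * q ^+ s / (1 - q ^+ s.+1).
apply: (@le_trans _ _ (binE m (stay s.+1) (fun i => 1 + (- c) * i%:R))).
  apply: le_binE; first exact: stay_itv.
  by move=> i im; rewrite mulNr mulrC; apply: IH; exact: leq_trans im _.
rewrite binED binE_cst binEZ binE_id mulNr mulrCA.
suff -> : c * stay s.+1 = p * q ^+ s.+1 / (1 - q ^+ s.+2) by [].
rewrite /c /stay_prob [q ^+ s.+1 in RHS]exprS.
by field; rewrite !lt0r_neq0 ?one_sub_qX_gt0.
Qed.

(** One step of the walk turns the exponential of base [1 - 8 d] into this power. Bernoulli's
    inequality on the whole power gives only 1 - 8 d - 8 d^2, too small at second order. Applied to
    each half and multiplied, it gains the missing 16 d^2. *)
Lemma le_step_ratio (h d : R) s m : (m <= s)%N -> 0 <= h <= 1 ->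
  s.+1%:R * h <= 1 + d -> 0 <= d <= 1 / 8 ->
  (1 + 8 * d ^+ 2) * (1 - 8 * d) <= (1 - h * (8 * d)) ^+ m.
Proof.
move=> ms /andP[h0 h1] sh /andP[d0 d1].
have hu : 0 <= h * (8 * d) <= 1 by apply/andP; split; nra.
have /andP[hu0 hu1] := hu.
have b0 : 0 <= 1 - h * (8 * d) by rewrite subr_ge0.
have b1 : 1 - h * (8 * d) <= 1 by rewrite gerBl.
apply: (@le_trans _ _ ((1 - h * (8 * d)) ^+ (uphalf s + uphalf s))); last first.
  apply: ler_wiXn2l => //; apply: leq_trans ms _.
  by rewrite addnn uphalf_half doubleD -{1}(odd_double_half s) leq_add2r; case: odd.
rewrite exprD; have := expr_sub1_ge (uphalf s) hu.
have : (uphalf s)%:R * 2 <= s.+1%:R :> R.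
  rewrite -natrM ler_nat muln2 uphalf_half doubleD -{3}(odd_double_half s).
  by rewrite -addSn leq_add2r; case: odd.
move: (_ ^+ _) => z; have := ler0n R (uphalf s).
move: ((uphalf s)%:R : R) (s.+1%:R : R) sh => t N sh t0 tN zt.
have E : 1 - (1 + d) * (8 * d) / 2 <= z.
  apply: le_trans zt; rewrite lerD2l lerN2.
  have : t * h * 2 <= 1 + d by nra.
  nra.
have : 0 <= 1 - (1 + d) * (8 * d) / 2 by nra.
move: E; set y := 1 - _ => E y0.
have : y * y <= z * z by nra.
apply: le_trans; rewrite /y expr2; nra.
Qed.

(* The right-hand side is a supersolution of the recursion [rho_rec]: as [rho] is
   nearly linear in the number [S + j - m] of discovered vertices, the linear term
   is corrected by exponentials decaying in that number. *)
Lemma rho_le_barrier S L : (0 < S)%N -> p * (S + L)%:R <= 1 / 8 ->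
    1 <= 8 * (p * (S + L)%:R) ^+ 2 * L%:R ->
  forall d : R, d = p * (S + L)%:R ->
  forall j m, (j <= L)%N -> (m <= S + j)%N ->
  rho p (S + j) m <= (S + j - m)%:R / S%:R
    + d * (L + j)%:R / S%:R * (1 - (1 - 8 * d) ^+ (S + j - m))
    + 2 * p * S%:R * (1 - (1 + 8 * d ^+ 2)^-1 ^+ (L - j) * (1 - 8 * d) ^+ (S + j - m)).
Proof.
case: S => // S _ hd hL d dE; rewrite -dE in hd hL.
have S0 : 0 < S.+1%:R :> R by rewrite ltr0n.
have d0 : 0 < d.
  rewrite dE mulr_gt0 // addSn ltr0n //.
have dle := hd.
have b0 : 0 <= 1 - 8 * d by lra.
have b1 : 1 - 8 * d <= 1 by lra.
have f1 : 1 <= 1 + 8 * d ^+ 2 by rewrite lerDl mulr_ge0 ?ler0n // exprn_ge0 // ltW.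
have f0 : 0 < 1 + 8 * d ^+ 2 by apply: lt_le_trans f1.
set b := 1 - 8 * d; set psi := (1 + 8 * d ^+ 2)^-1.
have bE : b = 1 - 8 * d by []. have psiE : psi = (1 + 8 * d ^+ 2)^-1 by [].
clearbody b psi.
have psi0 : 0 <= psi by rewrite psiE invr_ge0 ltW.
have psi1 : psi <= 1 by rewrite psiE invf_le1.
rewrite -bE in b0 b1.
have bX n : 0 <= b ^+ n <= 1 by rewrite exprn_ge0 ?exprn_ile1.
have psiX n : 0 <= psi ^+ n <= 1 by rewrite exprn_ge0 ?exprn_ile1.
elim=> [|j IH] m jL mS.
  rewrite addn0 in mS *; apply: (le_trans (rho_le_linear mS)).
  have h1 : 1 - m%:R * (p * q ^+ S / (1 - q ^+ S.+1)) <=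
      (S.+1 - m)%:R / S.+1%:R + p * S.+1%:R.
    have pS1 : p * S.+1%:R <= 1.
      apply: le_trans (_ : d <= 1); last by lra.
      by rewrite dE ler_wpM2l ?(ltW p_gt0) // ler_nat leq_addr.
    have /(@expr_sub1_ge _ _ S.+1) : 0 <= p <= 1 by rewrite !ltW.
    have /(@expr_sub1_ge _ _ S) : 0 <= p <= 1 by rewrite !ltW.
    move=> e1 e2.
    have D0 := one_sub_qX_gt0 S.
    have : (1 - p * S.+1%:R) / S.+1%:R <= p * q ^+ S / (1 - q ^+ S.+1).
      rewrite ler_pdivlMr // mulrAC ler_pdivrMr //.
      have e3 : 1 - q ^+ S.+1 <= p * S.+1%:R by lra.
      have e4 : 1 - p * S.+1%:R <= q ^+ S.
        by apply: le_trans e1; rewrite lerD2l lerN2 mulrC ler_wpM2l ?(ltW p_gt0) // ler_nat.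
      have e5 : 0 <= 1 - p * S.+1%:R by lra.
      apply: (@le_trans _ _ ((1 - p * S.+1%:R) * (p * S.+1%:R))).
        by apply: ler_wpM2l.
      have pS0 : 0 <= p * S.+1%:R by rewrite mulr_ge0 ?ler0n ?(ltW p_gt0).
      by have := ler_wpM2r pS0 e4; lra.
    move: (p * q ^+ S / _) => W hW.
    have m0 : 0 <= m%:R / S.+1%:R :> R by rewrite divr_ge0 ?ler0n.
    have m1 : m%:R / S.+1%:R <= 1 :> R by rewrite ler_pdivrMr ?mul1r ?ler_nat.
    have e6 : m%:R * ((1 - p * S.+1%:R) / S.+1%:R) <= m%:R * W.
      by apply: ler_wpM2l => //; exact: ler0n.
    have e7 : m%:R * ((1 - p * S.+1%:R) / S.+1%:R) =
        m%:R / S.+1%:R - p * S.+1%:R * (m%:R / S.+1%:R).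
      by field; rewrite addrC natr1 lt0r_neq0.
    have e8 : p * S.+1%:R * (m%:R / S.+1%:R) <= p * S.+1%:R * 1.
      by apply: ler_wpM2l => //; rewrite mulr_ge0 ?ler0n ?(ltW p_gt0).
    rewrite natrB // mulrBl divff ?lt0r_neq0 //.
    move: e6 e8; rewrite e7 mulr1; move: (_ / _) (p * _) (_ * W) => x y z; lra.
  apply: (le_trans h1); rewrite -addrA lerD2l.
  (* The lower bound on [L] is what makes [psi ^+ L] at most 1/2. The last barrier term is then at
     least [p * S.+1], the excess of the linear bound, even at height 0. *)
  have h2 : psi ^+ L <= 1 / 2.
    have : 1 + L%:R * (8 * d ^+ 2) <= (1 + 8 * d ^+ 2) ^+ L.
      elim: (L) => [|l IHl]; first by rewrite mul0r addr0 expr0.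
      rewrite [(_ + _) ^+ l.+1]exprS; have := ler_wpM2l (ltW f0) IHl.
      apply: le_trans; rewrite -natr1.
      have := ler0n R l; move: f1; rewrite lerDl.
      move: (l%:R : R) (8 * d ^+ 2) => c e e0 c0; nra.
    rewrite psiE exprVn div1r lef_pV2 ?posrE ?ltr0n ?exprn_gt0 //.
    apply: le_trans; rewrite [L%:R * _]mulrC; move: hL; lra.
  rewrite addn0 subn0.
  have /andP[z0 z1] := bX (S.+1 - m)%N; have /andP[w0 w1] := psiX L.
  move: (b ^+ _) (psi ^+ _) z0 z1 w0 w1 h2 => z w z0 z1 w0 w1 h2.
  have : 0 <= d * L%:R / S.+1%:R * (1 - z).
    by rewrite !mulr_ge0 ?invr_ge0 ?ler0n ?subr_ge0 // ltW.
  have : p * S.+1%:R * (1 / 2) <= p * S.+1%:R * (1 - w * z).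
    apply: ler_wpM2l; first by rewrite mulr_ge0 ?ler0n ?(ltW p_gt0).
    nra.
  move=> e1 e2; rewrite -[X in X <= _]add0r; apply: lerD => //.
  by move: e1; move: (S.+1%:R : R) => N; lra.
have jL' : (j <= L)%N by exact: ltnW.
have LjE : (L - j = (L - j.+1).+1)%N by rewrite subnSK.
move: mS; rewrite addnS leq_eqVlt => /predU1P[->|ms].
  rewrite subnn rho_diag expr0 subrr mulr1 mulr0 mul0r addr0 add0r.
  have /andP[w0 w1] := psiX (L - j.+1)%N.
  by rewrite !mulr_ge0 ?ler0n ?subr_ge0 ?(ltW p_gt0).
rewrite ltnS in ms; rewrite rho_rec //.
set pi := stay _.
pose A := d * (L + j)%:R / S.+1%:R; pose B := 2 * p * S.+1%:R.
pose w := psi ^+ (L - j).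
apply: (@le_trans _ _ (binE m pi (fun i => ((S.+1 + j)%:R / S.+1%:R + A + B) +
   ((- S.+1%:R^-1) * i%:R + (- (A + B * w)) * b ^+ (S.+1 + j - i))))).
  apply: le_binE; first exact: stay_itv.
  move=> i im; have iS : (i <= S.+1 + j)%N by exact: leq_trans im _.
  have := IH i jL' iS; rewrite -/A -/B -/w => /le_trans; apply.
  rewrite natrB // /B; move: (b ^+ _) A w => z A w; move: (S.+1%:R^-1 : R) => y.
  by rewrite le_eqVlt; apply/orP; left; apply/eqP; ring.
rewrite binED binE_cst binED !binEZ binE_id binE_exp_sub //.
set h := 1 - pi; set r := (1 - _) ^+ m.
have /andP[pi0 pi1] : 0 <= pi <= 1 by exact: stay_itv.
have h01 : 0 <= h <= 1 by rewrite /h subr_ge0 pi1 gerBl.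
have hz : (S.+1 + j).+1%:R * h <= 1 + d.
  apply: (le_trans (hazard_le _)); rewrite lerD2l mulrC dE.
  apply: ler_wpM2l; first exact: ltW.
  by rewrite ler_nat -addnS leq_add2l.
have rge : (1 + 8 * d ^+ 2) * b <= r.
  rewrite /r bE; have -> : 1 - (1 - 8 * d) = 8 * d by ring.
  apply: (le_step_ratio ms h01 hz); apply/andP; split=> //; exact: ltW.
have mh : m%:R * h <= 1 + d.
  apply: le_trans hz; apply: ler_wpM2r; first by case/andP: h01.
  by rewrite ler_nat leqW.
have wE : w * (1 + 8 * d ^+ 2) = psi ^+ (L - j.+1).
  by rewrite /w LjE exprSr psiE -mulrA mulVf ?mulr1 // lt0r_neq0.
have /andP[X0 X1] := bX (S.+1 + j - m)%N.
have -> : ((S.+1 + j).+1 - m = (S.+1 + j - m).+1)%N by rewrite subSn.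
rewrite -wE [b ^+ _.+1]exprS.
have -> : (S.+1 + j - m).+1%:R = (S.+1 + j)%:R + 1 - m%:R :> R.
  by rewrite -natr1 natrB //; ring.
have -> : d * (L + j.+1)%:R / S.+1%:R = A + d / S.+1%:R.
  rewrite /A addnS -natr1; ring.
have w0 : 0 <= w by case/andP: (psiX (L - j)%N).
have A0 : 0 <= A by rewrite !mulr_ge0 ?invr_ge0 ?ler0n // ltW.
have B0 : 0 <= B by rewrite !mulr_ge0 ?ler0n // ltW.
(* As [m * h <= 1 + d], a step raises the linear term by up to [d / S.+1] too much. The growth of
   [A] by that amount compensates, except for a multiple of the exponential, which the gain
   [8 * d ^+ 2] from [rge] pays for. *)
have AL : d / S.+1%:R <= A * (8 * d ^+ 2).
  have dS : 0 <= d / S.+1%:R by rewrite mulr_ge0 ?invr_ge0 ?(ltW d0) ?ler0n.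
  have e1 : 1 <= (L + j)%:R * (8 * d ^+ 2).
    apply: (le_trans hL); rewrite mulrC; apply: ler_wpM2r.
      by rewrite mulr_ge0 ?ler0n // exprn_ge0 // ltW.
    by rewrite ler_nat leq_addr.
  have := ler_wpM2l dS e1; rewrite mulr1 => /le_trans; apply.
  by rewrite le_eqVlt /A; apply/orP; left; apply/eqP; ring.
have lin : m%:R * h / S.+1%:R <= (1 + d) / S.+1%:R.
  by apply: ler_wpM2r => //; rewrite invr_ge0 ltW.
have -> : pi = 1 - h by rewrite /h; ring.
rewrite -/B; clearbody A B w r.
move: lin AL rge X0 X1; move: (S.+1%:R^-1 : R) => iS.
move: (b ^+ _) => X lin AL rge X0 X1.
have Xr : (A + B * w) * ((1 + 8 * d ^+ 2) * b) * X <= (A + B * w) * r * X.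
  apply: ler_wpM2r => //; apply: ler_wpM2l => //.
  by rewrite addr_ge0 // mulr_ge0.
have bX0 : 0 <= b * X by rewrite mulr_ge0.
have AX : d * iS * (b * X) <= A * (8 * d ^+ 2) * (b * X) by apply: ler_wpM2r.
move: Xr AX lin; rewrite bE; move: (8 * d ^+ 2) => e; lra.
Qed.

End Walk.

Section WalkBounds.
Variables (R : realFieldType) (p : R).
Hypotheses (p_gt0 : 0 < p) (p_lt1 : p < 1).
Local Notation q := (1 - p).
Local Notation stay := (stay_prob p).

(** The barrier is read at height 1, where the exponential terms contribute 1 - b = 8 d times
    coefficients of order d. The hypothesis [1 <= p ^+ 2 * k%:R ^+ 3] says that 1/k <= d^2, which
    covers the linear term. *)
Lemma rho_upper k : p * k%:R <= 1 / 8 -> 1 <= p ^+ 2 * k%:R ^+ 3 ->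
  rho p k k.-1 <= 67 * (p * k%:R) ^+ 2.
Proof.
move=> hd hk; set d := p * k%:R.
have k2 : (1 < k)%N.
  have k1 : 1 < k%:R :> R.
    rewrite ltNge; apply/negP => k1; have k0 := ler0n R k.
    have : 1 <= d ^+ 2 * k%:R by rewrite /d; lra.
    have : 0 <= d by rewrite mulr_ge0 // ltW.
    have : d <= 1 / 8 by [].
    by move: d {hd hk} => d d1 d2; nra.
  by move: k1; rewrite ltr1n.
have d0 : 0 < d by rewrite mulr_gt0 // ltr0n (ltn_trans _ k2).
have kE := odd_double_half k.
have S0 : (0 < k./2)%N by rewrite half_gt0.
set S := k./2 in S0 kE *; pose L := (k - S)%N.
have SL : (S + L = k)%N by rewrite /L subnKC // -kE -addnn addnCA leq_addr.
have LS : (S <= L)%N by rewrite -(leq_add2l S) SL -kE addnn leq_addl.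
have S3 : (k <= 3 * S)%N.
  by rewrite mulSn mul2n -kE leq_add2r; case: (odd k).
have Lk : k%:R / 2 <= L%:R :> R.
  rewrite ler_pdivrMr // -natrM ler_nat -SL muln2 -addnn leq_add2r //.
have hL : 1 <= 8 * (p * (S + L)%:R) ^+ 2 * L%:R.
  rewrite SL; apply: (le_trans hk).
  have : (8 * (p * k%:R) ^+ 2) * (k%:R / 2) <= (8 * (p * k%:R) ^+ 2) * L%:R.
    by apply: ler_wpM2l => //; rewrite mulr_ge0 // exprn_ge0 // ltW.
  apply: le_trans; have : 0 <= p ^+ 2 * k%:R ^+ 3 by rewrite mulr_ge0 ?exprn_ge0 ?ler0n // ltW.
  lra.
rewrite SL in hL.
have := @rho_le_barrier _ p p_gt0 p_lt1 S L S0; rewrite SL => /(_ hd hL d erefl L k.-1 (leqnn _)).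
have km1 : (k.-1 <= S + L)%N by rewrite SL leq_pred.
move=> /(_ km1); rewrite SL subnn expr0.
have -> : (k - k.-1 = 1)%N by rewrite -subn1 subKn // ltnW.
move/le_trans; apply; rewrite expr1 mul1r.
have kR : 0 < k%:R :> R by rewrite ltr0n (ltn_trans _ k2).
have SR : 0 < S%:R :> R by rewrite ltr0n.
have iS : S%:R^-1 <= 3 / k%:R :> R.
  by rewrite ler_pdivlMr // mulrC ler_pdivrMr // -natrM ler_nat.
have ik : k%:R^-1 <= d ^+ 2.
  rewrite -(ler_pM2r kR) mulVf ?lt0r_neq0 //; apply: (le_trans hk).
  by rewrite /d; lra.
have LL : (L + L)%:R <= 2 * k%:R :> R.
  by rewrite -natrM ler_nat addnn mul2n leq_double -SL leq_addl.
have e1 : (d * (L + L)%:R) / S%:R <= (d * (2 * k%:R)) * (3 / k%:R).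
  have e0 := ler_wpM2l (ltW d0) LL.
  apply: ler_pM e0 iS; last by rewrite invr_ge0 ler0n.
  by rewrite mulr_ge0 ?ler0n ?ltW.
have e2 : (d * (2 * k%:R)) * (3 / k%:R) = 6 * d by field; rewrite lt0r_neq0.
have e3 : p * S%:R <= d / 2.
  rewrite /d -mulrA ler_wpM2l ?(ltW p_gt0) // ler_pdivlMr // -natrM ler_nat muln2 -addnn -[in X in (_ <= X)%N]SL.
  by rewrite leq_add2l.
move: e1; rewrite e2 => e1.
have -> : 1 - (1 - 8 * d) = 8 * d by ring.
have e4 : (d * (L + L)%:R) / S%:R * (8 * d) <= 6 * d * (8 * d).
  by apply: ler_wpM2r => //; rewrite mulr_ge0 // ltW.
have e5 : p * S%:R * (8 * d) <= d / 2 * (8 * d).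
  by apply: ler_wpM2r => //; rewrite mulr_ge0 // ltW.
have e6 : 0 <= d ^+ 2 by rewrite exprn_ge0 // ltW.
move: e4 e5 iS ik; clearbody d.
move: (S%:R^-1 : R) (k%:R^-1 : R) (S%:R : R) => y z s; lra.
Qed.

(* The induction goes through only while the linear term is small; otherwise
   [rho_ge_linear] already suffices, at the price of the factor [1 / 2]. *)
Lemma rho_ge_barrier S L : (0 < S)%N -> (L <= S)%N -> p * (S + L)%:R <= 1 ->
  forall b : R, b = 1 - p * (S + L)%:R / 64 ->
  forall j m, (j <= L)%N -> (m <= S + j)%N ->
  ((S + j - m)%:R / (S + j)%:R + p / 8 * j%:R * (1 - b ^+ (S + j - m))) / 2
    <= rho p (S + j) m.
Proof.
case: S => // S _ LS hp b bE.
have kR : 0 < (S.+1 + L)%:R :> R by rewrite addSn ltr0n.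
set u := p * (S.+1 + L)%:R / 64 in bE.
have u0 : 0 < u by rewrite divr_gt0 ?mulr_gt0 ?ltr0n.
have u1 : u <= 1 / 64 by rewrite /u; lra.
have b0 : 0 <= b by lra.
have b1 : b <= 1 by lra.
have bX n : 0 <= b ^+ n <= 1 by rewrite exprn_ge0 ?exprn_ile1.
have ge1 j m : (m <= S.+1 + j)%N -> (S.+1 + j - m)%:R / (S.+1 + j)%:R <= rho p (S.+1 + j) m.
  move=> ms; have := rho_ge_linear p_gt0 p_lt1 (isT : 0 < (S + j).+1)%N ms.
  by rewrite natrB // mulrBl divff // addSn pnatr_eq0.
have ge0y j m : 0 <= (S.+1 + j - m)%:R / (S.+1 + j)%:R :> R by rewrite divr_ge0 ?ler0n.
have bound j m : (j <= L)%N -> p / 8 * j%:R * (1 - b ^+ (S.+1 + j - m)) <= p * L%:R / 8.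
  move=> jL; have /andP[z0 z1] := bX (S.+1 + j - m)%N.
  have : p / 8 * j%:R <= p / 8 * L%:R.
    by rewrite ler_wpM2l ?ler_nat // divr_ge0 ?ler0n // ltW.
  have : 0 <= p / 8 * j%:R by rewrite mulr_ge0 ?ler0n // divr_ge0 ?ler0n // ltW.
  move: (b ^+ _) (p / 8 * j%:R) z0 z1 => z x; nra.
elim=> [|j IH] m jL ms.
  rewrite mulr0 mul0r addr0; apply: le_trans (ge1 _ _ ms).
  have := ge0y 0%N m; lra.
have jL' : (j <= L)%N by exact: ltnW.
have [big|small] := lerP (p * L%:R / 8) ((S.+1 + j.+1 - m)%:R / (S.+1 + j.+1)%:R).
  apply: le_trans (ge1 _ _ ms); have := bound _ m jL; lra.
move: ms; rewrite leq_eqVlt => /predU1P[E|ms].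
  by rewrite E subnn expr0 subrr mulr0 mul0r add0r mul0r addnS rho_diag.
move: small ms; rewrite !addnS => small; rewrite ltnS => ms.
rewrite rho_rec //.
set pi := stay _; set A := p / 8 * j%:R.
set s := (S.+1 + j)%N in ms small *.
apply: (@le_trans _ _ (binE m pi (fun i => (1 + A) / 2 +
   ((- (s%:R^-1 / 2)) * i%:R + (- (A / 2)) * b ^+ (s - i))))); last first.
  apply: le_binE; first exact: stay_itv.
  move=> i im; have iS : (i <= s)%N by exact: leq_trans im _.
  apply: le_trans (IH i jL' iS).
  rewrite -/A natrB // mulrBl divff ?pnatr_eq0 //; lra.
rewrite binED binE_cst binED !binEZ binE_id binE_exp_sub //.
set h := 1 - pi; set r := (1 - _) ^+ m.
have s0 : 0 < s%:R :> R by rewrite ltr0n.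
have s10 : 0 < s.+1%:R :> R by rewrite ltr0n.
have psk : p * s%:R <= 1.
  by apply: le_trans hp; rewrite ler_wpM2l ?(ltW p_gt0) // ler_nat leq_add2l.
have piS : pi / s%:R <= (1 - p / 4) / s.+1%:R.
  rewrite ler_pdivrMr //; apply: le_trans (stay_le_strong p_gt0 p_lt1 (isT : 0 < s)%N psk) _.
  by rewrite le_eqVlt; apply/orP; left; apply/eqP; ring.
have my : 1 - p * L%:R / 8 <= m%:R / s.+1%:R.
  move: small; rewrite natrB ?(leqW ms) // mulrBl divff ?pnatr_eq0 //.
  by move: (m%:R / _) (p * L%:R) => x y; lra.
have Ls : p * L%:R <= p * s%:R.
  by rewrite ler_wpM2l ?(ltW p_gt0) // ler_nat (leq_trans LS) // leq_addr.
have us : u <= p * s%:R / 32.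
  have : (S.+1 + L)%:R <= 2 * s%:R :> R.
    by rewrite -natrM ler_nat mul2n -addnn leq_add // ?leq_addr // (leq_trans LS) // leq_addr.
  move/(ler_wpM2l (ltW p_gt0)); rewrite /u; lra.
have sh : 1 + p * s%:R / 4 <= s.+1%:R * h.
  have := stay_le_strong p_gt0 p_lt1 (isT : 0 < s)%N psk; rewrite -/pi => e.
  have e2 : s.+1%:R * (s%:R / s.+1%:R * (1 - p / 4)) = s%:R * (1 - p / 4).
    by rewrite mulrA [s%:R / _]mulrC mulVKf ?lt0r_neq0.
  have := ler_wpM2l (ltW s10) e; rewrite e2 /h.
  by rewrite -[s.+1%:R]natr1; lra.
have mh : 1 + p * s%:R / 16 <= m%:R * h.
  have -> : m%:R * h = m%:R / s.+1%:R * (s.+1%:R * h).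
    by rewrite mulrA divfK ?lt0r_neq0.
  have p0 : 0 <= p * L%:R by rewrite mulr_ge0 ?ler0n // ltW.
  move: my sh Ls psk p0; move: (_ / s.+1%:R) (s.+1%:R * h) (p * s%:R) (p * L%:R) => x y z t; nra.
have h01 : 0 <= h <= 1.
  have /andP[h0 h1] : 0 <= pi <= 1 by exact: stay_itv.
  by rewrite /h subr_ge0 h1 gerBl.
(* Here [b = 1 - u] and [r] is at most 1 / (1 + m h u). The excess [p s / 16] of the drift [m h]
   over 1 beats [u <= p s / 32], and the 64 in [b] is chosen for this. *)
have rb : r <= b.
  have ub : 1 - b = u by rewrite bE; ring.
  have hu : 0 <= h * (1 - b) <= 1 by rewrite ub; case/andP: h01 => h0 h1; apply/andP; split; nra.
  have := expr_sub1_mul_le m hu; rewrite -/r ub => e.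
  have r0 : 0 <= r by rewrite exprn_ge0 // subr_ge0; case/andP: hu.
  have ps0 : 0 <= p * s%:R by rewrite mulr_ge0 ?ler0n // ltW.
  have e1 : (1 + p * s%:R / 16) * u <= m%:R * (h * u) by rewrite mulrA ler_wpM2r // ltW.
  have e2 : r * (1 + (1 + p * s%:R / 16) * u) <= 1.
    by apply: le_trans e; rewrite ler_wpM2l // lerD2l.
  have e3 : 1 <= b * (1 + (1 + p * s%:R / 16) * u) by rewrite bE; move: (p * s%:R) us psk ps0 => t; nra.
  rewrite -(ler_pM2r (_ : 0 < 1 + (1 + p * s%:R / 16) * u)); first exact: le_trans e3.
  by move: (p * s%:R) ps0 => t; nra.
have -> : (s.+1 - m = (s - m).+1)%N by rewrite subSn.
have /andP[X0 X1] := bX (s - m)%N.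
have A0 : 0 <= A by rewrite mulr_ge0 ?ler0n // divr_ge0 ?ler0n // ltW.
have -> : p / 8 * j.+1%:R = A + p / 8 by rewrite /A -natr1; ring.
have -> : (s - m).+1%:R / s.+1%:R = 1 - m%:R / s.+1%:R :> R.
  by rewrite -subSn // natrB ?(leqW ms) // mulrBl divff ?lt0r_neq0.
rewrite [b ^+ _.+1]exprS.
have lin : m%:R * (pi / s%:R) <= m%:R * ((1 - p / 4) / s.+1%:R) by rewrite ler_wpM2l ?ler0n.
(* In this case [m / s.+1] is at least 1/2, so the gain p/4 of [stay_le_strong] pays for the growth
   p/8 of the exponential coefficient. *)
have mp : p / 8 <= p / 4 * (m%:R / s.+1%:R).
  have : 1 / 2 <= m%:R / s.+1%:R :> R by move: my Ls psk; move: (m%:R / _) (p * s%:R) (p * L%:R) => x y z; lra.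
  by move: (_ / s.+1%:R) => x; move: p_gt0 => p0; nra.
have Xr : A * r * b ^+ (s - m) <= A * b * b ^+ (s - m).
  by apply: ler_wpM2r => //; apply: ler_wpM2l.
have bb : 0 <= b * b ^+ (s - m) by rewrite mulr_ge0.
have pb : 0 <= p / 8 * (b * b ^+ (s - m)) by rewrite mulr_ge0 // divr_ge0 ?ler0n // ltW.
move: lin mp Xr pb; clearbody A r pi s.
move: (b ^+ _) (s.+1%:R^-1 : R) (s%:R^-1 : R) => X t v; lra.
Qed.

(** At height 1 the exponential term is p/8 times [L >= k / 3] times 1 - b = p k / 64, and the
    barrier halves it: 8 * 3 * 64 * 2 = 3 * 32 * 32. *)
Lemma rho_lower k : (2 <= k)%N -> p * k%:R <= 1 ->
  (p * k%:R) ^+ 2 / (3 * 32 * 32) <= rho p k k.-1.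
Proof.
move=> k2 hp.
have kE := odd_double_half k.
pose L := k./2; pose S := (k - L)%N.
have L0 : (0 < L)%N by rewrite half_gt0.
have SL : (S + L = k)%N by rewrite /S subnK // -kE -addnn addnCA leq_addr.
have LS : (L <= S)%N by rewrite -(leq_add2r L) SL -kE addnn leq_addl.
have S0 : (0 < S)%N by exact: (leq_trans L0).
have L3 : (k <= 3 * L)%N.
  by rewrite mulSn mul2n -kE leq_add2r; case: (odd k) L0.
have hp' : p * (S + L)%:R <= 1 by rewrite SL.
have := rho_ge_barrier S0 LS hp' erefl (leqnn L); rewrite SL => /(_ k.-1 (leq_pred _)).
apply: le_trans; have -> : (k - k.-1 = 1)%N by rewrite -subn1 subKn // ltnW.
rewrite expr1.
have L3R : k%:R / 3 <= L%:R :> R by rewrite ler_pdivrMr // -natrM ler_nat mulnC.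
have kV : 0 <= 1 / k%:R :> R by rewrite divr_ge0 ?ler0n.
have pk : 0 <= p * k%:R by rewrite mulr_ge0 ?ler0n // ltW.
have : p / 8 * (k%:R / 3) * (p * k%:R / 64) <= p / 8 * L%:R * (p * k%:R / 64).
  apply: ler_wpM2r; first by rewrite divr_ge0.
  by apply: ler_wpM2l => //; rewrite divr_ge0 // ltW.
move: kV; move: (1 / k%:R) => z; lra.
Qed.

End WalkBounds.

(** * Components of the random graph *)

Section EdgeExpectation.
Variables (R : comNzRingType) (T : finType) (p : R).
Implicit Types (A B F G : {set T}) (f g : {set T} -> R).

(** Allowing an arbitrary set [F] of independent edges, rather than the complete graph, lets
    independence be expressed by splitting [F]. *)
Definition edgeE F f : R :=
  \sum_(A in powerset F) (\prod_(e in F) (if e \in A then p else 1 - p)) * f A.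

Lemma eq_edgeE F f g : (forall A, A \subset F -> f A = g A) -> edgeE F f = edgeE F g.
Proof. by move=> fg; apply: eq_bigr => A; rewrite inE => /fg ->. Qed.

Lemma edgeEZ F c f : edgeE F (fun A => c * f A) = c * edgeE F f.
Proof. by rewrite /edgeE mulr_sumr; apply: eq_bigr => A _; rewrite mulrCA. Qed.

Lemma edgeEZr F c f : edgeE F (fun A => f A * c) = edgeE F f * c.
Proof. by rewrite /edgeE mulr_suml; apply: eq_bigr => A _; rewrite mulrA. Qed.

Lemma edgeED F f g : edgeE F (fun A => f A + g A) = edgeE F f + edgeE F g.
Proof. by rewrite /edgeE -big_split; apply: eq_bigr => A _; rewrite mulrDr. Qed.

Lemma edgeE_sum (I : finType) (P : pred I) F (f : I -> {set T} -> R) :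
  edgeE F (fun A => \sum_(i | P i) f i A) = \sum_(i | P i) edgeE F (f i).
Proof.
by rewrite /edgeE exchange_big /=; apply: eq_bigr => A _; rewrite mulr_sumr.
Qed.

Lemma edgeE1 F : edgeE F (fun=> 1) = 1.
Proof.
pose f e : R := if e \in F then p else 0.
pose g e : R := if e \in F then 1 - p else 1.
have E : \prod_e (f e + g e) = 1.
  by apply: big1 => e _; rewrite /f /g; case: ifP => _; rewrite ?add0r // addrC subrK.
rewrite -[RHS]E bigA_distr /edgeE [RHS](bigID (fun A => A \in powerset F)) /=.
rewrite [X in _ = _ + X]big1 ?addr0 => [|A]; last first.
  rewrite inE => /subsetPn[e eA eF].
  by rewrite (bigD1 e) //= eA /f (negbTE eF) mul0r.
apply: eq_big => [A|A]; first by [].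
rewrite inE => /subsetP sAF; rewrite mulr1 big_mkcond /=.
apply: eq_bigr => e _; rewrite /f /g; case: ifP => // eF.
by case: ifP => // /sAF; rewrite eF.
Qed.

Lemma edgeE_set0 F : edgeE F (fun A => (A == set0)%:R) = (1 - p) ^+ #|F|.
Proof.
rewrite /edgeE (bigD1 set0) ?inE ?sub0set //= eqxx mulr1.
rewrite [X in _ + X]big1 ?addr0; last by move=> A /andP[_ /negbTE->]; rewrite mulr0.
by rewrite (eq_bigr (fun=> 1 - p)) => [|e _]; rewrite ?prodr_const // inE.
Qed.

Lemma edgeE_split F G f : [disjoint F & G] ->
  edgeE (F :|: G) f = edgeE F (fun A => edgeE G (fun B => f (A :|: B))).
Proof.
move=> dFG.
have dis (x : T) : x \in F -> x \in G -> false.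
  by move=> xF xG; move: dFG; rewrite disjoints_subset => /subsetP/(_ x xF); rewrite inE xG.
rewrite {1}/edgeE (partition_big (fun A => A :&: F) (fun A => A \in powerset F)) /=; last first.
  by move=> A _; rewrite inE subsetIr.
apply: eq_bigr => A; rewrite inE => AF.
rewrite (reindex_onto (fun B => A :|: B) (fun C => C :&: G)) /=; last first.
  move=> C /andP[]; rewrite inE => CFG /eqP <-.
  by rewrite -setIUr; apply/setIidPl.
rewrite mulr_sumr; apply: eq_big => [B|B].
  rewrite !inE; apply/andP/idP => [[_ /eqP<-]|BG]; first exact: subsetIr.
  split; last first.
    apply/eqP/setP => x; rewrite !inE andb_orl.
    case xG: (x \in G); rewrite ?andbF ?andbT /=; last first.
      by apply/esym/negbTE; apply/negP => /(subsetP BG); rewrite xG.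
    by case xA: (x \in A) => //; have := dis x (subsetP AF _ xA) xG.
  apply/andP; split; first exact: setUSS.
  apply/eqP/setP => x; rewrite !inE andb_orl.
  case xF: (x \in F); rewrite ?andbF ?andbT /=; last first.
    by apply/esym/negbTE; apply/negP => /(subsetP AF); rewrite xF.
  case xA: (x \in A) => //=; apply/negbTE/negP => /(subsetP BG) xG.
  by have := dis x xF xG.
move=> /andP[/andP[_ /eqP hA] /eqP hB]; rewrite mulrA; congr (_ * _).
rewrite (eq_bigl (fun x => (x \in F) || (x \in G))); last by move=> x; rewrite inE.
rewrite bigU //=; congr (_ * _).
  by apply: eq_bigr => e eF; move/setP/(_ e): hA; rewrite in_setI eF andbT => ->.
by apply: eq_bigr => e eG; move/setP/(_ e): hB; rewrite in_setI eG andbT => ->.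
Qed.

End EdgeExpectation.

Lemma ler_edgeE (R : numDomainType) (T : finType) (p : R) (F : {set T})
    (f g : {set T} -> R) :
  0 <= p <= 1 -> (forall A : {set T}, A \subset F -> f A <= g A) ->
  edgeE p F f <= edgeE p F g.
Proof.
move=> /andP[p0 p1] fg; apply: ler_sum => A; rewrite inE => AF.
apply: ler_wpM2l; last exact: fg.
by apply: prodr_ge0 => e _; case: ifP => _; rewrite ?subr_ge0.
Qed.

Section Components.
Variable n : nat.
Implicit Types (V S : {set 'I_n}) (E A B X : {set {set 'I_n}}) (u v x y : 'I_n).

Definition edges V : {set {set 'I_n}} := [set e : {set 'I_n} | e \subset V & #|e| == 2].

Definition cross S V : {set {set 'I_n}} := edges V :\: (edges S :|: edges (V :\: S)).

Lemma edgesT : edges [set: 'I_n] = complete_edges n.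
Proof. by apply/setP => e; rewrite !inE subsetT. Qed.

Lemma mem_component E v w : (w \in component E v) = connect (adj E) v w.
Proof. by rewrite inE. Qed.

Lemma adj_sym E : symmetric (adj E).
Proof. by move=> x y; rewrite /adj setUC. Qed.

Lemma component_refl E v : v \in component E v.
Proof. by rewrite mem_component connect0. Qed.

Lemma component_eq E u v : u \in component E v -> component E u = component E v.
Proof.
rewrite mem_component => uv; apply/setP => w; rewrite !mem_component.
apply/idP/idP; first exact: connect_trans.
by apply: connect_trans; rewrite (sym_connect_sym (@adj_sym E)).
Qed.

Lemma component_cut A B S S' v : A \subset edges S -> B \subset edges S' ->
  [disjoint S & S'] -> v \in S -> component (A :|: B) v = component A v.
Proof.
move=> AS BS' dS vS; apply/setP => w; rewrite !mem_component; apply/idP/idP; last first.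
  apply: connect_sub => x y xy; apply: connect1; by rewrite /adj inE; apply/orP; left.
case/connectP => s; elim: s v vS => [|y s IH] x xS /=; first by move=> _ ->; exact: connect0.
move=> /andP[]; rewrite /adj inE => /orP[xy|xy].
  move=> ps lw; have yS : y \in S.
    have := subsetP AS _ xy; rewrite inE => /andP[/subsetP h _]; apply: h.
    by rewrite !inE eqxx orbT.
  exact: connect_trans (connect1 xy) (IH y yS ps lw).
have := subsetP BS' _ xy; rewrite inE => /andP[/subsetP/(_ x) h _].
have : x \in S' by apply: h; rewrite !inE eqxx.
by move/(disjointFl dS); rewrite xS.
Qed.

Lemma component_sub E V v : E \subset edges V -> v \in V -> component E v \subset V.
Proof.
move=> EV vV; apply/subsetP => w; rewrite mem_component => /connectP[s].
elim: s v vV => [|y s IH] x xV /=; first by move=> _ ->.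
move=> /andP[xy]; apply: IH.
have := subsetP EV _ xy; rewrite inE => /andP[/subsetP h _]; apply: h.
by rewrite !inE eqxx orbT.
Qed.

Lemma edges_split S V : S \subset V ->
  edges V = edges S :|: (cross S V :|: edges (V :\: S)).
Proof.
move=> SV; apply/setP => e; rewrite /cross !inE.
have h1 : e \subset S -> e \subset V by move/subset_trans; apply.
have h2 : e \subset V :\: S -> e \subset V by move/subset_trans; apply; rewrite subDset subsetUr.
case: (#|e| == 2); rewrite ?andbF ?andbT //=.
case: (e \subset S) h1 => [->//|_]; case: (e \subset V :\: S) h2 => [->//|_] /=.
by rewrite !orbF.
Qed.

Lemma disjoint_edges S S' : [disjoint S & S'] -> [disjoint edges S & edges S'].
Proof.
move=> dS; rewrite disjoints_subset; apply/subsetP => e; rewrite !inE => /andP[eS e2].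
rewrite e2 andbT; apply/negP => eS'.
have [x xe] : exists x, x \in e by apply/card_gt0P; rewrite (eqP e2).
by have := disjointFl dS (subsetP eS' _ xe); rewrite (subsetP eS).
Qed.

Lemma disjoint_setD S V : [disjoint S & V :\: S].
Proof. by rewrite disjoints_subset; apply/subsetP => x xS; rewrite !inE xS. Qed.

Lemma disjoint_cross S V : S \subset V ->
  [disjoint edges S & cross S V :|: edges (V :\: S)] /\
  [disjoint cross S V & edges (V :\: S)].
Proof.
move=> SV; have d := disjoint_edges (disjoint_setD S V); split.
  rewrite disjoints_subset; apply/subsetP => e eS; rewrite in_setC in_setU /cross in_setD in_setU eS /=.
  by rewrite (disjointFr d).
rewrite disjoints_subset; apply/subsetP => e; rewrite /cross in_setD in_setU in_setC.
by rewrite negb_or -andbA => /and3P[].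
Qed.

Lemma card_cross S V : S \subset V -> #|cross S V| = (#|S| * #|V :\: S|)%N.
Proof.
move=> SV; have [d1 d2] := disjoint_cross SV.
have binD a b : ('C(a + b, 2) = 'C(a, 2) + (a * b + 'C(b, 2)))%N.
  elim: a => [|a IH]; first by rewrite add0n bin0n mul0n !add0n.
  by rewrite addSn !binS IH !bin1 mulSn; lia.
have := congr1 (fun F : {set {set 'I_n}} => #|F|) (edges_split SV).
rewrite /= cardsU (disjoint_setI0 d1) cards0 subn0 cardsU (disjoint_setI0 d2) cards0 subn0.
rewrite /edges !cards_draws.
have <- : (#|S| + #|V :\: S| = #|V|)%N.
  by rewrite -(cardsID S V) (setIidPr SV).
by rewrite binD => /addnI/addIn <-.
Qed.

Lemma component_cross A X B S V v : S \subset V -> v \in S ->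
  A \subset edges S -> X \subset cross S V -> B \subset edges (V :\: S) ->
  (component (A :|: (X :|: B)) v == S) = (component A v == S) && (X == set0).
Proof.
move=> SV vS AS XC BS.
have [->|[e eX]] := set_0Vmem X.
  by rewrite set0U eqxx andbT (component_cut AS BS (disjoint_setD S V) vS).
have -> : (X == set0) = false by apply/negbTE/set0Pn; exists e.
rewrite andbF; apply/negP => /eqP cS.
have := subsetP XC _ eX; rewrite !inE negb_or => /andP[/andP[]].
move=> h1 h2 /andP[eV e2]; move: h1 h2; rewrite e2 !andbT => h1 h2.
have [x [y [exy xS yS]]] : exists x y, [/\ e = [set x; y], x \in S & y \notin S].
  case/cards2P: e2 => x [y [xy exy]].
  move: h1 h2 eV; rewrite exy !subUset !sub1set !inE.
  case xS: (x \in S); case yS: (y \in S) => //=.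
  - by exists x, y; rewrite xS yS.
  - by exists y, x; rewrite xS yS setUC.
  - by move=> _ /negP h /h.
have : y \in component (A :|: (X :|: B)) v.
  rewrite mem_component; apply: (@connect_trans _ _ x); first by rewrite -mem_component cS.
  by apply: connect1; rewrite /adj -exy !inE eX orbT.
by rewrite cS (negbTE yS).
Qed.

End Components.

Lemma bin_mul_split m i l : (i + l <= m)%N ->
  ('C(m, i) * 'C(m - i, l) = 'C(m, i + l) * 'C(i + l, i))%N.
Proof.
move=> ilm; have im : (i <= m)%N := leq_trans (leq_addr _ _) ilm.
have h0 : (0 < i`! * (l`! * (m - (i + l))`!))%N by rewrite !muln_gt0 !fact_gt0.
apply/eqP; rewrite -(eqn_pmul2r h0); apply/eqP.
have e1 := bin_fact im; have e2 := bin_fact ilm.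
have e3 : ('C(m - i, l) * (l`! * (m - (i + l))`!) = (m - i)`!)%N.
  by rewrite subnDA bin_fact // leq_subRL.
have e4 : ('C(i + l, i) * (i`! * l`!) = (i + l)`!)%N.
  by rewrite -[X in (_ * (_ * X`!))%N](addKn i) bin_fact // leq_addr.
rewrite mulnACA -[X in _ = X]mulnA.
transitivity (m`!).
  by rewrite -e1 -e3; rewrite -!mulnA; congr (_ * _)%N; rewrite !mulnA; congr (_ * _)%N.
by rewrite -e2 -e4; congr (_ * _)%N; rewrite -!mulnA.
Qed.

Lemma sum_triangle (R : nmodType) m (F : nat -> nat -> R) :
  \sum_(i < m.+1) \sum_(l < (m - i).+1) F i l =
  \sum_(k < m.+1) \sum_(i < k.+1) F i (k - i)%N.
Proof.
transitivity (\sum_(0 <= i < m.+1) \sum_(0 <= k < m.+1 | (i <= k)%N) F i (k - i)%N).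
  rewrite big_mkord; apply: eq_bigr => i _.
  have im : (i <= m)%N by rewrite -ltnS.
  rewrite -(big_nat_widenl i 0 m.+1 predT) //; move: (nat_of_ord i) im => j jm.
  rewrite -[in RHS](add0n j) big_addn subSn // big_mkord.
  by apply: eq_bigr => l _; rewrite add0n addnK.
rewrite (@exchange_big_dep_nat _ _ _ _ _ _ _ _ _ predT) //= big_mkord.
apply: eq_bigr => k _.
by rewrite (big_ord_widen m.+1 (fun i => F i (k - i)%N)) // big_mkord; apply: eq_bigl.
Qed.

(** Total probability over the moment when an exploration of [N] vertices, [m] of them undiscovered,
    runs out. If [i] vertices are never found, then [N - i] have been processed and each of these
    misses all [i]. The induction conditions on the first step; for m = N the exploration is over at
    once. *)
Lemma reach_total (R : comNzRingType) (p : R) N m : (m <= N)%N ->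
  \sum_(i < m.+1) 'C(m, i)%:R * reach p (N - i) (m - i) * (1 - p) ^+ ((N - i) * i) = 1.
Proof.
have diag n : \sum_(i < n.+1) 'C(n, i)%:R * reach p (n - i) (n - i) * (1 - p) ^+ ((n - i) * i) = 1.
  rewrite big_ord_recr /= big1 ?add0r => [|i _].
    by rewrite subnn binn mul0n expr0 !mulr1.
  rewrite -[(n - i)%N]prednK ?subn_gt0 // reachS -{1}[(n - i).-1]succnK prednK ?subn_gt0 //.
  by rewrite -ltnS prednK ?subn_gt0 // ltnn mulr0 mul0r.
elim: N m => [|N IH] m; first by rewrite leqn0 => /eqP ->; exact: diag.
rewrite leq_eqVlt => /predU1P[->|]; first exact: diag.
rewrite ltnS => mN.
pose F i l := ('C(m, i) * 'C(m - i, l))%:R * p ^+ (m - (i + l)) * (1 - p) ^+ (i + l) *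
   (reach p (N - i) l * (1 - p) ^+ ((N - i) * i)) : R.
transitivity (\sum_(i < m.+1) \sum_(l < (m - i).+1) F i l).
  apply: eq_bigr => i _; have im : (i <= m)%N by rewrite -ltnS.
  have iN : (i <= N)%N := leq_trans im mN.
  rewrite subSn // reachS leq_sub2r // mulr_sumr mulr_suml; apply: eq_bigr => l _.
  by rewrite /F natrM subnDA exprD mulSn exprD; ring.
rewrite sum_triangle.
transitivity (\sum_(k < m.+1) ('C(m, k)%:R * p ^+ (m - k) * (1 - p) ^+ k * 1)); last first.
  rewrite -[RHS](@binE_cst R m (1 - p) 1) /binE; apply: eq_bigr => k _.
  by have -> : 1 - (1 - p) = p by ring.
apply: eq_bigr => k _; have km : (k <= m)%N by rewrite -ltnS.
rewrite -[X in _ = _ * X](IH k (leq_trans km mN)) mulr_sumr; apply: eq_bigr => i _.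
have ik : (i <= k)%N by rewrite -ltnS.
rewrite /F bin_mul_split subnKC // natrM; ring.
Qed.

(* The probability that a given vertex of G(m,p) lies in a component of size [j.+1]
   (not [j]). *)
Definition component_pmf (R : comNzRingType) (p : R) (m j : nat) : R :=
  'C(m.-1, j)%:R * reach p j.+1 j * (1 - p) ^+ (j.+1 * (m.-1 - j)).

Lemma component_pmf_total (R : comNzRingType) (p : R) m : (0 < m)%N ->
  \sum_(j < m) component_pmf p m j = 1.
Proof.
case: m => // m _; rewrite -[RHS](reach_total p (leqnSn m)).
rewrite [RHS](reindex_inj rev_ord_inj) /=; apply: eq_bigr => j _.
have jm : (j <= m)%N by rewrite -ltnS.
rewrite /component_pmf succnK subSS bin_sub // subKn // subSn ?leq_subr // subKn //.
Qed.

Lemma sum_subsets_card (R : comNzRingType) (T : finType) (W : {set T}) (phi : nat -> R) :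
  \sum_(S : {set T} | S \subset W) phi #|S| = \sum_(j < #|W|.+1) 'C(#|W|, j)%:R * phi j.
Proof.
rewrite (partition_big (fun S : {set T} => inord #|S| : 'I_#|W|.+1) predT) //=.
apply: eq_bigr => j _.
rewrite (eq_bigr (fun=> phi j)) => [|S /andP[SW /eqP<-]]; last first.
  by rewrite inordK // ltnS subset_leq_card.
rewrite sumr_const mulr_natl -cards_draws; congr (_ *+ _); rewrite -[LHS]cardsE.
apply: eq_card => S; rewrite !inE -topredE /=; case SW: (S \subset W) => //=.
by rewrite -(inj_eq val_inj) /= inordK // ltnS subset_leq_card.
Qed.

(** * The law of the component size *)

Section ComponentLaw.
Variables (R : comNzRingType) (n : nat) (p : R).
Implicit Types (V S : {set 'I_n}) (E A B : {set {set 'I_n}}) (u v : 'I_n).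
Local Notation q := (1 - p).

Definition span_prob S v : R := edgeE p (edges S) (fun E => (component E v == S)%:R).

(** The event that the component is [S] concerns only edges inside [S] and across its boundary. The
    edges outside [S] are thus untouched, and the hypothesis on [g] says that it reads only
    those. *)
Lemma edgeE_component S V v g : S \subset V -> v \in S ->
  (forall A B, A \subset edges S -> B \subset edges (V :\: S) -> g (A :|: B) = g B) ->
  edgeE p (edges V) (fun E => (component E v == S)%:R * g E) =
  span_prob S v * q ^+ (#|S| * #|V :\: S|) * edgeE p (edges (V :\: S)) g.
Proof.
move=> SV vS hg; have [d1 d2] := disjoint_cross SV.
rewrite (edges_split SV) edgeE_split // /span_prob -mulrA -edgeEZr.
apply: eq_edgeE => A AS; rewrite edgeE_split // -card_cross // -edgeE_set0.
rewrite -edgeEZr -edgeEZ; apply: eq_edgeE => X XC; rewrite -!edgeEZ.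
apply: eq_edgeE => B BV; rewrite (component_cross SV vS AS XC BV) -mulnb natrM -mulrA.
congr (_ * _); have [->|_] := eqVneq X set0; last by rewrite !mul0r.
by rewrite !mul1r set0U hg.
Qed.

Lemma edgeE_component_sum V v (f : {set 'I_n} -> {set {set 'I_n}} -> R) : v \in V ->
  edgeE p (edges V) (fun E => f (component E v) E) =
  \sum_(S : {set 'I_n} | (S \subset V) && (v \in S))
     edgeE p (edges V) (fun E => (component E v == S)%:R * f S E).
Proof.
move=> vV; rewrite -edgeE_sum; apply: eq_edgeE => E EV.
rewrite (bigD1 (component E v)) ?component_refl ?(component_sub EV vV) //= eqxx mul1r.
by rewrite big1 ?addr0 // => S /andP[_]; rewrite eq_sym => /negbTE->; rewrite mul0r.
Qed.

Lemma span_prob_total V v : v \in V ->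
  \sum_(S : {set 'I_n} | (S \subset V) && (v \in S))
     span_prob S v * q ^+ (#|S| * #|V :\: S|) = 1.
Proof.
move=> vV; rewrite -[RHS](edgeE1 p (edges V)).
rewrite (edgeE_component_sum (fun=> fun=> 1) vV); apply: eq_bigr => S /andP[SV vS].
by rewrite (@edgeE_component S V v (fun=> 1)) // edgeE1 mulr1.
Qed.

Lemma sum_subsets_with V v (phi : nat -> R) : v \in V ->
  \sum_(S : {set 'I_n} | (S \subset V) && (v \in S)) phi #|S| =
  \sum_(j < #|V|) 'C(#|V|.-1, j)%:R * phi j.+1.
Proof.
move=> vV; have cV : #|V| = #|V :\ v|.+1 by rewrite (cardsD1 v) vV.
transitivity (\sum_(S : {set 'I_n} | S \subset V :\ v) phi #|S|.+1).
  rewrite (reindex_onto (fun S => v |: S) (fun S => S :\ v)) /=; last first.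
    by move=> S /andP[_ vS]; rewrite setD1K.
  apply: eq_big => [S|S].
    rewrite setU11 andbT subsetD1 subUset sub1set vV /=; congr (_ && _).
    apply/eqP/idP => [<-|vS]; first by rewrite !inE eqxx.
    by rewrite setU1K.
  move=> /andP[_ /eqP E]; have vS : v \notin S by rewrite -E !inE eqxx.
  by rewrite cardsU1 vS.
by rewrite cV (sum_subsets_card _ (fun k => phi k.+1)).
Qed.

Lemma card_setD_sub S V : S \subset V -> #|V :\: S| = (#|V| - #|S|)%N.
Proof. by move=> SV; rewrite cardsD (setIidPr SV). Qed.

Lemma sum_component_pmf V v (phi : nat -> R) : v \in V ->
  \sum_(S : {set 'I_n} | (S \subset V) && (v \in S))
     reach p #|S| #|S|.-1 * q ^+ (#|S| * #|V :\: S|) * phi #|S| =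
  \sum_(j < #|V|) component_pmf p #|V| j * phi j.+1.
Proof.
move=> vV; have V0 : (0 < #|V|)%N by apply/card_gt0P; exists v.
pose psi k := reach p k k.-1 * q ^+ (k * (#|V| - k)) * phi k.
transitivity (\sum_(S : {set 'I_n} | (S \subset V) && (v \in S)) psi #|S|).
  by apply: eq_bigr => S /andP[SV _]; rewrite card_setD_sub.
rewrite (sum_subsets_with psi vV); apply: eq_bigr => j _.
have E k : (#|V| - k.+1 = #|V|.-1 - k)%N by move: V0; case: #|V|.
by rewrite /psi /component_pmf E; ring.
Qed.

(** Both sides satisfy the same identity: summed over the subsets containing [v], weighted by the
    absence of crossing edges, they give 1. By strong induction the terms of proper subsets agree,
    so the top terms agree as well; no coupling of the graph with the walk is needed. *)
Lemma span_prob_reach S v : v \in S -> span_prob S v = reach p #|S| #|S|.-1.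
Proof.
have [k] := ubnP #|S|; elim: k S => // k IH S Sk vS.
have S0 : (0 < #|S|)%N by apply/card_gt0P; exists v.
have := sum_component_pmf (fun=> 1) vS.
rewrite [RHS](eq_bigr (fun j : 'I__ => component_pmf p #|S| j)) => [|j _]; last by rewrite mulr1.
rewrite component_pmf_total // => E1.
have := span_prob_total vS; rewrite -[RHS]E1 (bigD1 S) ?subxx ?vS //=.
rewrite [RHS](bigD1 S) ?subxx ?vS //= !mulr1 setDv cards0 muln0 !expr0 !mulr1.
rewrite (eq_bigr (fun S' : {set 'I_n} =>
  reach p #|S'| #|S'|.-1 * q ^+ (#|S'| * #|S :\: S'|) * 1)) => [/addIr //|].
move=> S' /andP[/andP[S'S vS'] neq]; rewrite mulr1 IH //.
have : S' \proper S by rewrite properEneq neq S'S.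
by move/proper_card => lt; rewrite ltnS in Sk; exact: leq_trans lt Sk.
Qed.

Lemma edgeE_component_card V v (phi : nat -> R) : v \in V ->
  edgeE p (edges V) (fun E => phi #|component E v|) =
  \sum_(j < #|V|) component_pmf p #|V| j * phi j.+1.
Proof.
move=> vV; rewrite (edgeE_component_sum (fun S _ => phi #|S|) vV) -(sum_component_pmf phi vV).
apply: eq_bigr => S /andP[SV vS].
rewrite (@edgeE_component S V v (fun=> phi #|S|)) // (span_prob_reach vS); congr (_ * _).
by rewrite -[RHS]mulr1 -[X in _ = _ * X](edgeE1 p (edges (V :\: S))) -edgeEZ; apply: eq_edgeE => A _; rewrite mulr1.
Qed.

(** Given the component of [v], the rest is a fresh random graph on [#|V| - j.+1] vertices, so the
    inner sum is again a first moment. With [phi k] = 1/k on large sizes this is the expected number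
    of ordered pairs of distinct large components. *)
Lemma edgeE_distinct_components V (phi : nat -> R) :
  edgeE p (edges V) (fun E => \sum_(v in V) \sum_(u in V :\: component E v)
     phi #|component E v| * phi #|component E u|) =
  #|V|%:R * \sum_(j < #|V|) component_pmf p #|V| j * (phi j.+1 *
     ((#|V| - j.+1)%:R *
      \sum_(l < #|V| - j.+1) component_pmf p (#|V| - j.+1) l * phi l.+1)).
Proof.
pose M k := \sum_(l < k) component_pmf p k l * phi l.+1.
rewrite edgeE_sum mulr_natl -sumr_const; apply: eq_bigr => v vV.
rewrite -(@sum_component_pmf V v (fun k => phi k * ((#|V| - k)%:R * M (#|V| - k)%N)) vV).
rewrite (edgeE_component_sum
  (fun S E => \sum_(u in V :\: S) phi #|S| * phi #|component E u|) vV).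
apply: eq_bigr => S /andP[SV vS].
rewrite (@edgeE_component S V v (fun E => \sum_(u in V :\: S) phi #|S| * phi #|component E u|)) //; last first.
  move=> A B AS BS; apply: eq_bigr => u uVS.
  by rewrite setUC (component_cut BS AS _ uVS) // disjoint_sym disjoint_setD.
rewrite (span_prob_reach vS); congr (_ * _); rewrite edgeE_sum.
rewrite (eq_bigr (fun=> phi #|S| * M #|V :\: S|)) => [|u uVS]; last first.
  by rewrite edgeEZ edgeE_component_card.
by rewrite sumr_const -[LHS]mulr_natl card_setD_sub // mulrCA.
Qed.

End ComponentLaw.

(** * First and second moments of the number of large components *)

Section Gnp.
Variables (R : realType) (n : nat) (p : R).
Implicit Types (E : {set {set 'I_n}}).

Lemma gnp_prob_edgeE (Q : pred {set {set 'I_n}}) :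
  gnp_prob p Q = edgeE p (edges [set: 'I_n]) (fun E => (Q E)%:R).
Proof.
rewrite edgesT /gnp_prob /edgeE big_mkcondr /=; apply: eq_bigr => E _.
by rewrite /gnp_weight; case: (Q E); rewrite ?mulr1 ?mulr0.
Qed.

Lemma prob_component (P : pred nat) v :
  gnp_prob p (fun E => P #|component E v|) =
  \sum_(j < n) component_pmf p n j * (P j.+1)%:R.
Proof.
by rewrite gnp_prob_edgeE (edgeE_component_card _ (fun k => (P k)%:R)) ?inE // cardsT card_ord.
Qed.

Hypothesis p01 : 0 <= p <= 1.
Variable P : pred nat.
Hypothesis Pmono : forall j k, (j <= k)%N -> P j -> P k.
(** The weight 1/k makes the vertices of a component contribute 1 in total, so sums over vertices
    count components. *)
Let phi k : R := (P k)%:R / k%:R.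

Lemma sum_component_inv E v : P #|component E v| ->
  \sum_(u in component E v) phi #|component E u| = 1.
Proof.
move=> Pv; rewrite (eq_bigr (fun=> phi #|component E v|)) => [|u /component_eq -> //].
rewrite sumr_const /phi Pv -[_ *+ _]mulr_natl mul1r divff // pnatr_eq0 -lt0n.
by apply/card_gt0P; exists v; exact: component_refl.
Qed.

Lemma phi_ge0 k : 0 <= phi k.
Proof. by rewrite divr_ge0 ?ler0n. Qed.

Lemma large_component E : (0 < n)%N ->
  P (max_component_size E) = [exists v, P #|component E v|].
Proof.
move=> n0; apply/idP/existsP => [|[v]]; last first.
  by apply: Pmono; exact: (bigop.leq_bigmax v).
have n0' : (0 < #|'I_n|)%N by rewrite card_ord.
rewrite /max_component_size; have [v ->] := @bigop.eq_bigmax _ (fun v => #|component E v|) n0'.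
by exists v.
Qed.

Lemma prob_max_component : (0 < n)%N ->
  forall X D : R, X = n%:R * \sum_(j < n) component_pmf p n j * phi j.+1 ->
  D = n%:R * \sum_(j < n) component_pmf p n j * (phi j.+1 *
     ((n - j.+1)%:R * \sum_(l < n - j.+1) component_pmf p (n - j.+1) l * phi l.+1)) ->
  X - D <= gnp_prob p (fun E => P (max_component_size E)) <= X.
Proof.
move=> n0 X D hX hD.
have XE : X = edgeE p (edges [set: 'I_n]) (fun E => \sum_v phi #|component E v|).
  rewrite edgeE_sum (eq_bigr (fun=> \sum_(j < n) component_pmf p n j * phi j.+1)).
    by rewrite sumr_const card_ord hX mulr_natl.
  by move=> v _; rewrite edgeE_component_card ?inE // cardsT card_ord.
have DE : D = edgeE p (edges [set: 'I_n]) (fun E => \sum_(v in [set: 'I_n])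
    \sum_(u in [set: 'I_n] :\: component E v) phi #|component E v| * phi #|component E u|).
  by rewrite hD edgeE_distinct_components cardsT card_ord.
rewrite gnp_prob_edgeE; apply/andP; split; last first.
  rewrite XE; apply: (ler_edgeE p01) => E _; rewrite large_component //.
  case: existsP => [[v Pv]|_]; last by apply: sumr_ge0 => v _; exact: phi_ge0.
  rewrite -(sum_component_inv Pv) [leRHS](bigID (mem (component E v))) /= lerDl.
  by apply: sumr_ge0 => u _; exact: phi_ge0.
rewrite XE DE lerBlDr -edgeED; apply: (ler_edgeE p01) => E _; rewrite large_component //.
set Y := \sum_v _.
have Y2 : Y ^+ 2 = Y + \sum_(v in [set: 'I_n])
    \sum_(u in [set: 'I_n] :\: component E v) phi #|component E v| * phi #|component E u|.
  rewrite expr2 {1 3}/Y mulr_suml (eq_bigl (fun v => v \in [set: 'I_n])); last by move=> v; rewrite inE.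
  rewrite [X in X + _](eq_bigl (fun v => v \in [set: 'I_n])); last by move=> v; rewrite inE.
  rewrite -big_split; apply: eq_bigr => v _ /=.
  rewrite /Y mulr_sumr (bigID (mem (component E v))) /=; congr (_ + _); last first.
    by apply: eq_bigl => u; rewrite !inE andbT.
  rewrite -mulr_sumr; have [Pv|Pv] := boolP (P #|component E v|).
    by rewrite sum_component_inv // mulr1.
  by rewrite /phi (negbTE Pv) !mul0r.
(* [Y] counts the components satisfying [P], and [2 Y - Y^2 <= 1] always. *)
case: existsP => [_|nP].
  have : 0 <= (1 - Y) ^+ 2 by rewrite sqr_ge0.
  have -> : (1 - Y) ^+ 2 = 1 + Y ^+ 2 - 2 * Y by ring.
  rewrite Y2 mulr1n; move: (\sum_(v in _) _) => Z; lra.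
have -> : Y = 0.
  apply: big1 => v _; rewrite /phi; case Pv: (P _); last by rewrite mul0r.
  by case: nP; exists v.
rewrite add0r; apply: sumr_ge0 => v _; apply: sumr_ge0 => u _.
by rewrite mulr_ge0 ?phi_ge0.
Qed.

End Gnp.

From mathcomp Require Import all_classical all_reals all_analysis.
Import Order.TTheory GRing.Theory Num.Theory.
Import numFieldNormedType.Exports.

(** * Exponential inequalities and Stirling bounds *)

Section ExpBounds.
Variable R : realType.
Implicit Types x y z : R.

Lemma ge0_of_derive_ge0 (f df : R -> R) :
  (forall x, is_derive x 1 f (df x)) -> f 0 = 0 ->
  (forall x, 0 <= x -> 0 <= df x) -> forall x, 0 <= x -> 0 <= f x.
Proof.
move=> fE f0 df0 x; rewrite le_eqVlt => /predU1P[<-|x0]; first by rewrite f0.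
have [|c] := @MVT R f df 0 x x0 (fun y _ => fE y).
  by apply: derivable_within_continuous => y _; exact: ex_derive.
rewrite in_itv /= f0 !subr0 => /andP[c0 _] ->.
by rewrite mulr_ge0 // ?df0 // ltW.
Qed.

Definition exp_taylor (s : R) n : {poly R} := \poly_(i < n) (s ^+ i / i`!%:R).

Lemma deriv_exp_taylor s n : (exp_taylor s n.+1)^`() = s *: exp_taylor s n.
Proof.
apply/polyP => i; rewrite coef_deriv coefZ !coef_poly ltnS.
case: ifP => _; last by rewrite mul0rn mulr0.
rewrite exprS factS natrM invfM -mulr_natr; field.
by rewrite !pnatr_eq0 -lt0n fact_gt0; apply/andP; split=> //; rewrite addrC natr1 pnatr_eq0.
Qed.

(* For [s = 1] and [s = -1] this bounds [expR y] and [expR (- y)] by their Taylor polynomials. *)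
Lemma expR_taylor s n y : s ^+ 2 = 1 -> 0 <= y ->
  0 <= s ^+ n * (expR (s * y) - (exp_taylor s n).[y]).
Proof.
move=> s2; elim: n y => [|n IH] y y0.
  by rewrite mul1r /exp_taylor poly_def big_ord0 horner0 subr0 expR_ge0.
pose f z := s ^+ n.+1 * (expR (s * z) - (exp_taylor s n.+1).[z]).
apply: (@ge0_of_derive_ge0 f (fun z => s ^+ n * (expR (s * z) - (exp_taylor s n).[z]))) => //.
- move=> z; apply: is_derive_eq.
  rewrite deriv_exp_taylor hornerZ.
  rewrite /GRing.scale /= mulr1 exprS -[RHS]mul1r -s2; ring.
- rewrite /f mulr0 expR0 horner_poly big_ord_recl /= fact0 divr1 !expr0 !mulr1.
  by rewrite big1 ?addr0 ?subrr ?mulr0 // => i _; rewrite expr0n /= mulr0.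
Qed.

Lemma expR_ge_taylor5 y : 0 <= y ->
  1 + y + y ^+ 2 / 2 + y ^+ 3 / 6 + y ^+ 4 / 24 + y ^+ 5 / 120 <= expR y.
Proof.
move=> y0; have := @expR_taylor 1 6 y (expr1n _ _) y0.
rewrite !expr1n !mul1r /exp_taylor horner_poly subr_ge0 => /(le_trans _); apply.
rewrite !big_ord_recr big_ord0 /= !expr1n.
have [-> -> -> ->] : [/\ 2`! = 2, 3`! = 6, 4`! = 24 & 5`! = 120]%N by [].
rewrite fact0 (_ : 1`! = 1%N) //; lra.
Qed.

Lemma expRN_taylor y : 0 <= y ->
  [/\ 1 - y + y ^+ 2 / 2 - y ^+ 3 / 6 <= expR (- y),
     expR (- y) <= 1 - y + y ^+ 2 / 2 - y ^+ 3 / 6 + y ^+ 4 / 24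
   & expR (- y) <= 1 - y + y ^+ 2 / 2].
Proof.
move=> y0; have s2 : (-1 : R) ^+ 2 = 1 by ring.
have := expR_taylor 3 s2 y0; have := expR_taylor 4 s2 y0; have := expR_taylor 5 s2 y0.
rewrite !mulN1r /exp_taylor !horner_poly !big_ord_recr !big_ord0 /=.
have [-> -> ->] : [/\ 2`! = 2, 3`! = 6 & 4`! = 24]%N by [].
by rewrite fact0 (_ : 1`! = 1%N) // => h1 h2 h3; split; lra.
Qed.

Lemma expR_ge_taylor3 z : 0 <= z -> 1 + z + z ^+ 2 / 2 + z ^+ 3 / 6 <= expR z.
Proof.
move=> z0; apply: le_trans (expR_ge_taylor5 z0).
have := exprn_ge0 4 z0; have := exprn_ge0 5 z0; lra.
Qed.

(** 1 - y/2 + y^2/12 begins the Bernoulli expansion of y / (e^y - 1), the form taken by k p q^k / (1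
    - q^k) in successive quotients of the size law. *)
Lemma expR_sub1_le y : 0 <= y -> y <= (expR y - 1) * (1 - y / 2 + y ^+ 2 / 12).
Proof.
move=> y0; have := expR_ge_taylor5 y0; set t := expR y => h.
have q0 : 0 < 1 - y / 2 + y ^+ 2 / 12 by have := sqr_ge0 (y - 3); lra.
have : (y + y ^+ 2 / 2 + y ^+ 3 / 6 + y ^+ 4 / 24 + y ^+ 5 / 120) * (1 - y / 2 + y ^+ 2 / 12)
     <= (t - 1) * (1 - y / 2 + y ^+ 2 / 12).
  by apply: ler_wpM2r; [exact: ltW | lra].
apply: le_trans.
have q5 : 0 <= 2 - y + y ^+ 2 by have := sqr_ge0 (y - 1 / 2); lra.
have := mulr_ge0 (exprn_ge0 5 y0) q5; lra.
Qed.

Lemma one_sub_le_expR x : 0 <= x -> 1 - x <= expR (- x - x ^+ 2 / 2).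
Proof.
move=> x0; rewrite -subr_ge0.
pose f z := expR (- z - z ^+ 2 / 2) - (1 - z) : R.
apply: (@ge0_of_derive_ge0 f (fun z => 1 - (1 + z) * expR (- z - z ^+ 2 / 2))) => //.
- move=> z; apply: is_derive_eq.
  by rewrite /GRing.scale /=; field.
- by rewrite /f expr0n /= mul0r oppr0 !addr0 expR0 subrr.
- move=> z z0; rewrite subr_ge0; have := expR_ge1Dx (z + z ^+ 2 / 2).
  have -> : - z - z ^+ 2 / 2 = - (z + z ^+ 2 / 2) by ring.
  rewrite expRN ler_pdivrMr ?expR_gt0 // mul1r; apply: le_trans; by rewrite addrA lerDl divr_ge0 ?exprn_ge0 ?ler0n.
Qed.

Lemma expR_le_one_sub x : 0 <= x <= 1 / 4 -> expR (- x - x ^+ 2 / 2 - x ^+ 3) <= 1 - x.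
Proof.
move=> /andP[x0 x1]; have -> : - x - x ^+ 2 / 2 - x ^+ 3 = - (x + x ^+ 2 / 2 + x ^+ 3) by ring.
set t := x + _ + _; have t0 : 0 <= t by rewrite !addr_ge0 ?divr_ge0 ?exprn_ge0 ?ler0n //.
rewrite expRN -[leLHS]div1r ler_pdivrMr ?expR_gt0 //.
have h := expR_ge_taylor3 t0.
apply: (@le_trans _ _ ((1 - x) * (1 + t + t ^+ 2 / 2 + t ^+ 3 / 6))); last first.
  by apply: ler_wpM2l => //; lra.
have e1 : x ^+ 2 + x ^+ 3 <= t ^+ 2.
  rewrite /t; have := exprn_ge0 4 x0; have := exprn_ge0 5 x0;  have := exprn_ge0 6 x0; lra.
have e2 : x ^+ 3 <= t ^+ 3.
  rewrite lerXn2r ?nnegrE // /t -addrA lerDl addr_ge0 ?divr_ge0 ?exprn_ge0 ?ler0n //.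
have : (1 - x) * (1 + t + (x ^+ 2 + x ^+ 3) / 2 + x ^+ 3 / 6) <=
  (1 - x) * (1 + t + t ^+ 2 / 2 + t ^+ 3 / 6) by apply: ler_wpM2l; lra.
apply: le_trans; rewrite /t.
have : 0 <= x ^+ 3 * (1 / 4 - x) by rewrite mulr_ge0 ?exprn_ge0 ?subr_ge0.
have := exprn_ge0 3 x0; have := exprn_ge0 4 x0; lra.
Qed.

Lemma one_add_le_expR x : 0 <= x -> 1 + x <= expR (x - x ^+ 2 / 2 + x ^+ 3).
Proof.
move=> x0; set z := (X in expR X).
have zE : z = x * (1 - x / 2 + x ^+ 2) by rewrite /z; ring.
have q0 : 0 <= 1 - x / 2 + x ^+ 2 by have := sqr_ge0 (x - 1 / 4); lra.
have z1 : 0 <= z by rewrite zE mulr_ge0.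
apply: le_trans (expR_ge_taylor3 z1); have := exprn_ge0 3 z1.
have : x ^+ 2 * (1 - x + 2 * x ^+ 2) <= z ^+ 2.
  rewrite zE exprMn ler_wpM2l ?exprn_ge0 //; have := sqr_ge0 (x / 2 - x ^+ 2); lra.
move: (z ^+ 3) (z ^+ 2) => u v; rewrite /z.
have := exprn_ge0 3 x0; have := exprn_ge0 4 x0; lra.
Qed.

Lemma expR_le_one_add x : 0 <= x <= 1 / 4 -> expR (x - x ^+ 2 / 2 - x ^+ 3) <= 1 + x.
Proof.
move=> /andP[x0 x1]; set z := (X in expR X).
have x2 : x ^+ 2 <= x / 4 by rewrite expr2 ler_wpM2l // -[4^-1]div1r.
have x3 : x ^+ 3 <= x ^+ 2 / 4 by rewrite exprSr ler_wpM2l ?exprn_ge0 // -[4^-1]div1r.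
have z0 : 0 <= z by rewrite /z; lra.
have zx : z <= x by rewrite /z; have := exprn_ge0 3 x0; have := exprn_ge0 2 x0; lra.
have [h _ _] := expRN_taylor z0.
rewrite -[z]opprK expRN -[leLHS]div1r ler_pdivrMr ?expR_gt0 //.
apply: (@le_trans _ _ ((1 + x) * (1 - z + z ^+ 2 / 2 - z ^+ 3 / 6))); last first.
  by apply: ler_wpM2l => //; lra.
have e1 : x ^+ 2 - x ^+ 3 * (3 / 2) <= z ^+ 2.
  rewrite /z; have := exprn_ge0 4 x0; have := exprn_ge0 5 x0; have := exprn_ge0 6 x0.
  have : 0 <= x ^+ 3 * (1 / 4 - x) by rewrite mulr_ge0 ?exprn_ge0 ?subr_ge0.
  have : 0 <= x ^+ 4 * (1 / 4 - x) by rewrite mulr_ge0 ?exprn_ge0 ?subr_ge0.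
  lra.
have e2 : z ^+ 3 <= x ^+ 3 by rewrite lerXn2r.
have : (1 + x) * (1 - z + (x ^+ 2 - x ^+ 3 * (3 / 2)) / 2 - x ^+ 3 / 6) <=
  (1 + x) * (1 - z + z ^+ 2 / 2 - z ^+ 3 / 6) by apply: ler_wpM2l; lra.
apply: le_trans; rewrite /z.
have : 0 <= x ^+ 3 * (1 / 4 - x) by rewrite mulr_ge0 ?exprn_ge0 ?subr_ge0.
have := exprn_ge0 3 x0; have := exprn_ge0 4 x0; lra.
Qed.

End ExpBounds.

Section HyperbolicBounds.
Variable R : realType.
Implicit Types x y z : R.

Lemma expR_small_le x : 0 <= x <= 1 / 4 -> expR x <= 1 + x + x ^+ 2.
Proof.
move=> /andP[x0 x1]; have [h _ _] := expRN_taylor x0.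
rewrite -[x in leLHS]opprK expRN -[leLHS]div1r ler_pdivrMr ?expR_gt0 //.
apply: (@le_trans _ _ ((1 + x + x ^+ 2) * (1 - x + x ^+ 2 / 2 - x ^+ 3 / 6))); last first.
  by apply: ler_wpM2l => //; rewrite !addr_ge0 ?exprn_ge0.
have : 0 <= x ^+ 2 * (1 / 4 - x) by rewrite mulr_ge0 ?exprn_ge0 ?subr_ge0.
have : 0 <= x ^+ 4 * (1 / 4 - x) by rewrite mulr_ge0 ?exprn_ge0 ?subr_ge0.
have := exprn_ge0 3 x0; have := exprn_ge0 4 x0; lra.
Qed.

(* Halving the argument turns the local Taylor bound into a global one:
   [cosh (2 x) = 2 (cosh x)^2 - 1 <= (cosh x)^4]. *)
Lemma cosh_le N x : 0 <= x <= 2 ^+ N / 4 ->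
  expR x + expR (- x) <= 2 * expR (x ^+ 2 * (3 / 4)).
Proof.
elim: N x => [|N IH] x /andP[x0 x1].
  rewrite expr0 in x1.
  have : expR x <= 1 + x + x ^+ 2 by apply: expR_small_le; rewrite x0.
  have [_ _ h] := expRN_taylor x0.
  have := expR_ge1Dx (x ^+ 2 * (3 / 4)); lra.
pose y := x / 2; have y0 : 0 <= y by rewrite divr_ge0.
have yN : 0 <= y <= 2 ^+ N / 4 by rewrite y0 /y; move: x1; rewrite exprS; lra.
have -> : x = y + y by rewrite /y; field.
have -> : (y + y) ^+ 2 * (3 / 4) = y ^+ 2 * (3 / 4) + y ^+ 2 * (3 / 4) + (y ^+ 2 * (3 / 4) + y ^+ 2 * (3 / 4)) by field.
rewrite opprD !expRD; have := IH y yN.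
have e1 : expR y * expR (- y) = 1 by rewrite -expRD subrr expR0.
have := expR_gt0 y; have := expR_gt0 (- y); move: e1.
move: (expR y) (expR (- y)) (expR (y ^+ 2 * (3 / 4))) => a b c ab b0 a0 abc.
have s0 : 2 <= a + b.
  have : 0 <= (a - b) ^+ 2 by exact: sqr_ge0.
  have -> : (a - b) ^+ 2 = (a + b) ^+ 2 - 4 * (a * b) by ring.
  rewrite ab mulr1.
  rewrite subr_ge0 => h4; rewrite leNgt; apply/negP => lt2.
  have : (a + b) ^+ 2 < 2 ^+ 2 by rewrite ltrXn2r // ?nnegrE ?addr_ge0 // ltW.
  lra.
have c2 : ((a + b) / 2) ^+ 2 <= c ^+ 2.
  rewrite lerXn2r ?nnegrE //; lra.
have c0 : 0 <= ((a + b) / 2) ^+ 2 by exact: sqr_ge0.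
have : (((a + b) / 2) ^+ 2) ^+ 2 <= (c ^+ 2) ^+ 2.
  by rewrite lerXn2r ?nnegrE // (le_trans c0).
have : a * a + b * b = (a + b) ^+ 2 - 2 * (a * b) by ring.
rewrite ab.
have -> : c * c * (c * c) = (c ^+ 2) ^+ 2 by ring.
have : 0 <= (((a + b) / 2) ^+ 2 - 1) ^+ 2 by exact: sqr_ge0.
move: ((c ^+ 2) ^+ 2) => d; lra.
Qed.

Lemma one_sub_expRN_le_small x : 0 <= x <= 1 / 4 ->
  1 - expR (- x) <= x * expR (- (x / 2) + x ^+ 2 / 16).
Proof.
move=> /andP[x0 x1]; have [h _ _] := expRN_taylor x0.
have x2 : x ^+ 2 <= x / 4 by rewrite expr2 ler_wpM2l // -[4^-1]div1r.
set t := x / 2 - x ^+ 2 / 16; have t0 : 0 <= t by rewrite /t; lra.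
have -> : - (x / 2) + x ^+ 2 / 16 = - t by rewrite /t; ring.
have [ht _ _] := expRN_taylor t0.
have tx : t ^+ 3 <= (x / 2) ^+ 3.
  rewrite lerXn2r ?nnegrE //; rewrite /t; have := exprn_ge0 2 x0; lra.
have : x * (1 - x / 2 + x ^+ 2 / 6) <= x * expR (- t); last by lra.
apply: ler_wpM2l => //; apply: le_trans ht.
have : 0 <= x ^+ 2 * (1 / 4 - x) by rewrite mulr_ge0 ?exprn_ge0 ?subr_ge0.
have := exprn_ge0 4 x0; have := exprn_ge0 2 x0; move: tx; move: (t ^+ 3) => u; rewrite /t; lra.
Qed.

(** The quotients of the size law are needed up to k = n, where x is not small, so the bound must be
    global. It is propagated by doubling: 1 - e^(-2z) = (1 - e^(-z)) (1 + e^(-z)), and [cosh_le] at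
    z/2 adds 3 z^2/16 to z^2/16, which is exactly (2z)^2/16. *)
Lemma one_sub_expRN_le x : 0 <= x -> 1 - expR (- x) <= x * expR (- (x / 2) + x ^+ 2 / 16).
Proof.
move=> x0.
suff H N y : 0 <= y <= 2 ^+ N / 4 -> 1 - expR (- y) <= y * expR (- (y / 2) + y ^+ 2 / 16).
  have x4 : 0 <= 4 * x by rewrite mulr_ge0.
  apply: (H (Num.Def.archi_bound (4 * x))); rewrite x0 /=.
  have := archi_boundP x4; set N := Num.Def.archi_bound _ => xN.
  have : N%:R <= 2 ^+ N :> R by rewrite -natrX ler_nat ltnW // ltn_expl.
  lra.
elim: N y => [|N IH] y; first by rewrite expr0 => yN; exact: one_sub_expRN_le_small.
move=> /andP[y0 y1]; pose z := y / 2; have z0 : 0 <= z by rewrite divr_ge0.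
have zN : 0 <= z <= 2 ^+ N / 4 by rewrite z0 /z; move: y1; rewrite exprS; lra.
have z2N : 0 <= z / 2 <= 2 ^+ N / 4 by case/andP: zN => h1 h2; apply/andP; split; lra.
have -> : y = z + z by rewrite /z; field.
have -> : - ((z + z) / 2) + (z + z) ^+ 2 / 16 =
  - (z / 2) + z ^+ 2 / 16 + (- (z / 2) + (z / 2) ^+ 2 * (3 / 4)) by field.
rewrite opprD expRD [expR (- (z / 2) + z ^+ 2 / 16 + _)]expRD.
have h1 := IH z zN; have h2 := cosh_le z2N.
have h3 : 1 + expR (- z) <= 2 * expR (- (z / 2) + (z / 2) ^+ 2 * (3 / 4)).
  rewrite expRD mulrCA; apply: le_trans (ler_wpM2l (expR_ge0 _) h2).
  rewrite mulrDr -!expRD addNr expR0 lerD2l.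
  by rewrite le_eqVlt (_ : - (z / 2) + - (z / 2) = - z) ?eqxx //; field.
have h0 : 0 <= 1 - expR (- z) by rewrite subr_ge0 expR_le1 oppr_le0.
have h4 : 0 <= 1 + expR (- z) by rewrite addr_ge0 ?expR_ge0.
have := ler_pM h0 h4 h1 h3.
move: (expR (- z)) (expR (- (z / 2) + z ^+ 2 / 16)) (expR (- (z / 2) + (z / 2) ^+ 2 * (3 / 4))).
move=> a b c; lra.
Qed.

(** The true second coefficient 1/24 matters: with x of order a t and the power of order a/t^2,
    quadratic terms contribute order a^3 to the exponent, while cubic ones are only of order a^4
    t. *)
Lemma one_sub_expRN_le_sharp x : 0 <= x <= 1 / 4 ->
  1 - expR (- x) <= x * expR (- (x / 2) + x ^+ 2 / 24 + x ^+ 3).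
Proof.
move=> /andP[x0 x1]; have [h _ _] := expRN_taylor x0.
have x2 : x ^+ 2 <= x / 4 by rewrite expr2 ler_wpM2l // -[4^-1]div1r.
have x3 : x ^+ 3 <= x ^+ 2 / 4 by rewrite exprSr ler_wpM2l ?exprn_ge0 // -[4^-1]div1r.
have p2 := exprn_ge0 2 x0; have p3 := exprn_ge0 3 x0; have p4 := exprn_ge0 4 x0.
have p5 := exprn_ge0 5 x0; have p6 := exprn_ge0 6 x0.
have x4 : x ^+ 4 <= x ^+ 3 / 4 by rewrite exprSr ler_wpM2l ?exprn_ge0 // -[4^-1]div1r.
set t := x / 2 - x ^+ 2 / 24 - x ^+ 3; have t0 : 0 <= t by rewrite /t; lra.
have -> : - (x / 2) + x ^+ 2 / 24 + x ^+ 3 = - t by rewrite /t; ring.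
have [ht _ _] := expRN_taylor t0.
have tx : t ^+ 3 <= (x / 2) ^+ 3.
  rewrite lerXn2r ?nnegrE //; rewrite /t; lra.
have t2 : x ^+ 2 / 4 - x ^+ 3 / 24 - x ^+ 4 <= t ^+ 2.
  have : 0 <= (x ^+ 2 / 24 + x ^+ 3) ^+ 2 by exact: sqr_ge0.
  rewrite /t; lra.
have : x * (1 - x / 2 + x ^+ 2 / 6) <= x * expR (- t); last by lra.
apply: ler_wpM2l => //; apply: le_trans ht.
move: tx t2; move: (t ^+ 3) (t ^+ 2) => u v; rewrite /t; lra.
Qed.

Lemma one_sub_expRN_ge x : 0 <= x <= 1 / 4 ->
  x * expR (- (x / 2) + x ^+ 2 / 24 - x ^+ 3) <= 1 - expR (- x).
Proof.
move=> /andP[x0 x1]; have [_ h _] := expRN_taylor x0.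
have x2 : x ^+ 2 <= x / 4 by rewrite expr2 ler_wpM2l // -[4^-1]div1r.
have x3 : x ^+ 3 <= x ^+ 2 / 4 by rewrite exprSr ler_wpM2l ?exprn_ge0 // -[4^-1]div1r.
have p2 := exprn_ge0 2 x0; have p3 := exprn_ge0 3 x0; have p4 := exprn_ge0 4 x0.
have p5 := exprn_ge0 5 x0; have p6 := exprn_ge0 6 x0.
have x4 : x ^+ 4 <= x ^+ 3 / 4 by rewrite exprSr ler_wpM2l ?exprn_ge0 // -[4^-1]div1r.
have x5 : x ^+ 5 <= x ^+ 4 / 4 by rewrite exprSr ler_wpM2l ?exprn_ge0 // -[4^-1]div1r.
have x6 : x ^+ 6 <= x ^+ 5 / 4 by rewrite exprSr ler_wpM2l ?exprn_ge0 // -[4^-1]div1r.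
set t := x / 2 - x ^+ 2 / 24 + x ^+ 3; have t0 : 0 <= t by rewrite /t; lra.
have -> : - (x / 2) + x ^+ 2 / 24 - x ^+ 3 = - t by rewrite /t; ring.
have [_ _ ht] := expRN_taylor t0.
have : x * expR (- t) <= x * (1 - x / 2 + x ^+ 2 / 6 - x ^+ 3 / 24); last by lra.
apply: ler_wpM2l => //; apply: (le_trans ht).
rewrite /t; lra.
Qed.

End HyperbolicBounds.

Section Stirling.
Variable R : realType.
Implicit Types x y z : R.

Lemma one_sub_mul_expR_le z : 0 <= z -> (1 - z) * expR z <= (1 + z) * expR (- z).
Proof.
move=> z0; rewrite -subr_ge0.
pose f x : R := (1 + x) * expR (- x) - (1 - x) * expR x.
apply: (@ge0_of_derive_ge0 R f (fun x => x * (expR x - expR (- x)))) => //.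
- move=> x; apply: is_derive_eq.
  by rewrite /GRing.scale /=; ring.
- by rewrite /f oppr0 !addr0 subrr.
- move=> x x0; rewrite mulr_ge0 // subr_ge0 ler_expR; lra.
Qed.

(** With z = 1/(2k+1) the ratio is (1 + z) / (1 - z), whose logarithm is at least 2 z. *)
Lemma succ_ratio_ge k : (0 < k)%N -> expR 2 <= (k.+1%:R / k%:R) ^+ (2 * k).+1 :> R.
Proof.
move=> k0; have kR : 0 < k%:R :> R by rewrite ltr0n.
have NE : (2 * k).+1%:R = 2 * k%:R + 1 :> R by rewrite -natr1 natrM.
have N0 : 0 < 2 * k%:R + 1 :> R by lra.
pose z : R := (2 * k%:R + 1)^-1.
have z0 : 0 <= z by rewrite invr_ge0 ltW.
have rE : k.+1%:R / k%:R = (1 + z) / (1 - z).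
  rewrite -natr1 /z; field; rewrite !lt0r_neq0 //; first lra.
have z1 : 0 < 1 - z.
  have -> : 1 - z = 2 * k%:R / (2 * k%:R + 1) by rewrite /z; field; rewrite lt0r_neq0.
  by rewrite divr_gt0 ?mulr_gt0.
have : expR (2 * z) <= k.+1%:R / k%:R.
  rewrite rE ler_pdivlMr //; have := one_sub_mul_expR_le z0.
  rewrite expRN ler_pdivlMr ?expR_gt0 // => h.
  have -> : 2 * z = z + z by ring.
  by rewrite expRD; move: h; lra.
have -> : expR 2 = expR (2 * z) ^+ (2 * k).+1 :> R.
  rewrite -expRM_natl NE /z; congr expR; field; rewrite lt0r_neq0 //.
by move=> h; rewrite lerXn2r // nnegrE ?expR_ge0 // divr_ge0.
Qed.

Lemma succ_ratio_le k : (0 < k)%N ->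
  (k.+1%:R / k%:R) ^+ (2 * k).+1 <= expR (2 + 6 / k%:R - 6 / k.+1%:R) :> R.
Proof.
move=> k0; have kR : 1 <= k%:R :> R by rewrite ler1n.
have kR0 : 0 < k%:R :> R by lra.
have NE : (2 * k).+1%:R = 2 * k%:R + 1 :> R by rewrite -natr1 natrM.
pose x : R := k%:R^-1.
have x0 : 0 < x by rewrite invr_gt0.
have x1 : x <= 1 by rewrite invf_le1.
have kE : k%:R = x^-1 by rewrite invrK.
have rE : k.+1%:R / k%:R = 1 + x by rewrite -natr1 mulrDl divff ?lt0r_neq0 // mul1r.
rewrite rE; apply: (@le_trans _ _ (expR (x - x ^+ 2 / 2 + x ^+ 3) ^+ (2 * k).+1)).
  by rewrite lerXn2r ?nnegrE ?expR_ge0 ?one_add_le_expR //; lra.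
rewrite -expRM_natl ler_expR NE -[k.+1%:R]natr1 kE invrK.
have -> : 6 / (x^-1 + 1) = 6 * x / (1 + x) by field; rewrite !lt0r_neq0 //; lra.
have -> : (2 * x^-1 + 1) * (x - x ^+ 2 / 2 + x ^+ 3) = 2 + x ^+ 2 * (3 / 2 + x).
  by field; rewrite lt0r_neq0.
have -> : 2 + 6 * x - 6 * x / (1 + x) = 2 + x ^+ 2 * (6 / (1 + x)).
  by field; rewrite lt0r_neq0 //; lra.
rewrite lerD2l; apply: ler_wpM2l; first exact: sqr_ge0.
rewrite ler_pdivlMr; last by lra.
have : x ^+ 2 <= 1 by rewrite exprn_ile1 // ltW.
lra.
Qed.

(** Stirling's formula up to a constant, squared so that only integer powers occur. The upper bound
    is monotonicity of a quotient; in the lower one the errors 6/k - 6/(k+1) telescope. Both are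
    equalities at k = 1. *)
Lemma fact_sq_bounds k : (0 < k)%N ->
  expR (6 / k%:R - 6) * (k%:R ^+ (2 * k).+1 * expR (2 - 2 * k%:R)) <= (k`!%:R : R) ^+ 2 <=
  k%:R ^+ (2 * k).+1 * expR (2 - 2 * k%:R).
Proof.
case: k => // k _; elim: k => [|k /andP[IH1 IH2]].
  by rewrite divr1 mulr1 !subrr !expR0 !expr1n !mul1r lexx.
set K : R := k.+1%:R in IH1 IH2 *; set K' : R := k.+2%:R.
have K0 : 0 < K by rewrite ltr0n.
have h1 := @succ_ratio_ge k.+1 isT; have h2 := @succ_ratio_le k.+1 isT.
rewrite -/K -/K' in h1 h2.
have E : K' ^+ (2 * k.+2).+1 = K' ^+ 2 * (K ^+ (2 * k.+1).+1 * (K' / K) ^+ (2 * k.+1).+1).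
  have KK : K * (K' / K) = K' by rewrite mulrC divfK ?lt0r_neq0.
  by rewrite -exprMn KK -exprD; congr (_ ^+ _); rewrite !mulnS.
have K'E : 2 - 2 * K' = (2 - 2 * K) - 2 by rewrite /K' -[k.+2%:R]natr1; ring.
rewrite [k.+2`!]factS natrM exprMn -/K' E K'E.
have K'2 : 0 <= K' ^+ 2 by exact: sqr_ge0.
set G := K ^+ (2 * k.+1).+1 in IH1 IH2 *; set r := (K' / K) ^+ _ in h1 h2 *.
have G0 : 0 <= G by rewrite exprn_ge0 // ltW.
have E0 := expR_ge0 (2 - 2 * K).
have E1 : expR 2 * expR (- 2) = 1 :> R by rewrite -expRD subrr expR0.
have e2 : 1 <= r * expR (- 2) by rewrite -[leLHS]E1 ler_wpM2r ?expR_ge0.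
rewrite [expR (2 - 2 * K - 2)]expRD; apply/andP; split; last first.
  rewrite -mulrA ler_wpM2l //; apply: (le_trans IH2).
  have -> : G * r * (expR (2 - 2 * K) * expR (-2)) = G * expR (2 - 2 * K) * (r * expR (-2)) by ring.
  by rewrite ler_peMr // mulr_ge0.
have e3 : expR (6 / K' - 6) * (r * expR (-2)) <= expR (6 / K - 6).
  have -> : 6 / K - 6 = (6 / K' - 6) + ((2 + 6 / K - 6 / K') - 2) by ring.
  rewrite [leRHS]expRD ler_wpM2l ?expR_ge0 // [leRHS]expRD ler_wpM2r ?expR_ge0 //.
have -> : expR (6 / K' - 6) * (K' ^+ 2 * (G * r) * (expR (2 - 2 * K) * expR (-2))) =
  K' ^+ 2 * (expR (6 / K' - 6) * (r * expR (-2)) * (G * expR (2 - 2 * K))) by ring.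
rewrite ler_wpM2l //; apply: le_trans IH1.
by rewrite ler_wpM2r // mulr_ge0.
Qed.

(** Exponents and errors both add under products, so estimating the size law becomes arithmetic on
    exponents. *)
Definition exp_near (x e d : R) := expR (e - d) <= x <= expR (e + d).

Lemma exp_nearM x e d x' e' d' :
  exp_near x e d -> exp_near x' e' d' -> exp_near (x * x') (e + e') (d + d').
Proof.
move=> /andP[h1 h2] /andP[h3 h4].
have x0 : 0 <= x by apply: le_trans h1; exact: expR_ge0.
have x0' : 0 <= x' by apply: le_trans h3; exact: expR_ge0.
rewrite /exp_near; have -> : e + e' - (d + d') = (e - d) + (e' - d') by ring.
have -> : e + e' + (d + d') = (e + d) + (e' + d') by ring.
rewrite [expR (e - d + _)]expRD [expR (e + d + _)]expRD; apply/andP; split; apply: ler_pM; rewrite ?expR_ge0 //.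
Qed.

Lemma exp_nearX m x e d : exp_near x e d -> exp_near (x ^+ m) (m%:R * e) (m%:R * d).
Proof.
move=> /andP[h1 h2]; have x0 : 0 <= x by apply: le_trans h1; exact: expR_ge0.
rewrite /exp_near -mulrBr -mulrDr !expRM_natl.
by apply/andP; split; rewrite lerXn2r ?nnegrE ?expR_ge0.
Qed.

Lemma exp_near_sqrt x e d : 0 <= x -> exp_near (x ^+ 2) (2 * e) (2 * d) -> exp_near x e d.
Proof.
move=> x0; rewrite /exp_near -mulrBr -mulrDr !expRM_natl.
by rewrite !ler_pXn2r ?nnegrE ?expR_ge0.
Qed.

Lemma exp_near_weaken x e d e' d' : `|e - e'| + d <= d' -> exp_near x e d -> exp_near x e' d'.
Proof.
move=> ed /andP[h1 h2]; have := ler_norm (e - e'); have := ler_norm (e' - e).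
rewrite distrC => n1 n2.
apply/andP; split.
  by apply: le_trans h1; rewrite ler_expR; lra.
by apply: (le_trans h2); rewrite ler_expR; lra.
Qed.

Lemma exp_near_expR e : exp_near (expR e) e 0.
Proof. by rewrite /exp_near subr0 addr0 lexx. Qed.

Lemma exp_near_one_add x : `|x| <= 1 / 4 -> exp_near (1 + x) (x - x ^+ 2 / 2) (`|x| ^+ 3).
Proof.
move=> x4; have [x0|x0] := lerP 0 x.
  rewrite ger0_norm // in x4 *; apply/andP; split.
    by apply: expR_le_one_add; rewrite x0.
  exact: one_add_le_expR.
rewrite ltr0_norm // in x4 *; have y0 : 0 <= - x by lra.
apply/andP; split.
  have -> : x - x ^+ 2 / 2 - (- x) ^+ 3 = - - x - (- x) ^+ 2 / 2 - (- x) ^+ 3 by rewrite opprK sqrrN.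
  have -> : 1 + x = 1 - - x by rewrite opprK.
  by apply: expR_le_one_sub; rewrite y0.
have -> : 1 + x = 1 - - x by rewrite opprK.
apply: le_trans (one_sub_le_expR y0) _; rewrite ler_expR opprK sqrrN lerDl.
by rewrite exprn_ge0.
Qed.

Lemma exp_near_fact k : (0 < k)%N ->
  exp_near (k%:R ^+ k * Num.sqrt k%:R / k`!%:R) k%:R 3.
Proof.
move=> k0; have kR : 0 < k%:R :> R by rewrite ltr0n.
have f0 : 0 < k`!%:R :> R by rewrite ltr0n fact_gt0.
apply: exp_near_sqrt; first by rewrite divr_ge0 ?mulr_ge0 ?exprn_ge0 ?sqrtr_ge0 ?ler0n.
rewrite expr_div_n exprMn sqr_sqrtr ?ler0n // -exprM -exprSr mulnC.
have /andP[h1 h2] := fact_sq_bounds k0.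
have k6 : 0 <= 6 / k%:R :> R by rewrite divr_ge0 ?ler0n.
have f2 : 0 < k`!%:R ^+ 2 :> R by rewrite exprn_gt0.
have P0 : 0 < k%:R ^+ (2 * k).+1 :> R by rewrite exprn_gt0.
move: h1 h2 f2 P0; move: (_ ^+ (2 * k).+1) (_ ^+ 2) => G F h1 h2 F0 G0.
apply/andP; split.
  rewrite ler_pdivlMr // mulrC -ler_pdivlMr ?expR_gt0 // -expRN; apply: (le_trans h2).
  by rewrite ler_wpM2l ?(ltW G0) // ler_expR; lra.
rewrite ler_pdivrMr //; apply: (@le_trans _ _ (expR (2 * k%:R + 2 * 3) *
   (expR (6 / k%:R - 6) * (G * expR (2 - 2 * k%:R))))); last by rewrite ler_wpM2l ?expR_ge0.
rewrite [G * _]mulrC !mulrA -!expRD -[leLHS]mul1r ler_wpM2r ?(ltW G0) //.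
by rewrite -[leLHS]expR0 ler_expR; lra.
Qed.

Lemma exp_near_one_sub_expRN y : 0 < y <= 1 / 4 ->
  exp_near ((1 - expR (- y)) / y) (- (y / 2) + y ^+ 2 / 24) (y ^+ 3).
Proof.
move=> /andP[y0 y1]; have yI : 0 <= y <= 1 / 4 by rewrite ltW.
apply/andP; split.
  by rewrite ler_pdivlMr // mulrC one_sub_expRN_ge.
by rewrite ler_pdivrMr // mulrC one_sub_expRN_le_sharp.
Qed.

(** The logarithm of each factor is expanded to second order; the closed forms are the sums of i,
    i^2 and i^3 for i up to [m]. *)
Lemma exp_near_falling_prod (N : R) m : 0 < N -> m%:R <= N / 4 ->
  exp_near (\prod_(i < m) (1 - i.+1%:R / N))
    (- (m%:R * (m%:R + 1) / (2 * N)) - m%:R * (m%:R + 1) * (2 * m%:R + 1) / (12 * N ^+ 2))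
    (m%:R ^+ 2 * (m%:R + 1) ^+ 2 / (4 * N ^+ 3)).
Proof.
move=> N0; elim: m => [|m IH] mN.
  by rewrite big_ord0 /exp_near !(mul0r, expr0n, subr0, oppr0, addr0, expR0) lexx.
have x0 : 0 <= m.+1%:R / N by rewrite divr_ge0 ?ler0n // ltW.
have x4 : m.+1%:R / N <= 1 / 4 by rewrite ler_pdivrMr //; lra.
have mN' : m%:R <= N / 4 by apply: le_trans mN; rewrite ler_nat.
have x4' : `|- (m.+1%:R / N)| <= 1 / 4 by rewrite normrN ger0_norm.
have := exp_nearM (IH mN') (exp_near_one_add x4').
rewrite big_ord_recr /= normrN ger0_norm //.
apply: exp_near_weaken; rewrite -[m.+1%:R]natr1.
set M : R := m%:R.
have -> : - (M * (M + 1) / (2 * N)) - M * (M + 1) * (2 * M + 1) / (12 * N ^+ 2) +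
  (- ((M + 1) / N) - (- ((M + 1) / N)) ^+ 2 / 2) -
  (- ((M + 1) * (M + 1 + 1) / (2 * N)) -
   (M + 1) * (M + 1 + 1) * (2 * (M + 1) + 1) / (12 * N ^+ 2)) = 0.
  by field; rewrite lt0r_neq0.
rewrite normr0 add0r le_eqVlt; apply/orP; left; apply/eqP.
by field; rewrite lt0r_neq0.
Qed.

End Stirling.

(** * The binomial factor of the size law *)

(* The probability that a component has size [k], up to the factor [rho p k k.-1]. *)
Definition bpmf (R : comNzRingType) (p : R) (n k : nat) : R :=
  'C(n.-1, k.-1)%:R * (1 - (1 - p) ^+ k) ^+ k.-1 * (1 - p) ^+ (k * (n - k)).

Section Bpmf.
Variable R : realType.
Implicit Types t a l p x y z : R.

Lemma bin_falling_prod n m : (m < n)%N ->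
  'C(n.-1, m)%:R = n%:R ^+ m * \prod_(i < m) (1 - i.+1%:R / n%:R) / m`!%:R :> R.
Proof.
move=> mn; have n0 : n%:R != 0 :> R by rewrite pnatr_eq0 -lt0n (leq_trans _ mn).
have f0 : m`!%:R != 0 :> R by rewrite pnatr_eq0 -lt0n fact_gt0.
apply: (mulIf f0); rewrite divfK // -natrM bin_ffact ffact_prod natr_prod.
transitivity (\prod_(i < m) (n%:R * (1 - i.+1%:R / n%:R)) : R).
  apply: eq_bigr => i _; rewrite mulrBr mulr1 mulrCA divff // mulr1 -natrB; last first.
    exact: leq_trans (ltn_ord i) (ltnW mn).
  by rewrite subnS predn_sub.
by rewrite big_split /= prodr_const card_ord.
Qed.

Lemma neg_ln_bounds p : 0 <= p <= 1 / 4 ->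
  exists2 P, 1 - p = expR (- P) & p <= P <= p + p ^+ 2.
Proof.
move=> /andP[p0 p1]; have q0 : 0 < 1 - p by lra.
have E : expR (ln (1 - p)) = 1 - p by rewrite lnK // posrE.
exists (- ln (1 - p)); rewrite ?opprK //; apply/andP; split.
  by rewrite lerNr -ler_expR E; exact: expR_ge1Dx.
rewrite lerNl -ler_expR E; apply: le_trans (expR_le_one_sub _); last by rewrite p0.
rewrite ler_expR opprD; have : p * p ^+ 2 <= 1 / 4 * p ^+ 2 by rewrite ler_wpM2r ?sqr_ge0.
have := sqr_ge0 p; lra.
Qed.

(** With P = - ln (1 - p), every factor has an [exp_near] estimate; the square root on the left
    absorbs the polynomial part of Stirling's formula. *)
Lemma bpmf_factor n m p P : (m.+1 <= n)%N -> 0 < P -> 1 - p = expR (- P) ->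
  Num.sqrt m.+1%:R * bpmf p n m.+1 =
  \prod_(i < m) (1 - i.+1%:R / n%:R) * (m.+1%:R ^+ m.+1 * Num.sqrt m.+1%:R / (m.+1)`!%:R)
  * ((1 - expR (- (m.+1%:R * P))) / (m.+1%:R * P)) ^+ m * (n%:R * P) ^+ m
  * expR (- (m.+1%:R * P * (n%:R - m.+1%:R))).
Proof.
move=> mn P0 qE; rewrite /bpmf succnK bin_falling_prod // qE -!expRM_natl natrM natrB //.
have -> : m.+1%:R * (n%:R - m.+1%:R) * - P = - (m.+1%:R * P * (n%:R - m.+1%:R)) by ring.
rewrite mulrN factS natrM exprS !expr_div_n !exprMn.
have P1 : P ^+ m != 0 by rewrite expf_neq0 ?lt0r_neq0.
have K1 : m.+1%:R != 0 :> R by rewrite pnatr_eq0.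
have K2 : m.+1%:R ^+ m != 0 :> R by rewrite expf_neq0.
have f0 : m`!%:R != 0 :> R by rewrite pnatr_eq0 -lt0n fact_gt0.
move: (\prod_(i < m) _) (expR (- (_ * (_ - _)))) ((1 - _) ^+ m) (P ^+ m) P1 (n%:R ^+ m).
move=> a b c d d0 e.
move: (Num.sqrt (m.+1%:R : R)) => r.
move: (m.+1%:R ^+ m) K2 => G G0; move: (m.+1%:R : R) K1 => K K1.
move: (m`!%:R : R) f0 => f f0.
by field; rewrite K1 f0 G0 d0.
Qed.

Lemma small_param a t : 10 <= a -> 0 < t -> a ^+ 10 * t <= 1 ->
  [/\ a ^+ 4 * t <= 1 / 100, a * t <= 1 / 100 & t <= 1 / 10 * (a * t)].
Proof.
move=> a10 t0 at1; have a0 : 0 < a by lra.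
have ge1 j i : (j <= i)%N -> a ^+ j <= a ^+ i by move=> ji; rewrite ler_weXn2l //; lra.
have a2 : 100 <= a ^+ 2 by rewrite expr2; have := ler_pM _ _ a10 a10; lra.
have key i : (i + 2 <= 10)%N -> 100 * (a ^+ i * t) <= 1.
  move=> hi; apply: le_trans at1; rewrite mulrA ler_wpM2r ?(ltW t0) //.
  apply: (@le_trans _ _ (a ^+ (i + 2))); last exact: ge1.
  by rewrite exprD mulrC ler_wpM2l ?exprn_ge0 // ltW.
split.
- have := key 4%N isT; lra.
- have := key 1%N isT; rewrite expr1; lra.
- have := ler_wpM2r (ltW t0) a10; lra.
Qed.

(** Subtracting the claimed exponent cancels all large terms. Of the remainder,
    [x ^+ 3 * (2 * e + e ^+ 2) / 24] is of order a^4 t when x is of order a. *)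
Lemma exponent_identity t l c x e y N K M : 0 < t -> N = (t ^+ 3)^-1 -> K = x / t ^+ 2 ->
  M = K - 1 -> e = l * t + c * t ^+ 3 -> y = x * t * (1 + e) ->
  - (M * (M + 1) / (2 * N)) - M * (M + 1) * (2 * M + 1) / (12 * N ^+ 2) + K +
    M * (- (y / 2) + y ^+ 2 / 24) + M * (e - e ^+ 2 / 2) - y * (N - K) -
    - (x ^+ 3 / 8 - l * x ^+ 2 / 2 + l ^+ 2 * x / 2) =
  x * t / 2 + (x * t) ^+ 2 / 4 - x * t * t ^+ 3 / 12 + c * (x * t) ^+ 2 / 2
    - c * (x * t) * (2 * (l * t) + c * t ^+ 3) / 2 + x ^+ 3 * (2 * e + e ^+ 2) / 24
    + y / 2 - y ^+ 2 / 24 - e + e ^+ 2 / 2.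
Proof.
by move=> t0 -> -> -> -> ->; field; rewrite lt0r_neq0.
Qed.

Lemma norm_mul_le x y u v : `|x| <= u -> `|y| <= v -> `|x * y| <= u * v.
Proof. by move=> xu yv; rewrite normrM; apply: ler_pM. Qed.

Lemma exponent_error t a l c x e y N K M : 0 < t -> t <= 1 -> 0 < a ->
  a * t <= 1 / 100 -> a ^+ 4 * t <= 1 / 100 -> N = (t ^+ 3)^-1 -> K = x / t ^+ 2 ->
  M = K - 1 -> e = l * t + c * t ^+ 3 -> y = x * t * (1 + e) ->
  0 <= M -> 0 < x <= 3 * a -> `|l * t| <= 1 / 4 -> 0 <= c <= 4 -> c * t ^+ 3 <= 1 / 2 ->
  `|e| <= a * t ->
  `|- (M * (M + 1) / (2 * N)) - M * (M + 1) * (2 * M + 1) / (12 * N ^+ 2) + K +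
    M * (- (y / 2) + y ^+ 2 / 24) + M * (e - e ^+ 2 / 2) - y * (N - K) -
    - (x ^+ 3 / 8 - l * x ^+ 2 / 2 + l ^+ 2 * x / 2)| +
  (M ^+ 2 * (M + 1) ^+ 2 / (4 * N ^+ 3) + 3 + M * y ^+ 3 + M * `|e| ^+ 3 + 0) <= 11.
Proof.
move=> t0 t1 a0 z1 s1 NE KE ME eE yE M0 /andP[x0 xa] lt1 /andP[c0 c4] ct1 ez.
rewrite (exponent_identity t0 NE KE ME eE yE).
have z0 : 0 < a * t by rewrite mulr_gt0.
have xt0 : 0 < x * t by rewrite mulr_gt0.
have xt : x * t <= 3 / 100.
  by apply: (@le_trans _ _ (3 * a * t)); [rewrite ler_wpM2r // ltW|rewrite -mulrA; lra].
have e1 : `|e| <= 1 / 100 by exact: le_trans z1.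
have [ee1 ee2] : - (1 / 100) <= e /\ e <= 1 / 100 by apply/andP; rewrite -ler_norml.
have x3 : x ^+ 3 <= 27 * a ^+ 3.
  have -> : 27 * a ^+ 3 = (3 * a) ^+ 3 by ring.
  by rewrite lerXn2r // nnegrE ?ltW // mulr_gt0.
have x4 : x ^+ 4 * t <= 81 / 100.
  apply: (@le_trans _ _ ((3 * a) ^+ 4 * t)).
    by rewrite ler_wpM2r ?(ltW t0) // lerXn2r // nnegrE ?ltW // mulr_gt0.
  by rewrite exprMn; lra.
have y0 : 0 < y by rewrite yE mulr_gt0 //; lra.
have y2 : y <= 2 * (x * t) by rewrite yE mulrC ler_wpM2r ?(ltW xt0) //; lra.
have K0 : 0 <= K by rewrite KE divr_ge0 ?exprn_ge0 // ltW.
have MK : M <= K by rewrite ME; lra.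
have B1 : M ^+ 2 * (M + 1) ^+ 2 / (4 * N ^+ 3) <= 1 / 4.
  have -> : M + 1 = K by rewrite ME subrK.
  apply: (@le_trans _ _ (K ^+ 2 * K ^+ 2 / (4 * N ^+ 3))).
    rewrite ler_wpM2r ?invr_ge0 ?mulr_ge0 ?exprn_ge0 ?NE ?invr_ge0 ?exprn_ge0 ?ler0n ?(ltW t0) //.
    by rewrite ler_wpM2r ?sqr_ge0 // lerXn2r.
  have -> : K ^+ 2 * K ^+ 2 / (4 * N ^+ 3) = x ^+ 4 * t / 4.
    by rewrite KE NE; field; rewrite lt0r_neq0.
  lra.
have B2 : M * y ^+ 3 <= 13 / 2.
  apply: (@le_trans _ _ (K * (2 * (x * t)) ^+ 3)).
    apply: ler_pM; rewrite ?exprn_ge0 ?(ltW y0) //.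
    by rewrite lerXn2r // nnegrE ?ltW // mulr_gt0.
  have -> : K * (2 * (x * t)) ^+ 3 = 8 * (x ^+ 4 * t) by rewrite KE; field; rewrite lt0r_neq0.
  lra.
have B3 : M * `|e| ^+ 3 <= 3 / 100.
  apply: (@le_trans _ _ (K * (a * t) ^+ 3)).
    apply: ler_pM; rewrite ?exprn_ge0 //.
    by rewrite lerXn2r // nnegrE ltW.
  have -> : K * (a * t) ^+ 3 = x * (a ^+ 3 * t) by rewrite KE; field; rewrite lt0r_neq0.
  apply: (@le_trans _ _ (3 * a * (a ^+ 3 * t))).
    by rewrite ler_wpM2r // mulr_ge0 ?exprn_ge0 // ltW.
  have -> : 3 * a * (a ^+ 3 * t) = 3 * (a ^+ 4 * t) by ring.
  lra.
have B6 : `|x ^+ 3 * (2 * e + e ^+ 2)| <= 27 * a ^+ 3 * (3 * (a * t)).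
  apply: norm_mul_le; first by rewrite ger0_norm ?exprn_ge0 // ltW.
  have -> : 2 * e + e ^+ 2 = e * (2 + e) by ring.
  rewrite [3 * _]mulrC; apply: norm_mul_le => //.
  by rewrite ger0_norm; lra.
have B5 : `|c * (x * t) * (2 * (l * t) + c * t ^+ 3)| <= 4 * (3 / 100) * 1.
  apply: norm_mul_le.
    by apply: norm_mul_le; rewrite ger0_norm ?(ltW xt0).
  apply: le_trans (ler_normD _ _) _; rewrite normrM [`|2|]ger0_norm //.
  by rewrite [`|c * _|]ger0_norm ?mulr_ge0 ?exprn_ge0 ?(ltW t0) //; lra.
have B4 : c * (x * t) ^+ 2 <= 4 * (1 / 100).
  apply: ler_pM; rewrite ?sqr_ge0 //.
  have : (x * t) ^+ 2 <= (3 / 100) ^+ 2 by rewrite lerXn2r // nnegrE ?divr_ge0 // ltW.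
  lra.
have B40 : 0 <= c * (x * t) ^+ 2 by rewrite mulr_ge0 ?sqr_ge0.
have B7 : (x * t) ^+ 2 <= x * t.
  by rewrite expr2 ler_piMr ?(ltW xt0) //; lra.
have B8 : x * t * t ^+ 3 <= x * t.
  by rewrite ler_piMr ?(ltW xt0) // exprn_ile1 // ltW.
have B80 : 0 <= x * t * t ^+ 3 by rewrite mulr_ge0 ?exprn_ge0 ?ltW.
have B9 : y ^+ 2 <= y by rewrite expr2 ler_piMr ?(ltW y0) //; clear - y2 xt; lra.
have B10 : e ^+ 2 <= 1 / 100.
  by rewrite -[e ^+ 2]ger0_norm ?sqr_ge0 // normrX expr2 -[leRHS]mulr1 ler_pM //; clear - e1; lra.
have := sqr_ge0 e; have := sqr_ge0 y; have := sqr_ge0 (x * t).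
have aa : 27 * a ^+ 3 * (3 * (a * t)) = 81 * (a ^+ 4 * t) by ring.
rewrite aa in B6.
move: B5 B6; rewrite !ler_norml => /andP[B51 B52] /andP[B61 B62].
move: (x ^+ 3 * _) (c * _ * (2 * _ + _)) (c * (x * t) ^+ 2) (x * t * t ^+ 3) B51 B52 B61 B62 B4 B40 B8 B80.
move=> b6 b5 b4 b8 B51 B52 B61 B62 B4 B40 B8 B80.
move: ((x * t) ^+ 2) (y ^+ 2) (e ^+ 2) B7 B9 B10 => b7 b9 b10 B7 B9 B10 q1 q2 q3.
(* The budget of 11: at most 1 for the remainder of the identity, 1/4 for the falling product, 3 for
   Stirling, 13/2 and 3/100 for the two powers. *)
suff : `|x * t / 2 + b7 / 4 - b8 / 12 + b4 / 2 - b5 / 2 + b6 / 24 + y / 2 - b9 / 24 - e + b10 / 2| <= 1.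
  by move=> h; clear - h B1 B2 B3; lra.
clear - B51 B52 B61 B62 B4 B40 B8 B80 B7 B9 B10 q1 q2 q3 s1 y2 xt y0 xt0 ee1 ee2.
by rewrite ler_norml; apply/andP; split; lra.
Qed.

Lemma regime_bounds t a l p : 0 < t -> 10 <= a -> a ^+ 10 * t <= 1 -> `|l| <= a / 3 ->
  p = t ^+ 3 * (1 + l * t) ->
  [/\ `|l * t| <= a * t / 3, t ^+ 3 / 2 <= p, p <= 2 * t ^+ 3 & exists P c,
     [/\ 1 - p = expR (- P), p <= P, P = t ^+ 3 * (1 + (l * t + c * t ^+ 3)) & 0 <= c <= 4]].
Proof.
move=> t0 a10 at1 la pE.
have [_ z1 tz] := small_param a10 t0 at1.
have a0 : 0 < a by lra.
have z0 : 0 < a * t by rewrite mulr_gt0.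
have lt1 : `|l * t| <= a * t / 3.
  by rewrite normrM [`|t|]gtr0_norm // mulrAC ler_wpM2r // ltW.
have /andP[lt2 lt3] : - (a * t / 3) <= l * t <= a * t / 3 by rewrite -ler_norml.
have t30 : 0 < t ^+ 3 by rewrite exprn_gt0.
have t1 : t <= 1 by lra.
have t31 : t ^+ 3 <= t by rewrite exprS ler_piMr ?(ltW t0) // exprn_ile1 // ltW.
have ph : t ^+ 3 / 2 <= p by rewrite pE ler_wpM2l ?(ltW t30) //; lra.
have p2 : p <= 2 * t ^+ 3 by rewrite pE mulrC ler_wpM2r ?(ltW t30) //; lra.
split=> //.
have p4 : 0 <= p <= 1 / 4 by apply/andP; split; lra.
have [P qE /andP[P1 P2]] := neg_ln_bounds p4.
(* [c] is the normalized excess of - ln (1 - p) over [p]; the 4 is the square of the 2 in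
   [p <= 2 t^3]. *)
exists P, ((P / t ^+ 3 - (1 + l * t)) / t ^+ 3); split=> //.
  by field; rewrite lt0r_neq0.
apply/andP; split.
  by rewrite divr_ge0 ?(ltW t30) // subr_ge0 ler_pdivlMr // mulrC -pE.
rewrite ler_pdivrMr // lerBlDr ler_pdivrMr //; apply: (le_trans P2).
have p0 : 0 <= p by lra.
have : p ^+ 2 <= (2 * t ^+ 3) ^+ 2 by rewrite lerXn2r // nnegrE mulr_ge0 // ltW.
by rewrite pE; lra.
Qed.

Lemma bpmf_near n k t a l p : 0 < t -> n%:R * t ^+ 3 = 1 -> 10 <= a ->
  a ^+ 10 * t <= 1 -> `|l| <= a / 3 -> p = t ^+ 3 * (1 + l * t) ->
  (0 < k)%N -> k%:R * t ^+ 2 <= 3 * a ->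
  exp_near (Num.sqrt k%:R * bpmf p n k)
    (- ((k%:R * t ^+ 2) ^+ 3 / 8 - l * (k%:R * t ^+ 2) ^+ 2 / 2 + l ^+ 2 * (k%:R * t ^+ 2) / 2)) 11.
Proof.
move=> t0 nt a10 at1 la pE k0 ka.
have [s1 z1 tz] := small_param a10 t0 at1.
have [lt1 ph _ [P [c [qE P1 PE /andP[c0 c4]]]]] := regime_bounds t0 a10 at1 la pE.
have a0 : 0 < a by lra.
have z0 : 0 < a * t by rewrite mulr_gt0.
have t1 : t <= 1 by lra.
have /andP[lt2 lt3] : - (a * t / 3) <= l * t <= a * t / 3 by rewrite -ler_norml.
have t30 : 0 < t ^+ 3 by rewrite exprn_gt0.
have t31 : t ^+ 3 <= t by rewrite exprS ler_piMr ?(ltW t0) // exprn_ile1 // ltW.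
have p0 : 0 < p by apply: lt_le_trans ph; rewrite divr_gt0.
pose e := l * t + c * t ^+ 3.
have ct0 : 0 <= c * t ^+ 3 by rewrite mulr_ge0 // ltW.
have ct1 : c * t ^+ 3 <= 4 * t by apply: ler_pM => //; exact: ltW.
have /andP[e1 e2] : - (a * t) <= e <= a * t by rewrite /e; apply/andP; split; lra.
pose x : R := k%:R * t ^+ 2.
have kR : 0 < k%:R :> R by rewrite ltr0n.
have x0 : 0 < x by rewrite mulr_gt0 // exprn_gt0.
rewrite -/x in ka *.
have xt : x * t <= 3 * (a * t) by rewrite mulrA ler_wpM2r // ltW.
have xt0 : 0 < x * t by rewrite mulr_gt0.
pose y := x * t * (1 + e).
have yE : k%:R * P = y by rewrite PE -/e /y /x; ring.
have y0 : 0 < y by rewrite mulr_gt0 //; lra.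
have y2 : y <= 2 * (x * t) by rewrite /y mulrC ler_wpM2r ?(ltW xt0) //; lra.
have y4 : 0 < y <= 1 / 4 by rewrite y0 /=; lra.
have n0 : 0 < n%:R :> R.
  by rewrite -(pmulr_lgt0 _ t30) nt.
have nE : n%:R = (t ^+ 3)^-1 by apply: (mulIf (lt0r_neq0 t30)); rewrite nt mulVf ?lt0r_neq0.
have kn4 : k%:R <= n%:R / 4 :> R.
  have : k%:R * t ^+ 2 * t <= 1 / 4 by rewrite -/x; lra.
  move=> h; rewrite nE mulrC ler_pdivlMr // exprSr mulrA; lra.
have kn : (k <= n)%N.
  by rewrite -(ler_nat R); clear - kn4 n0; lra.
have norme : `|e| <= a * t by rewrite ler_norml e1.
case: k k0 kR @x x0 ka xt xt0 @y yE y0 y2 y4 kn4 kn => // m _ kR x x0 ka xt xt0 y yE y0 y2 y4 kn4 kn.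
have mk : m%:R = m.+1%:R - 1 :> R by rewrite -natr1 addrK.
have mn4 : m%:R <= n%:R / 4 :> R by rewrite mk; clear - kn4; lra.
have near1 := exp_near_falling_prod n0 mn4.
have near2 := exp_near_fact R (isT : 0 < m.+1)%N.
have near3 := exp_nearX m (exp_near_one_sub_expRN y4).
have near4 : exp_near ((1 + e) ^+ m) (m%:R * (e - e ^+ 2 / 2)) (m%:R * `|e| ^+ 3).
  by apply/exp_nearX/exp_near_one_add; clear - norme z1; lra.
have near5 := exp_near_expR (- (y * (n%:R - m.+1%:R))).
have := exp_nearM (exp_nearM (exp_nearM (exp_nearM near1 near2) near3) near4) near5.
set W := (X in exp_near X).
have -> : W = Num.sqrt m.+1%:R * bpmf p n m.+1.
  rewrite /W (bpmf_factor kn (_ : 0 < P) qE); last exact: lt_le_trans P1.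
  rewrite yE; have -> : n%:R * P = 1 + e; last by [].
  by rewrite PE nE mulKf ?lt0r_neq0.
apply: exp_near_weaken.
apply: (@exponent_error t a l c); rewrite ?x0 ?c0 ?ler0n //.
- by rewrite /x mulfK // lt0r_neq0 // exprn_gt0.
- by rewrite ler_norml; clear - lt2 lt3 z1; apply/andP; split; lra.
- clear - ct1 tz z1; lra.
Qed.

End Bpmf.

(** * Decay of the successive quotients of the size law *)

Section Ratio.
Variable R : realType.
Implicit Types t a l p x y z : R.

Lemma bpmf_ge0 p n k : 0 <= p <= 1 -> 0 <= bpmf p n k.
Proof.
move=> /andP[p0 p1]; have q0 : 0 <= 1 - p by rewrite subr_ge0.
have q1 : 1 - p <= 1 by rewrite gerBl.
by rewrite !mulr_ge0 ?ler0n ?exprn_ge0 // subr_ge0 exprn_ile1.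
Qed.

Lemma bpmf_succ_le p P n k : (0 < k)%N -> (k < n)%N -> 0 < p < 1 -> 1 - p = expR (- P) ->
  bpmf p n k.+1 <= bpmf p n k * ((n%:R - k%:R) / k%:R * (1 - (1 - p) ^+ k) *
     expR (k%:R * p * (1 - p) ^+ k / (1 - (1 - p) ^+ k)) * expR (- (n%:R - 2 * k%:R - 1) * P)).
Proof.
case: k => // m _ kn /andP[p0 p1] qE; set k := m.+1.
have k0 : 0 < k%:R :> R by rewrite ltr0n.
set q := 1 - p; have q0 : 0 < q by rewrite subr_gt0.
have q1 : q < 1 by rewrite gtrBl.
have u0 : 0 < 1 - q ^+ k by rewrite subr_gt0 exprn_ilt1 // ltW.
set u := 1 - q ^+ k in u0 *.
have CE : 'C(n.-1, m.+1)%:R = (n%:R - k%:R) / k%:R * 'C(n.-1, m)%:R :> R.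
  have := congr1 (fun i : nat => i%:R : R) (mul_bin_left n.-1 m).
  rewrite /= !natrM -predn_sub -subnS -/k natrB ?(ltnW kn) // => E.
  by rewrite mulrAC -E [k%:R * _]mulrC mulfK // lt0r_neq0.
have uE : 1 - q ^+ k.+1 = u * (1 + p * q ^+ k / u).
  rewrite mulrDr mulr1 [u * _]mulrC divfK ?lt0r_neq0 // /u exprS /q; ring.
have le1 : (1 - q ^+ k.+1) ^+ k <= u ^+ m * (u * expR (k%:R * p * q ^+ k / u)).
  rewrite mulrA -exprSr -/k -!mulrA expRM_natl -exprMn uE lerXn2r ?nnegrE //.
  - by rewrite mulr_ge0 ?(ltW u0) // addr_ge0 // divr_ge0 ?(ltW u0) // mulr_ge0 ?exprn_ge0 ?ltW.
  - by rewrite mulr_ge0 ?expR_ge0 ?ltW.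
  - by rewrite ler_wpM2l ?(ltW u0) // -mulrA expR_ge1Dx.
have qX : q ^+ (k.+1 * (n - k.+1)) = q ^+ (k * (n - k)) * expR (- (n%:R - 2 * k%:R - 1) * P).
  rewrite /q qE -!expRM_natl -expRD !natrM !natrB ?(ltnW kn) //; congr expR.
  by rewrite -[k.+1%:R]natr1; ring.
rewrite /bpmf !succnK qX CE -/q -/u.
set Q := q ^+ (k * (n - k)); set E1 := expR (- _ * P).
set C := 'C(n.-1, m)%:R; set F := (n%:R - k%:R) / k%:R.
have F0 : 0 <= F by rewrite divr_ge0 ?ler0n // subr_ge0 ler_nat ltnW.
have -> : C * u ^+ m * Q * (F * u * expR (k%:R * p * q ^+ k / u) * E1) =
  F * C * (u ^+ m * (u * expR (k%:R * p * q ^+ k / u))) * (Q * E1) by ring.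
apply: ler_wpM2r; first by rewrite mulr_ge0 ?expR_ge0 ?exprn_ge0 // ltW.
by apply: ler_wpM2l => //; rewrite mulr_ge0 ?ler0n.
Qed.

Lemma geometric_tail (g : nat -> R) (r : R) k0 n : (0 < k0)%N -> 0 <= r < 1 ->
  (forall k, 0 <= g k) -> (forall k, (k0 <= k)%N -> (k < n)%N -> g k.+1 <= r * g k) ->
  \sum_(j < n) (k0 <= j.+1)%:R * g j.+1 <= g k0 / (1 - r).
Proof.
move=> k00 /andP[r0 r1] g0 gr; have r1' : 0 < 1 - r by rewrite subr_gt0.
have T0 m : 0 <= (k0 <= m)%:R * (r * g m) / (1 - r).
  by apply: mulr_ge0; [apply: mulr_ge0; [exact: ler0n|exact: mulr_ge0]|rewrite invr_ge0 ltW].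
(* The added term is the geometric bound for everything beyond [m], which makes the statement
   inductive. *)
have H m : (m <= n)%N -> \sum_(j < m) (k0 <= j.+1)%:R * g j.+1 +
    (k0 <= m)%:R * (r * g m) / (1 - r) <= g k0 / (1 - r).
  elim: m => [|m IH] mn.
    by rewrite big_ord0 add0r leqNgt k00 !mul0r divr_ge0 // ltW.
  rewrite big_ord_recr /= -addrA.
  have -> : (k0 <= m.+1)%:R * g m.+1 + (k0 <= m.+1)%:R * (r * g m.+1) / (1 - r) =
      (k0 <= m.+1)%:R * (g m.+1 / (1 - r)).
    by field; rewrite lt0r_neq0.
  case: (ltngtP k0 m.+1) => [km|mk|->].
  - rewrite mul1r; apply: le_trans (IH (ltnW mn)); rewrite lerD2l ltnS in km *.
    by rewrite km mul1r ler_pM2r ?invr_gt0 // gr.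
  - by rewrite mul0r addr0; apply: le_trans (IH (ltnW mn)); rewrite lerDl.
  - rewrite mul1r big1 ?add0r // => j _; have -> : (m < j.+1)%N = false.
      by apply/negbTE; rewrite -leqNgt ltn_ord.
    by rewrite mul0r.
apply: le_trans (H n (leqnn n)); by rewrite lerDl.
Qed.

(** The weight k^2 stands for the factor (p k)^2 bounding [rho], so the decay proved here carries
    over to the bound for the full size law. *)
Lemma bpmf_ratio n k t a l p : 0 < t -> n%:R * t ^+ 3 = 1 -> 10 <= a ->
  a ^+ 10 * t <= 1 -> `|l| <= a / 3 -> p = t ^+ 3 * (1 + l * t) ->
  a <= k%:R * t ^+ 2 -> (k < n)%N ->
  k.+1%:R ^+ 2 * bpmf p n k.+1 <= expR (- ((a * t) ^+ 2 / 100)) * (k%:R ^+ 2 * bpmf p n k).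
Proof.
move=> t0 nt a10 at1 la pE ak kn.
have [s1 z1 tz] := small_param a10 t0 at1.
have [lt1 ph p2 [P [c [qE P1 PE /andP[c0 c4]]]]] := regime_bounds t0 a10 at1 la pE.
have a0 : 0 < a by lra.
have z0 : 0 < a * t by rewrite mulr_gt0.
have t1 : t <= 1 / 100 by lra.
have /andP[lt2 lt3] : - (a * t / 3) <= l * t <= a * t / 3 by rewrite -ler_norml.
have t30 : 0 < t ^+ 3 by rewrite exprn_gt0.
have t20 : 0 < t ^+ 2 by rewrite exprn_gt0.
have p0 : 0 < p by apply: lt_le_trans ph; rewrite divr_gt0.
have kR : 0 < k%:R :> R by rewrite -(pmulr_lgt0 _ t20); apply: lt_le_trans ak.
have k0 : (0 < k)%N by rewrite -(ltr0n R).
have nR : 0 < n%:R :> R by rewrite -(pmulr_lgt0 _ t30) nt.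
have nE : n%:R = (t ^+ 3)^-1 by apply: (mulIf (lt0r_neq0 t30)); rewrite nt mulVf ?lt0r_neq0.
pose x := k%:R * t ^+ 3.
have x0 : 0 < x by rewrite mulr_gt0.
have x1 : x < 1 by rewrite -[ltRHS]nt ltr_pM2r // ltr_nat.
have ax : a * t <= x by rewrite /x exprSr mulrA ler_pM2r.
have t31 : t ^+ 3 <= t by rewrite exprS ler_piMr ?(ltW t0) // exprn_ile1 ?ltW //; lra.
have t32 : t ^+ 3 <= t * (x ^+ 2 / 100).
  rewrite exprS ler_pM2l //; have : (10 * t) ^+ 2 <= x ^+ 2; last by lra.
  rewrite lerXn2r ?nnegrE ?mulr_ge0 ?(ltW t0) ?(ltW x0) //; apply: le_trans ax.
  by rewrite ler_wpM2r // ltW.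
have t33 : t ^+ 3 <= x ^+ 3 / 1000.
  have : (10 * t) ^+ 3 <= x ^+ 3; last by lra.
  rewrite lerXn2r ?nnegrE ?mulr_ge0 ?(ltW t0) ?(ltW x0) //; apply: le_trans ax.
  by rewrite ler_wpM2r // ltW.
pose e := l * t + c * t ^+ 3.
have ct0 : 0 <= c * t ^+ 3 by rewrite mulr_ge0 // ltW.
have ct1 : c * t ^+ 3 <= 4 * t ^+ 3 by rewrite ler_wpM2r // ltW.
have e1 : - (1 / 100) <= e by rewrite /e; clear - lt2 z1 ct0 z0; lra.
have e2 : e <= 1 / 100 by rewrite /e; clear - lt3 z1 ct1 t31 tz; lra.
have e3 : e <= x / 3 + 4 * t ^+ 3 by rewrite /e; clear - lt3 ax ct1; lra.
have x2 : 0 < x ^+ 2 by rewrite exprn_gt0.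
have x4 : x * t ^+ 3 <= t ^+ 3 by rewrite ler_piMl // ltW.
have nPE : n%:R * P = 1 + e by rewrite PE nE mulKf ?lt0r_neq0.
pose y := x * (1 + e).
have yE : k%:R * P = y by rewrite PE -/e /y /x; ring.
have y0 : 0 < y by rewrite mulr_gt0 //; clear - e1; lra.
have P0 : 0 < P by exact: lt_le_trans P1.
have Pu : P <= 2 * t ^+ 3 by rewrite PE mulrC ler_wpM2r ?(ltW t30) // -/e; clear - e2; lra.
have p01 : 0 < p < 1 by rewrite p0 /=; clear - p2 t31 t1; lra.
have b0 : 0 <= bpmf p n k by apply: bpmf_ge0; case/andP: p01 => h1 h2; rewrite !ltW.
have h1 : ((k.+1%:R : R) / k%:R) ^+ 2 <= expR (2 * (t ^+ 3 / x)).
  have -> : k.+1%:R / k%:R = 1 + t ^+ 3 / x.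
    by rewrite /x -natr1; field; rewrite !lt0r_neq0.
  rewrite -[2 * _]/(2%:R * _) expRM_natl lerXn2r ?nnegrE ?expR_ge0 ?expR_ge1Dx //.
  by rewrite addr_ge0 // divr_ge0 // ltW.
have qkE : (1 - p) ^+ k = expR (- y) by rewrite qE -expRM_natl mulrN yE.
have u0 : 0 < 1 - expR (- y) by rewrite subr_gt0 expR_lt1 oppr_lt0.
have h2 : (n%:R - k%:R) / k%:R * (1 - expR (- y)) <=
    expR (e - x - x ^+ 2 / 2 - y / 2 + y ^+ 2 / 16).
  have hD := one_sub_expRN_le (ltW y0).
  have hx := one_sub_le_expR (ltW x0).
  have he := expR_ge1Dx e.
  have -> : e - x - x ^+ 2 / 2 - y / 2 + y ^+ 2 / 16 =
    e + (- x - x ^+ 2 / 2) + (- (y / 2) + y ^+ 2 / 16) by ring.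
  rewrite [expR (_ + (- (y / 2) + _))]expRD [expR (e + _)]expRD.
  have E : (n%:R - k%:R) / k%:R * y = (1 + e) * (1 - x).
    rewrite -nPE -yE nE /x; field; rewrite !lt0r_neq0 //.
  have F0 : 0 <= (n%:R - k%:R) / k%:R :> R.
    by rewrite divr_ge0 ?ler0n // subr_ge0 ler_nat ltnW.
  have hF := ler_wpM2l F0 hD; rewrite mulrA in hF; apply: (le_trans hF).
  rewrite E ler_wpM2r ?expR_ge0 //; apply: ler_pM => //; clear - e1 x1; lra.
have h3 : k%:R * p * expR (- y) / (1 - expR (- y)) <= 1 - y / 2 + y ^+ 2 / 12.
  rewrite ler_pdivrMr //; apply: (@le_trans _ _ (y * expR (- y))).
    by rewrite ler_wpM2r ?expR_ge0 // -yE ler_wpM2l // ltW.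
  have := ler_wpM2r (expR_ge0 (- y)) (expR_sub1_le (ltW y0)).
  move/le_trans; apply; rewrite mulrAC mulrBl -expRD subrr expR0 mul1r mulrC //.
have hk : k%:R ^+ 2 * ((k.+1%:R / k%:R) ^+ 2) = k.+1%:R ^+ 2 :> R.
  by rewrite -exprMn mulrC divfK // lt0r_neq0.
have h4 := bpmf_succ_le k0 kn p01 qE; rewrite qkE in h4.
have h5 : (n%:R - k%:R) / k%:R * (1 - expR (- y)) *
     expR (k%:R * p * expR (- y) / (1 - expR (- y))) * expR (- (n%:R - 2 * k%:R - 1) * P) <=
    expR (e - x - x ^+ 2 / 2 - y / 2 + y ^+ 2 / 16 + (1 - y / 2 + y ^+ 2 / 12) +
      (- (1 + e) + 2 * y + P)).
  have -> : - (n%:R - 2 * k%:R - 1) * P = - (1 + e) + 2 * y + P by rewrite -nPE -yE; ring.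
  rewrite [leRHS]expRD ler_wpM2r ?expR_ge0 // [leRHS]expRD; apply: ler_pM; rewrite ?expR_ge0 //.
    by rewrite mulr_ge0 ?(ltW u0) // divr_ge0 ?ler0n // subr_ge0 ler_nat ltnW.
  by rewrite ler_expR.
(* Linear terms cancel up to [y - x = x e], and [x e] is at most x^2/3 up to smaller terms because
   |l| <= a/3 and a t <= x. The coefficient of x^2 is about 1/3 - 1/2 + 1/16 + 1/12 = -1/48, leaving
   room for 1/100 after the errors. *)
have h6 : expR (2 * (t ^+ 3 / x)) * expR (e - x - x ^+ 2 / 2 - y / 2 + y ^+ 2 / 16 +
    (1 - y / 2 + y ^+ 2 / 12) + (- (1 + e) + 2 * y + P)) <= expR (- ((a * t) ^+ 2 / 100)).
  rewrite -expRD ler_expR.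
  have tx : t ^+ 3 / x <= x ^+ 2 / 1000.
    by rewrite ler_pdivrMr // mulrAC -exprSr.
  have at2 : (a * t) ^+ 2 <= x ^+ 2 by rewrite lerXn2r // nnegrE ltW.
  have xe : x * e <= x * (x / 3 + 4 * t ^+ 3) by rewrite ler_wpM2l // ltW.
  have xxe : x ^+ 2 * (1 + e) ^+ 2 <= x ^+ 2 * (103 / 100).
    rewrite ler_wpM2l ?(ltW x2) //; have : e ^+ 2 <= (1 / 100) ^+ 2.
      rewrite -[e ^+ 2]ger0_norm ?sqr_ge0 // normrX lerXn2r ?nnegrE // ler_norml e1 //.
    by move=> ee; clear - e2 ee; lra.
  have t34 : t ^+ 3 <= x ^+ 2 / 100 / 100.
    have : t * (x ^+ 2 / 100) <= 1 / 100 * (x ^+ 2 / 100) by rewrite ler_wpM2r // divr_ge0 // ltW.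
    by move=> h; clear - t32 h; lra.
  move: (t ^+ 3 / x) tx => r tx.
  have -> : y ^+ 2 = x ^+ 2 * (1 + e) ^+ 2 by rewrite /y exprMn.
  have -> : y = x + x * e by rewrite /y; ring.
  move: at2 xe xxe t34 Pu x4 x2 tx; clear; move: ((a * t) ^+ 2) (x ^+ 2 * (1 + e) ^+ 2) (x * e) (t ^+ 3).
  move=> A B C D; lra.
have h7 := le_trans h4 (ler_wpM2l b0 h5).
have b1 : 0 <= bpmf p n k.+1 by apply: bpmf_ge0; case/andP: p01 => i1 i2; rewrite !ltW.
have h8 := ler_pM (sqr_ge0 _) b1 h1 h7.
have h9 := ler_wpM2l b0 h6.
have k2 : 0 <= k%:R ^+ 2 :> R by exact: sqr_ge0.
rewrite -hk -mulrA [leRHS]mulrCA; apply: ler_wpM2l => //.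
rewrite [leRHS]mulrC; apply: le_trans h9; rewrite [leRHS]mulrCA; exact: h8.
Qed.

End Ratio.

(** * The rate function and the upper tail *)

Section Tails.
Variable R : realType.
Implicit Types t a l p x y z : R.

Definition rate l x : R := x ^+ 3 / 8 - l * x ^+ 2 / 2 + l ^+ 2 * x / 2.

Lemma rateE l x : rate l x = x / 2 * (x / 2 - l) ^+ 2.
Proof. by rewrite /rate; field. Qed.

Lemma rate_ge0 l x : 0 <= x -> 0 <= rate l x.
Proof. by move=> x0; rewrite rateE mulr_ge0 ?sqr_ge0 ?divr_ge0. Qed.

Lemma le_rate l a x : 0 < a -> `|l| <= a / 3 -> a <= x -> rate l a <= rate l x.
Proof.
move=> a0; rewrite ler_norml => /andP[l1 l2] ax; rewrite !rateE.
apply: ler_pM; rewrite ?sqr_ge0 ?divr_ge0 ?(ltW a0) //; first by lra.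
by rewrite lerXn2r ?nnegrE //; lra.
Qed.

(** The derivative of the rate near [a] is of order a^2, so a window of width a^(-2) costs only a
    constant factor. *)
Lemma rate_add_le l a d : 10 <= a -> `|l| <= a / 3 -> 0 <= d -> d * a ^+ 2 <= 1 ->
  rate l (a + d) <= rate l a + 2.
Proof.
move=> a10; rewrite ler_norml => /andP[l1 l2] d0 da; rewrite !rateE.
pose b := a / 2 - l; have b0 : 0 <= b by rewrite /b; lra.
have ba : b <= a by rewrite /b; lra.
have -> : (a + d) / 2 - l = b + d / 2 by rewrite /b; ring.
rewrite -/b.
have a2 : 100 <= a ^+ 2 by rewrite expr2; have := ler_pM _ _ a10 a10; lra.
have d1 : d <= 1.
  have : d * 100 <= d * a ^+ 2 by rewrite ler_wpM2l.
  lra.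
have e1 : d * b ^+ 2 <= 1.
  by apply: le_trans da; rewrite ler_wpM2l // lerXn2r // nnegrE; lra.
have e2 : d * (a * b) <= 1.
  by apply: le_trans da; rewrite ler_wpM2l // expr2 ler_wpM2l //; lra.
have e3 : d * d * a <= 1 / 10.
  have : d * (d * a ^+ 2) <= 1 * 1 by apply: ler_pM => //; rewrite mulr_ge0 ?sqr_ge0.
  have : 10 * (d * d * a) <= a * (d * d * a) by rewrite ler_wpM2r // !mulr_ge0 //; lra.
  lra.
have e4 : d * d * b <= 1 / 10.
  by apply: le_trans e3; rewrite ler_wpM2l // mulr_ge0.
have e5 : d * d * d <= 1.
  by rewrite -[leRHS]mulr1 ler_pM ?mulr_ge0 // -[leRHS]mulr1 ler_pM.
lra.
Qed.

Lemma component_pmf_bpmf p n j : 0 < p < 1 ->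
  component_pmf p n j = bpmf p n j.+1 * rho p j.+1 j.
Proof.
move=> /andP[p0 p1].
have u0 : 1 - (1 - p) ^+ j.+1 != 0 by rewrite lt0r_neq0 // one_sub_qX_gt0.
rewrite /component_pmf /bpmf /rho succnK.
have -> : (n - j.+1 = n.-1 - j)%N by rewrite subnS predn_sub.
have uj : (1 - (1 - p) ^+ j.+1) ^+ j != 0 by rewrite expf_neq0.
move: ((1 - (1 - p) ^+ j.+1) ^+ j) uj (reach _ _ _) => u uj r.
by field.
Qed.

Lemma component_pmf_ge0 p n j : 0 < p < 1 -> 0 <= component_pmf p n j.
Proof.
move=> p01; rewrite component_pmf_bpmf //; case/andP: p01 => p0 p1.
by rewrite mulr_ge0 ?rho_ge0 // bpmf_ge0 // !ltW.
Qed.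

(** Once p k exceeds 1/8, the right-hand side is above 67/64 and [rho <= 1] is enough. *)
Lemma rho_le k p : 0 < p < 1 -> (0 < k)%N -> 1 <= p ^+ 2 * k%:R ^+ 3 ->
  rho p k k.-1 <= 67 * (p * k%:R) ^+ 2.
Proof.
move=> /andP[p0 p1] k0 pk; have [small|big] := lerP (p * k%:R) (1 / 8).
  exact: rho_upper.
case: k k0 pk big => // m _ pk big.
apply: (@le_trans _ _ 1).
  apply: (le_trans (rho_le_linear p0 p1 (leqnSn m))); rewrite gerBl.
  rewrite mulr_ge0 ?ler0n // divr_ge0 ?(ltW (one_sub_qX_gt0 p0 p1 _)) //.
  by rewrite mulr_ge0 ?exprn_ge0 ?subr_ge0 // ltW.
have : (1 / 8) ^+ 2 <= (p * m.+1%:R) ^+ 2 by rewrite lerXn2r ?nnegrE //; lra.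
lra.
Qed.

(* The parameters in units of [t] = n^(-1/3): the component size k is measured by
   [k%:R * t ^+ 2], and p = 1/n + l n^(-4/3). *)
Definition regime n t a l p := [/\ [/\ 0 < t, n%:R * t ^+ 3 = 1 & 10 <= a],
   a ^+ 10 * t <= 1, `|l| <= a / 3 & p = t ^+ 3 * (1 + l * t)].

Definition first_large a t k0 := a < k0%:R * t ^+ 2 <= a + t ^+ 2.

Lemma regime_p n t a l p : regime n t a l p -> 0 < p < 1.
Proof.
move=> [[t0 nt a10] at1 la pE].
have [_ z1 tz] := small_param a10 t0 at1.
have [_ ph p2 _] := regime_bounds t0 a10 at1 la pE.
have t30 : 0 < t ^+ 3 by rewrite exprn_gt0.
have t31 : t ^+ 3 <= t.
  by rewrite exprS ler_piMr ?(ltW t0) // exprn_ile1 ?(ltW t0) //; lra.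
by apply/andP; split; lra.
Qed.

Lemma one_sub_expRN_half (v : R) : 0 <= v <= 1 -> v / 2 <= 1 - expR (- v).
Proof.
move=> /andP[v0 v1]; have [_ _ h] := expRN_taylor v0.
have : v ^+ 2 <= v by rewrite expr2 ler_piMr.
lra.
Qed.

(** The factor (p k0)^2 from [rho], of order (a t)^2, cancels the length (a t)^(-2) of the geometric
    sum. The two factors 4 are the squares of the 2 in [p <= 2 t^3] and in [k0 <= 2 a / t^2]. *)
Lemma tail_upper n t a l p k0 : regime n t a l p -> first_large a t k0 ->
  \sum_(j < n) (k0 <= j.+1)%:R * component_pmf p n j <=
  67 * 4 * 4 * 200 * expR 11 * (t / Num.sqrt a * expR (- rate l a)).
Proof.
move=> reg /andP[ak kat]; have p01 := regime_p reg.
move: reg => [[t0 nt a10] at1 la pE].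
have [_ z1 tz] := small_param a10 t0 at1.
have [_ ph p2 _] := regime_bounds t0 a10 at1 la pE.
have a0 : 0 < a by lra.
have z0 : 0 < a * t by rewrite mulr_gt0.
have t20 : 0 < t ^+ 2 by rewrite exprn_gt0.
have t30 : 0 < t ^+ 3 by rewrite exprn_gt0.
have t21 : t ^+ 2 <= a.
  apply: (@le_trans _ _ 1); last by lra.
  by rewrite exprn_ile1 ?(ltW t0) //; lra.
have kR : 0 < k0%:R :> R by rewrite -(pmulr_lgt0 _ t20); apply: lt_trans ak.
have k00 : (0 < k0)%N by rewrite -(ltr0n R).
have /andP[p0 p1] := p01.
pose g k : R := k%:R ^+ 2 * bpmf p n k.
have b0 k : 0 <= bpmf p n k by apply: bpmf_ge0; rewrite !ltW.
have g0 k : 0 <= g k by rewrite mulr_ge0 ?sqr_ge0.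
have ak' k : (k0 <= k)%N -> a <= k%:R * t ^+ 2.
  move=> kk; apply: (le_trans (ltW ak)); rewrite ler_wpM2r ?(ltW t20) //.
  by rewrite ler_nat.
pose v := (a * t) ^+ 2 / 100.
have v0 : 0 < v by rewrite divr_gt0 ?exprn_gt0.
have v1 : v <= 1.
  have : (a * t) ^+ 2 <= 1 by rewrite exprn_ile1 ?(ltW z0) //; lra.
  rewrite /v; lra.
have r01 : 0 <= expR (- v) < 1 by rewrite expR_ge0 expR_lt1 oppr_lt0.
have ratio k : (k0 <= k)%N -> (k < n)%N -> g k.+1 <= expR (- v) * g k.
  by move=> kk kn; apply: bpmf_ratio; eauto.
have step1 : \sum_(j < n) (k0 <= j.+1)%:R * component_pmf p n j <=
    67 * p ^+ 2 * \sum_(j < n) (k0 <= j.+1)%:R * g j.+1.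
  rewrite mulr_sumr; apply: ler_sum => j _.
  case: leqP => kj; rewrite ?mul0r ?mulr0 // !mul1r component_pmf_bpmf //.
  have -> : 67 * p ^+ 2 * g j.+1 = bpmf p n j.+1 * (67 * (p * j.+1%:R) ^+ 2).
    by rewrite /g exprMn; ring.
  rewrite ler_wpM2l //; apply: rho_le => //.
  have : (t ^+ 3 / 2) ^+ 2 * j.+1%:R ^+ 3 <= p ^+ 2 * j.+1%:R ^+ 3.
    by rewrite ler_wpM2r ?exprn_ge0 // lerXn2r ?nnegrE ?divr_ge0 // ltW.
  apply: le_trans; have -> : (t ^+ 3 / 2) ^+ 2 * j.+1%:R ^+ 3 = (j.+1%:R * t ^+ 2) ^+ 3 / 4 :> R.
    by rewrite !exprMn; field.
  have := le_trans a10 (ak' _ kj); move: (_ * t ^+ 2) => u u10.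
  have : 10 ^+ 3 <= u ^+ 3; last by lra.
  by rewrite lerXn2r ?nnegrE ?(le_trans _ u10) // ler0n.
apply: (le_trans step1).
have step2 := geometric_tail k00 r01 g0 ratio.
have step3 : g k0 / (1 - expR (- v)) <= g k0 * (200 / (a * t) ^+ 2).
  rewrite ler_wpM2l // -[200 / _]invrK lef_pV2 ?posrE ?subr_gt0 ?expR_lt1 ?oppr_lt0 //.
    apply: le_trans (one_sub_expRN_half _); last by rewrite ltW.
    by rewrite invf_div /v; lra.
  by rewrite invr_gt0; apply: divr_gt0; rewrite ?exprn_gt0 ?ltr0n.
have pp : 67 * p ^+ 2 <= 67 * (2 * t ^+ 3) ^+ 2.
  have q0 : 0 <= 2 * t ^+ 3 by lra.
  by rewrite ler_wpM2l // lerXn2r // nnegrE ltW.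
have s0 : 0 <= \sum_(j < n) (k0 <= j.+1)%:R * g j.+1.
  by apply: sumr_ge0 => j _; rewrite mulr_ge0.
have p67 : 0 <= 67 * p ^+ 2 by rewrite mulr_ge0 ?sqr_ge0.
apply: (le_trans (ler_pM p67 s0 pp (le_trans step2 step3))).
set x := k0%:R * t ^+ 2 in ak kat.
have k3a : k0%:R * t ^+ 2 <= 3 * a by rewrite -/x; clear - kat t21 a0; lra.
have /andP[_ near] := bpmf_near t0 nt a10 at1 la pE k00 k3a.
rewrite -/x -/(rate l x) in near.
have ra : rate l a <= rate l x by apply: le_rate => //; exact: ltW.
have sa0 : 0 < Num.sqrt a by rewrite sqrtr_gt0.
have sk : Num.sqrt a / t <= Num.sqrt k0%:R.
  have -> : Num.sqrt a / t = Num.sqrt (a / t ^+ 2).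
    by rewrite sqrtrM ?(ltW a0) // sqrtrV ?(ltW t20) // sqrtr_sqr gtr0_norm.
  by rewrite ler_wsqrtr // ler_pdivrMr // ltW.
have bk : bpmf p n k0 <= t / Num.sqrt a * (expR 11 * expR (- rate l a)).
  have sat : 0 < Num.sqrt a / t by rewrite divr_gt0.
  rewrite -(ler_pM2l sat).
  have -> : Num.sqrt a / t * (t / Num.sqrt a * (expR 11 * expR (- rate l a))) =
     expR 11 * expR (- rate l a) by field; rewrite !lt0r_neq0.
  apply: (@le_trans _ _ (Num.sqrt k0%:R * bpmf p n k0)); first by rewrite ler_wpM2r.
  by apply: (le_trans near); rewrite -expRD ler_expR; clear - ra; lra.
have k2 : k0%:R ^+ 2 <= 4 * (a / t ^+ 2) ^+ 2.
  have -> : 4 * (a / t ^+ 2) ^+ 2 = (2 * a / t ^+ 2) ^+ 2 by rewrite !exprMn; ring.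
  have k2a : k0%:R <= 2 * a / t ^+ 2 by rewrite ler_pdivlMr // -/x; clear - kat t21; lra.
  by rewrite lerXn2r // nnegrE ?(le_trans _ k2a) // ltW.
have gk : g k0 <= 4 * (a / t ^+ 2) ^+ 2 * (t / Num.sqrt a * (expR 11 * expR (- rate l a))).
  by apply: ler_pM => //; exact: sqr_ge0.
have c0 : 0 <= 67 * (2 * t ^+ 3) ^+ 2 * (200 / (a * t) ^+ 2).
  by apply: mulr_ge0; [apply: mulr_ge0|apply: divr_ge0]; rewrite ?sqr_ge0 ?ler0n.
have := ler_wpM2l c0 gk.
set U := _ * _ => hU; rewrite (_ : 67 * (2 * t ^+ 3) ^+ 2 * (g k0 * (200 / (a * t) ^+ 2)) = U); last first.
  by rewrite /U; ring.
apply: (le_trans hU); rewrite le_eqVlt; apply/orP; left; apply/eqP.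
move: (Num.sqrt a) sa0 (expR _) (expR _) => s s0' E1 E2.
by field; rewrite !lt0r_neq0.
Qed.

End Tails.

(** * Lower bounds from a block of sizes *)

Section LowerBound.
Variable R : realType.
Implicit Types t a l p x y z : R.

Lemma component_pmf_ge n t a l p j : regime n t a l p -> a <= j.+1%:R * t ^+ 2 ->
  (j.+1%:R * t ^+ 2 - a) * a ^+ 2 <= 1 ->
  t / (2 * Num.sqrt a) * expR (- (rate l a + 13)) * ((a * t) ^+ 2 / 4 / (3 * 32 * 32))
    <= component_pmf p n j.
Proof.
move=> reg; have p01 := regime_p reg; have /andP[p0 p1] := p01.
move: reg => [[t0 nt a10] at1 la pE].
have [_ z1 tz] := small_param a10 t0 at1.
have [_ ph p2 _] := regime_bounds t0 a10 at1 la pE.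
set k := j.+1; set x := k%:R * t ^+ 2 => ax xd.
have a0 : 0 < a by lra.
have z0 : 0 < a * t by rewrite mulr_gt0.
have t20 : 0 < t ^+ 2 by rewrite exprn_gt0.
have t30 : 0 < t ^+ 3 by rewrite exprn_gt0.
have d0 : 0 <= x - a by rewrite subr_ge0.
have d1 : x - a <= 1.
  apply: le_trans xd; rewrite ler_peMr // exprn_ege1 //; lra.
have x3a : x <= 3 * a by lra.
have kR : 0 < k%:R :> R by rewrite ltr0n.
have k2 : (2 <= k)%N.
  rewrite -(ler_nat R); have : 2 * t ^+ 2 <= k%:R * t ^+ 2; last by rewrite ler_pM2r.
  apply: le_trans ax; have : t ^+ 2 <= 1 by rewrite exprn_ile1 ?(ltW t0) //; lra.
  lra.
have kE : k%:R = x / t ^+ 2 by rewrite /x mulfK // lt0r_neq0.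
have pk1 : p * k%:R <= 1.
  apply: (@le_trans _ _ (2 * t ^+ 3 * k%:R)); first by rewrite ler_wpM2r // ltW.
  have -> : 2 * t ^+ 3 * k%:R = 2 * (x * t) by rewrite /x; ring.
  have : x * t <= 3 * a * t by rewrite ler_wpM2r // ltW.
  lra.
have pk : a * t / 2 <= p * k%:R.
  apply: (@le_trans _ _ (t ^+ 3 / 2 * k%:R)); last by rewrite ler_wpM2r // ltW.
  have -> : t ^+ 3 / 2 * k%:R = x * t / 2 by rewrite /x; ring.
  by rewrite ler_wpM2r // ler_wpM2r // ltW.
have h1 : (a * t) ^+ 2 / 4 / (3 * 32 * 32) <= rho p k k.-1.
  apply: le_trans (rho_lower p0 p1 k2 pk1); rewrite ler_wpM2r ?invr_ge0 ?ler0n //.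
  have -> : (a * t) ^+ 2 / 4 = (a * t / 2) ^+ 2 by field.
  by rewrite lerXn2r ?nnegrE ?(le_trans _ pk) // divr_ge0 // ltW.
have /andP[near _] := bpmf_near t0 nt a10 at1 la pE (isT : 0 < k)%N x3a.
rewrite -/x -/(rate l x) in near.
have rx : rate l x <= rate l a + 2.
  have -> : x = a + (x - a) by ring.
  exact: rate_add_le.
have sa0 : 0 < Num.sqrt a by rewrite sqrtr_gt0.
have sk : Num.sqrt k%:R <= 2 * Num.sqrt a / t.
  have -> : 2 * Num.sqrt a / t = Num.sqrt (2 ^+ 2 * (a / t ^+ 2)).
    by rewrite sqrtrM ?sqr_ge0 // sqrtr_sqr ger0_norm // sqrtrM ?(ltW a0) // sqrtrV ?(ltW t20) // sqrtr_sqr gtr0_norm // mulrA.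
  rewrite ler_wsqrtr // kE mulrA ler_wpM2r ?invr_ge0 ?(ltW t20) //; lra.
have b0 : 0 <= bpmf p n k by apply: bpmf_ge0; rewrite !ltW.
have h2 : t / (2 * Num.sqrt a) * expR (- (rate l a + 13)) <= bpmf p n k.
  have sat : 0 < 2 * Num.sqrt a / t by rewrite divr_gt0 // mulr_gt0.
  rewrite -(ler_pM2l sat).
  have -> : 2 * Num.sqrt a / t * (t / (2 * Num.sqrt a) * expR (- (rate l a + 13))) =
     expR (- (rate l a + 13)) by field; rewrite !lt0r_neq0.
  apply: (@le_trans _ _ (Num.sqrt k%:R * bpmf p n k)); last by rewrite ler_wpM2r.
  by apply: le_trans near; rewrite ler_expR; lra.
rewrite component_pmf_bpmf // -/k; apply: ler_pM => //.
  by apply: mulr_ge0; [apply: divr_ge0|exact: expR_ge0]; rewrite ?mulr_ge0 ?ltW.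
by rewrite !divr_ge0 ?sqr_ge0 ?ler0n.
Qed.

(** The block has the integer part of (a t)^(-2) sizes, hence width at most a^(-2) on the scale x,
    where the rate varies by at most 2. The weight [psi] lets the same block serve the vertex
    probability, with [om] = 1, and the mean number of components, with [om] a lower bound for 1/k.
    The 16 is 2 for the integer part, 2 for the square root and 4 for (p k)^2. *)
Lemma block_lower n t a l p k0 (psi : nat -> R) om : regime n t a l p -> first_large a t k0 ->
  0 <= om -> (forall k, 0 <= psi k) ->
  (forall k, (k0 <= k)%N -> k%:R * t ^+ 2 <= 2 * a -> om <= psi k) ->
  expR (- 13) / (16 * (3 * 32 * 32)) * (t / Num.sqrt a * expR (- rate l a)) * om <=
  \sum_(j < n) component_pmf p n j * psi j.+1.
Proof.
move=> reg /andP[ak kat] om0 psi0 psiom; have p01 := regime_p reg.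
have [[t0 nt a10] at1 la pE] := reg.
have [_ z1 tz] := small_param a10 t0 at1.
have a0 : 0 < a by lra.
have z0 : 0 < a * t by rewrite mulr_gt0.
have t20 : 0 < t ^+ 2 by rewrite exprn_gt0.
have t30 : 0 < t ^+ 3 by rewrite exprn_gt0.
have k00 : (0 < k0)%N.
  by rewrite -(ltr0n R) -(pmulr_lgt0 _ t20); apply: lt_trans ak.
have z20 : 0 < (a * t) ^+ 2 by rewrite exprn_gt0.
have z2 : (a * t) ^+ 2 <= 1 / 2.
  have : (a * t) ^+ 2 <= a * t by rewrite expr2 ler_piMr ?(ltW z0) //; lra.
  lra.
have iz0 : 0 <= ((a * t) ^+ 2)^-1 by rewrite invr_ge0 ltW.
have /andP[M1 M2] := truncn_itv iz0; set M := Num.truncn _ in M1 M2.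
have M3 : ((a * t) ^+ 2)^-1 / 2 <= M%:R.
  have : 2 <= ((a * t) ^+ 2)^-1 by rewrite -[2]invrK lef_pV2 ?posrE ?invr_gt0 //; lra.
  move: M2; rewrite -natr1; lra.
have Mt : M%:R * t ^+ 2 * a ^+ 2 <= 1.
  have := ler_wpM2r (ltW z20) M1; rewrite mulVf ?lt0r_neq0 // exprMn; lra.
have blk j : (k0.-1 <= j)%N -> (j < k0.-1 + M)%N ->
    a <= j.+1%:R * t ^+ 2 /\ (j.+1%:R * t ^+ 2 - a) * a ^+ 2 <= 1.
  move=> kj jM; split.
    apply: (le_trans (ltW ak)); rewrite ler_wpM2r ?(ltW t20) // ler_nat.
    by rewrite -(prednK k00).
  apply: le_trans Mt; rewrite ler_wpM2r ?sqr_ge0 //.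
  have : j.+1%:R + 1 <= k0%:R + M%:R :> R.
    by rewrite natr1 -natrD ler_nat -(prednK k00) addSn ltnS.
  move/(ler_wpM2r (ltW t20)); lra.
have blk2 j : (k0.-1 <= j)%N -> (j < k0.-1 + M)%N -> j.+1%:R * t ^+ 2 <= 2 * a.
  move=> kj jM; have [h1 h2] := blk j kj jM.
  have : j.+1%:R * t ^+ 2 - a <= 1; last by lra.
  by apply: le_trans h2; rewrite ler_peMr ?subr_ge0 // exprn_ege1 //; lra.
have Mn : (k0.-1 + M <= n)%N.
  case: (posnP M) => [M0|Mpos].
    have : (0 : R) < M%:R by apply: lt_le_trans M3; rewrite divr_gt0 ?invr_gt0.
    by rewrite M0 ltxx.
  have lt : (k0.-1 + M.-1 < k0.-1 + M)%N by rewrite ltn_add2l prednK.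
  have := blk2 _ (leq_addr _ _) lt; rewrite -addnS prednK // => h.
  rewrite -(ler_nat R) -(ler_pM2r t30) nt exprSr mulrA.
  apply: (@le_trans _ _ (2 * a * t)); first by rewrite ler_wpM2r // ltW.
  by rewrite -mulrA; lra.
set beta := t / (2 * Num.sqrt a) * expR (- (rate l a + 13)) * ((a * t) ^+ 2 / 4 / (3 * 32 * 32)).
have pmf0 j : 0 <= component_pmf p n j by exact: component_pmf_ge0.
have T0 j : 0 <= component_pmf p n j * psi j.+1 by rewrite mulr_ge0.
have sa0 : 0 < Num.sqrt a by rewrite sqrtr_gt0.
have beta0 : 0 <= beta.
  rewrite /beta; apply: mulr_ge0; last by rewrite !divr_ge0 ?sqr_ge0 ?ler0n.
  by apply: mulr_ge0; [apply: divr_ge0|exact: expR_ge0]; rewrite ?mulr_ge0 ?ltW.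
apply: (@le_trans _ _ (M%:R * (beta * om))).
  have bo : 0 <= beta * om by rewrite mulr_ge0.
  apply: le_trans (ler_wpM2r bo M3); rewrite le_eqVlt; apply/orP; left; apply/eqP.
  rewrite /beta [- (rate l a + 13)]opprD [expR (- rate l a - 13)]expRD.
  move: (Num.sqrt a) sa0 (expR (- rate l a)) (expR (- 13)) => s s0 E1 E2.
  by field; rewrite !lt0r_neq0.
rewrite -(big_mkord xpredT (fun j => component_pmf p n j * psi j.+1)).
rewrite (big_cat_nat (n := k0.-1)) //=; last by rewrite (leq_trans _ Mn) // leq_addr.
rewrite [X in _ + X](big_cat_nat (n := (k0.-1 + M)%N)) ?leq_addr //=.
rewrite addrCA -[leLHS]addr0; apply: lerD; last by rewrite addr_ge0 ?sumr_ge0.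
have -> : M%:R * (beta * om) = \sum_(k0.-1 <= j < k0.-1 + M) (beta * om).
  by rewrite sumr_const_nat addKn mulr_natl.
apply: ler_sum_nat => j /andP[kj jM]; have [h1 h2] := blk j kj jM.
apply: ler_pM => //; first exact: component_pmf_ge.
apply: psiom; last exact: blk2.
by rewrite -(prednK k00).
Qed.

End LowerBound.

(** * Effect of removing a large component *)

Section Pairs.
Variable R : realType.
Implicit Types t a l p x y z : R.

(** The quotient of the binomials is a product of factors 1 - k/(n - i). Second-order terms are kept
    because the first-order ones are cancelled in [component_pmf_remove]. *)
Lemma bin_sub_le n k m : (m + k < n)%N ->
  'C((n - k).-1, m)%:R <= 'C(n.-1, m)%:R *
    expR (- (k%:R / n%:R * (m%:R + m%:R * (m%:R + 1) / (2 * n%:R) + m%:R * (k%:R / n%:R) / 2))) :> R.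
Proof.
elim: m => [|m IH] mkn; first by rewrite !bin0 !(mul0r, add0r, mulr0) oppr0 expR0 mulr1.
have n0 : 0 < n%:R :> R by rewrite ltr0n (leq_trans _ mkn).
have kn : (k <= n)%N by rewrite ltnW // (leq_trans _ mkn) // ltnS leq_addl.
have m1n : (m.+1 < n)%N by rewrite (leq_trans _ mkn) // ltnS leq_addr.
have binE N : 'C(N, m.+1)%:R = (N - m)%:R / m.+1%:R * 'C(N, m)%:R :> R.
  have := congr1 (fun i : nat => i%:R : R) (mul_bin_left N m); rewrite /= !natrM => E.
  by rewrite mulrAC -E [m.+1%:R * _]mulrC mulfK // pnatr_eq0.
have sub1 j : (j - m.+1)%:R = (j.-1 - m)%:R :> R by rewrite subnS predn_sub.
have IH' := IH (ltn_trans (ltnSn _) mkn).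
rewrite !binE -!sub1 !natrB //; last by rewrite leq_subRL // addnC ltnW.
set c := k%:R / n%:R in IH' *; set u := m.+1%:R.
have c0 : 0 <= c by rewrite divr_ge0 ?ler0n.
have u0 : 0 < u by rewrite ltr0n.
have nu : 0 < n%:R - u by rewrite subr_gt0 ltr_nat.
pose y := c * (1 + u / n%:R).
have cy : c <= y by rewrite /y ler_peMr // lerDl divr_ge0 ?ltW.
have y0 : 0 <= y by exact: le_trans cy.
have step : n%:R - k%:R - u <= (n%:R - u) * expR (- (c + c * (u / n%:R) + c ^+ 2 / 2)).
  apply: (@le_trans _ _ ((n%:R - u) * expR (- y - y ^+ 2 / 2))); last first.
    rewrite ler_wpM2l ?(ltW nu) // ler_expR.
    have : c ^+ 2 <= y ^+ 2 by rewrite lerXn2r ?nnegrE.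
    have yE : y = c + c * (u / n%:R) by rewrite /y; ring.
    move: (y ^+ 2) (c ^+ 2) => Y C; rewrite yE; move: (c * _) => z; lra.
  apply: le_trans (ler_wpM2l (ltW nu) (one_sub_le_expR y0)).
  have -> : (n%:R - u) * (1 - y) = n%:R - k%:R - u + c * (u ^+ 2 / n%:R).
    by rewrite /y /c; field; rewrite lt0r_neq0.
  by rewrite lerDl mulr_ge0 // divr_ge0 ?sqr_ge0 // ltW.
have uE : u = m%:R + 1 by rewrite /u -natr1.
have -> : - (c * (u + u * (u + 1) / (2 * n%:R) + u * c / 2)) =
  - (c + c * (u / n%:R) + c ^+ 2 / 2) + - (c * (m%:R + m%:R * (m%:R + 1) / (2 * n%:R) + m%:R * c / 2)).
  by rewrite uE; field; rewrite lt0r_neq0.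
rewrite expRD; set E1 := expR _; set E2 := expR _.
have -> : (n%:R - u) / u * 'C(n.-1, m)%:R * (E1 * E2) =
   ((n%:R - u) * E1) / u * ('C(n.-1, m)%:R * E2) by ring.
have k0 : 0 <= n%:R - k%:R - u.
  by rewrite -addrA -opprD -natrD subr_ge0 ler_nat addnC ltnW.
apply: ler_pM => //; rewrite ?divr_ge0 ?ler0n //.
by rewrite ler_wpM2r // invr_ge0 ltW.
exact: ltnW.
Qed.

(** Removal shrinks the binomial but drops (j+1) k absent edges. The main terms cancel, leaving k/n
    <= 1 plus k/n times (j+1) e - j (d + k/n) / 2 with d = (j+1)/n. The latter is nonpositive: d and
    k/n are at least a t, while e is at most a t / 3 up to smaller terms. *)
Lemma component_pmf_remove n t a l p k j : regime n t a l p -> a <= k%:R * t ^+ 2 ->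
  a <= j.+1%:R * t ^+ 2 -> (j < n - k)%N ->
  component_pmf p (n - k) j <= expR 1 * component_pmf p n j.
Proof.
move=> reg ak aj jnk; have p01 := regime_p reg; have /andP[p0 p1] := p01.
move: reg => [[t0 nt a10] at1 la pE].
have [_ z1 tz] := small_param a10 t0 at1.
have [lt1 ph p2 [P [c [qE P1 PE /andP[c0 c4]]]]] := regime_bounds t0 a10 at1 la pE.
have a0 : 0 < a by lra.
have t20 : 0 < t ^+ 2 by rewrite exprn_gt0.
have t30 : 0 < t ^+ 3 by rewrite exprn_gt0.
have z0 : 0 < a * t by rewrite mulr_gt0.
have nE : n%:R = (t ^+ 3)^-1 by apply: (mulIf (lt0r_neq0 t30)); rewrite nt mulVf ?lt0r_neq0.
have jkn : (j + k < n)%N by rewrite addnC -ltn_subRL.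
have kn : (k <= n)%N by rewrite ltnW // (leq_trans _ jkn) // ltnS leq_addl.
pose e := l * t + c * t ^+ 3.
have e3 : e <= a * t / 3 + 4 * t ^+ 3.
  have /andP[_ h] : - (a * t / 3) <= l * t <= a * t / 3 by rewrite -ler_norml.
  have : c * t ^+ 3 <= 4 * t ^+ 3 by rewrite ler_wpM2r // ltW.
  rewrite /e; lra.
have t3z : 8 * t ^+ 3 <= a * t / 3.
  have : t ^+ 2 <= 1 / 10.
    have : t ^+ 2 <= t by rewrite expr2 ler_piMr ?(ltW t0) //; lra.
    lra.
  move/(ler_wpM2r (ltW t0)); rewrite -exprSr; lra.
have j1 : 1 <= j%:R :> R.
  have : 2 * t ^+ 2 <= j.+1%:R * t ^+ 2.
    apply: le_trans aj; have : t ^+ 2 <= 1 by rewrite exprn_ile1 ?(ltW t0) //; lra.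
    lra.
  rewrite ler_pM2r // -[j.+1%:R]natr1; lra.
rewrite /component_pmf.
have qX : (1 - p) ^+ (j.+1 * ((n - k).-1 - j)) = (1 - p) ^+ (j.+1 * (n.-1 - j)) * expR (j.+1%:R * k%:R * P).
  have -> : (j.+1 * (n.-1 - j) = j.+1 * ((n - k).-1 - j) + j.+1 * k)%N.
    have jk1 : (j + k <= n.-1)%N by rewrite -ltnS (ltn_predK jkn).
    by rewrite -mulnDr predn_sub subnAC subnK // leq_subRL // (leq_trans (leq_addr _ _) jk1).
  rewrite exprD -mulrA [(1 - p) ^+ (j.+1 * k)](_ : _ = expR (- (j.+1%:R * k%:R * P))).
    by rewrite -expRD addNr expR0 mulr1.
  by rewrite qE -expRM_natl natrM mulrN.
rewrite qX; set Q := (1 - p) ^+ _; set r := reach _ _ _.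
have r0 : 0 <= r by exact: reach_ge0.
have Q0 : 0 <= Q by rewrite exprn_ge0 // subr_ge0 ltW.
have hb := bin_sub_le jkn.
set X1 := 'C(_, _)%:R in hb *; set X2 := 'C(_, _)%:R in hb *; set S1 := expR _ in hb.
have -> : X1 * r * (Q * expR (j.+1%:R * k%:R * P)) = X1 * (r * Q * expR (j.+1%:R * k%:R * P)) by ring.
apply: (@le_trans _ _ (X2 * S1 * (r * Q * expR (j.+1%:R * k%:R * P)))).
  by rewrite ler_wpM2r // mulr_ge0 ?expR_ge0 // mulr_ge0.
have -> : X2 * S1 * (r * Q * expR (j.+1%:R * k%:R * P)) =
  S1 * expR (j.+1%:R * k%:R * P) * (X2 * r * Q) by ring.
apply: ler_wpM2r; first by rewrite !mulr_ge0 ?ler0n.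
rewrite /S1 -expRD ler_expR.
have PE' : P = (1 + e) / n%:R by rewrite nE invrK PE mulrC.
pose cc : R := k%:R / n%:R; pose d : R := j.+1%:R / n%:R.
have ccE : cc = k%:R * t ^+ 3 by rewrite /cc nE invrK.
have dE : d = j.+1%:R * t ^+ 3 by rewrite /d nE invrK.
have ca : a * t <= cc by rewrite ccE exprSr mulrA ler_wpM2r // ltW.
have da : a * t <= d by rewrite dE exprSr mulrA ler_wpM2r // ltW.
have cc1 : cc <= 1 by rewrite ler_pdivrMr ?mul1r ?ler_nat // nE invr_gt0.
have n0 : n%:R != 0 :> R by rewrite nE invr_eq0 lt0r_neq0.
have jE : j.+1%:R = j%:R + 1 :> R by rewrite natr1.
have -> : - (k%:R / n%:R * (j%:R + j%:R * (j%:R + 1) / (2 * n%:R) + j%:R * (k%:R / n%:R) / 2)) +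
    j.+1%:R * k%:R * P = cc + cc * ((j%:R + 1) * e - j%:R * ((d + cc) / 2)).
  by rewrite PE' /cc /d jE; field.
suff : cc * ((j%:R + 1) * e - j%:R * ((d + cc) / 2)) <= 0.
  by move=> h; clear - h cc1; lra.
have cc0 : 0 <= cc by apply: le_trans ca; exact: ltW.
rewrite mulr_ge0_le0 // subr_le0.
apply: (@le_trans _ _ (j%:R * (a * t))); last by rewrite ler_wpM2l ?ler0n //; clear - ca da; lra.
apply: (@le_trans _ _ ((j%:R + 1) * (a * t / 3 + 4 * t ^+ 3))).
  by rewrite ler_wpM2l //; clear - j1; lra.
apply: (@le_trans _ _ ((2 * j%:R) * (a * t / 2))); last by clear; lra.
by clear - j1 z0 t30 t3z; apply: ler_pM; lra.
Qed.

End Pairs.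

(** * Assembly of the two estimates *)

Section Assembly.
Variable R : realType.
Implicit Types t a l p x y z : R.

(* [expR (- 13)] combines the error 11 of [bpmf_near] and the loss 2 of [rate_add_le];
   [3 * 32 * 32] comes from [rho_lower]. *)
Definition c_low : R := expR (- 13) / (16 * (3 * 32 * 32)).
(* [67] comes from [rho_upper], [expR 11] from [bpmf_near], and [200] from summing a
   geometric series of ratio [expR (- (a * t) ^+ 2 / 100)]. *)
Definition c_up : R := 67 * 4 * 4 * 200 * expR 11.

Lemma c_low_gt0 : 0 < c_low.
Proof. by rewrite divr_gt0 ?expR_gt0 // !mulr_gt0. Qed.

Lemma c_up_gt0 : 0 < c_up.
Proof. by rewrite !mulr_gt0 ?expR_gt0. Qed.

Lemma c_low_le_up : c_low / 4 <= c_up.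
Proof.
apply: (@le_trans _ _ 1).
  have h1 : expR (- 13) <= 1 :> R by rewrite expR_le1 oppr_le0.
  have h2 : c_low <= 1.
    rewrite ler_pdivrMr ?mulr_gt0 // mul1r (le_trans h1) //.
    by rewrite !mulr_ege1 // ler1n.
  have := c_low_gt0; lra.
by rewrite !mulr_ege1 ?ler1n // -expR0 ler_expR.
Qed.

Lemma first_large_ex a t : 0 < a -> 0 < t -> exists k0,
  first_large a t k0 /\ forall k : nat, (a < k%:R * t ^+ 2) = (k0 <= k)%N.
Proof.
move=> a0 t0; have t20 : 0 < t ^+ 2 by rewrite exprn_gt0.
have at0 : 0 <= a / t ^+ 2 by rewrite divr_ge0 // ltW.
have ex : exists k : nat, a < k%:R * t ^+ 2.
  by exists (Num.Def.archi_bound (a / t ^+ 2)); rewrite -ltr_pdivrMr //; exact: archi_boundP.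
case: (ex_minnP ex) => k0 ak min; exists k0; split.
  rewrite /first_large ak /=; case: k0 ak min => [|k] ak min.
    by move: ak; rewrite mul0r ltNge (ltW a0).
  rewrite -[k.+1%:R]natr1 mulrDl mul1r lerD2r leNgt; apply/negP => /min.
  by rewrite ltnn.
move=> k; apply/idP/idP => [/min //|kk].
by apply: (lt_le_trans ak); rewrite ler_wpM2r ?(ltW t20) // ler_nat.
Qed.

Lemma large_component_bounds n t a l p (P : pred nat) : regime n t a l p ->
  10 + 2 * expR 1 * c_up <= a -> (forall k, P k = (a < k%:R * t ^+ 2)) ->
  (forall v : 'I_n, c_low * (t / Num.sqrt a * expR (- rate l a)) <=
      gnp_prob p (fun E => P #|component E v|) <=
      c_up * (t / Num.sqrt a * expR (- rate l a))) /\
  c_low / 4 * (expR (- rate l a) / (a * Num.sqrt a)) <=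
    gnp_prob p (fun E : {set {set 'I_n}} => P (max_component_size E)) <=
    c_up * (expR (- rate l a) / (a * Num.sqrt a)).
Proof.
move=> reg aA PE; have p01 := regime_p reg; have /andP[p0 p1] := p01.
have [[t0 nt a10] at1 la pE] := reg.
have a0 : 0 < a by lra.
have t20 : 0 < t ^+ 2 by rewrite exprn_gt0.
have t30 : 0 < t ^+ 3 by rewrite exprn_gt0.
have nE : n%:R = (t ^+ 3)^-1 by apply: (mulIf (lt0r_neq0 t30)); rewrite nt mulVf ?lt0r_neq0.
have nR : 0 < n%:R :> R by rewrite nE invr_gt0.
have n0 : (0 < n)%N by rewrite -(ltr0n R).
have [k0 [fl Pk]] := first_large_ex a0 t0.
have {}PE k : P k = (k0 <= k)%N by rewrite PE Pk.
have pmf0 m j : 0 <= component_pmf p m j by exact: component_pmf_ge0.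
have sa0 : 0 < Num.sqrt a by rewrite sqrtr_gt0.
have up := tail_upper reg fl; rewrite -/c_up in up.
set E := expR (- rate l a) in up *.
have E0 : 0 < E by exact: expR_gt0.
split.
  move=> v; rewrite prob_component; apply/andP; split.
    have om1 k : (k0 <= k)%N -> k%:R * t ^+ 2 <= 2 * a -> 1 <= (P k)%:R :> R.
      by move=> kk _; rewrite PE kk.
    have := @block_lower R n t a l p k0 (fun k => (P k)%:R) 1 reg fl ler01 (fun k => ler0n _ _) om1.
    by rewrite mulr1.
  apply: le_trans up; apply: ler_sum => j _; by rewrite PE mulrC.
pose phi k : R := (P k)%:R / k%:R.
have phi0 k : 0 <= phi k by rewrite divr_ge0 ?ler0n.
pose X : R := n%:R * \sum_(j < n) component_pmf p n j * phi j.+1.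
have Xlow : c_low / 2 * (E / (a * Num.sqrt a)) <= X.
  have om0 : 0 <= t ^+ 2 / (2 * a) by apply: divr_ge0; [exact: ltW | rewrite mulr_ge0 // ltW].
  have om1 k : (k0 <= k)%N -> k%:R * t ^+ 2 <= 2 * a -> t ^+ 2 / (2 * a) <= phi k.
    move=> kk ka; rewrite /phi PE kk; have kR : 0 < k%:R :> R.
      by rewrite -(pmulr_lgt0 _ t20); apply: lt_trans a0 _; rewrite Pk.
    rewrite ler_pdivrMr ?mulr_gt0 // mulrAC ler_pdivlMr // mul1r mulrC //.
  have := block_lower reg fl om0 phi0 om1; rewrite -/c_low -/E => h.
  have := ler_wpM2l (ltW nR) h; rewrite -/X; apply: le_trans.
  rewrite nE le_eqVlt; apply/orP; left; apply/eqP; field.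
  by rewrite !lt0r_neq0.
have Xup : X <= c_up * (E / (a * Num.sqrt a)).
  have : \sum_(j < n) component_pmf p n j * phi j.+1 <=
     t ^+ 2 / a * \sum_(j < n) (k0 <= j.+1)%:R * component_pmf p n j.
    rewrite mulr_sumr; apply: ler_sum => j _; rewrite /phi PE.
    case: leqP => kj; rewrite ?mul0r ?mulr0 // mul1r mul1r mulrC ler_wpM2r //.
    rewrite -[j.+1%:R^-1]div1r ler_pdivrMr ?ltr0n // mulrAC ler_pdivlMr // mul1r mulrC.
    have := Pk j.+1; rewrite kj => /ltW.
    by move=> h; exact: h.
  move=> h1; have := ler_wpM2l (ltW nR) h1; rewrite -/X => /le_trans; apply.
  have ta0 : 0 <= t ^+ 2 / a by rewrite divr_ge0 ?ltW.
  apply: (le_trans (ler_wpM2l (ltW nR) (ler_wpM2l ta0 up))).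
  rewrite nE le_eqVlt; apply/orP; left; apply/eqP; field.
  by rewrite !lt0r_neq0.
have sa1 : 1 <= Num.sqrt a by rewrite -sqrtr1 ler_wsqrtr //; lra.
(* The lower bound on [a] enters here: [a * X <= c_up], so a large [a] makes the mean small. *)
have X2 : expR 1 * X <= 1 / 2.
  have E1 : E <= 1 by rewrite /E expR_le1 oppr_le0 rate_ge0 // ltW.
  have aX : a * X <= c_up.
    have := ler_wpM2l (ltW a0) Xup => /le_trans; apply.
    have -> : a * (c_up * (E / (a * Num.sqrt a))) = c_up * (E / Num.sqrt a).
      by field; rewrite !lt0r_neq0.
    rewrite ler_piMr ?(ltW c_up_gt0) // ler_pdivrMr // mul1r.
    exact: le_trans sa1.
  have X0 : 0 <= X.
    by rewrite mulr_ge0 ?(ltW nR) // sumr_ge0 // => j _; rewrite mulr_ge0.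
  have : 2 * expR 1 * c_up * X <= c_up.
    by apply: le_trans aX; rewrite ler_wpM2r //; lra.
  rewrite mulrAC -[leRHS]mul1r ler_pM2r ?c_up_gt0 //; lra.
have p01' : 0 <= p <= 1 by rewrite !ltW.
have Pmono j k : (j <= k)%N -> P j -> P k by move=> jk; rewrite !PE => /leq_trans; apply.
have /andP[low upp] := prob_max_component p01' Pmono n0 (erefl X) erefl.
apply/andP; split; last exact: le_trans Xup.
apply: le_trans low.
set D := _ * \sum_(j < n) _.
(* Given one large component, the mean number of others is at most e times [X], by
   [component_pmf_remove] applied to each size. *)
have DX : D <= X * (1 / 2).
  rewrite /D /X -mulrA ler_wpM2l ?(ltW nR) // mulr_suml; apply: ler_sum => j _.
  rewrite -[leRHS]mulrA ler_wpM2l // /phi PE; case: leqP => kj; last by rewrite !mul0r.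
  rewrite ler_wpM2l ?divr_ge0 ?ler0n //; apply: le_trans X2.
  have aj : a <= j.+1%:R * t ^+ 2 by apply: ltW; rewrite Pk.
  rewrite /X mulrCA; apply: ler_pM; rewrite ?ler0n //.
  - by apply: sumr_ge0 => i _; rewrite mulr_ge0.
  - by rewrite ler_nat leq_subr.
  rewrite mulr_sumr -(big_mkord xpredT (fun i => component_pmf p (n - j.+1) i * phi i.+1)).
  rewrite -(big_mkord xpredT (fun i => expR 1 * (component_pmf p n i * phi i.+1))).
  rewrite [leRHS](big_cat_nat (n := (n - j.+1)%N)) ?leq_subr //= -[leLHS]addr0.
  apply: lerD; last first.
    apply: sumr_ge0 => i _; apply: mulr_ge0; first exact: expR_ge0.
    by apply: mulr_ge0; [exact: pmf0 | exact: phi0].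
  apply: ler_sum_nat => i /andP[_ ij]; rewrite [leRHS]mulrA /phi PE.
  case: leqP => ki; last by rewrite !mul0r !mulr0.
  rewrite ler_wpM2r ?divr_ge0 ?ler0n //.
  by apply: (component_pmf_remove reg aj _ ij); apply: ltW; rewrite Pk.
have -> : c_low / 4 * (E / (a * Num.sqrt a)) = c_low / 2 * (E / (a * Num.sqrt a)) * (1 / 2).
  by field; rewrite !lt0r_neq0.
lra.
Qed.

End Assembly.

Unset Implicit Arguments.
Set Strict Implicit.
Set Printing Implicit Defensive.

Local Open Scope classical_set_scope.

Theorem theorem1p1 (R : realType) :
  exists A0 c1 c2 : R,
    0 < A0 /\ 0 < c1 /\ c1 <= c2 /\
    forall A lambda p : nat -> R,
      (forall n : nat, (0 < n)%N -> A0 <= A n) ->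
      A =o_\oo (fun n : nat => n%:R `^ (1 / 30)) ->
      (forall n : nat, (0 < n)%N ->
         p n = 1 / n%:R + lambda n / n%:R `^ (4 / 3)) ->
      (forall n : nat, (0 < n)%N -> `|lambda n| <= A n / 3) ->
      \forall n \near \oo,
        let a := A n in
        let l := lambda n in
        let ex := expR (- (a ^+ 3 / 8) + l * a ^+ 2 / 2 - l ^+ 2 * a / 2) in
        let PC := fun v : 'I_n => gnp_prob (p n)
          (fun E => a * n%:R `^ (2 / 3) < #|component E v|%:R) in
        let Pmax := gnp_prob (p n) (fun E : {set {set 'I_n}} =>
          a * n%:R `^ (2 / 3) < (max_component_size E)%:R) in
        (forall v : 'I_n,
           c1 / (a `^ (1 / 2) * n%:R `^ (1 / 3)) * ex <= PC v /\
           PC v <= c2 / (a `^ (1 / 2) * n%:R `^ (1 / 3)) * ex) /\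
        (c1 / a `^ (3 / 2) * ex <= Pmax /\ Pmax <= c2 / a `^ (3 / 2) * ex).
Proof.
pose A0 : R := 10 + 2 * expR 1 * c_up R.
have A010 : 10 <= A0 by rewrite lerDl !mulr_ge0 ?expR_ge0 ?(ltW (c_up_gt0 R)).
have cl0 := c_low_gt0 R.
(* Part (b) loses a factor 2 from 1/k >= t^2/(2 a) on the block and another from subtracting the
   pairs, hence [c_low / 4]. *)
exists A0, (c_low R / 4), (c_up R); split; first by lra.
split; first by rewrite divr_gt0.
split; first exact: c_low_le_up.
move=> A lambda p hA hAo hp hl.
have hAs : \forall n \near \oo, `|A n| <= `|(n%:R : R) `^ (1 / 30)|.
  move/eqoP: hAo => /(_ 1 ltr01). by under eq_near do rewrite mul1r.
near=> n.
have n0 : (0 < n)%N by near: n; exact: nbhs_infty_gt.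
have nR : 0 < (n%:R : R) by rewrite ltr0n.
have hn : `|A n| <= `|(n%:R : R) `^ (1 / 30)| by near: n.
set a := A n in hn *; set l := lambda n.
have aA : A0 <= a by exact: hA.
have a0 : 0 < a by lra.
set w : R := n%:R `^ (1 / 3).
have w0 : 0 < w by rewrite powR_gt0.
have wX k : n%:R `^ (k%:R / 3) = w ^+ k.
  by rewrite -powR_mulrn ?(ltW w0) // -powRrM; congr (_ `^ _); field.
have w3 : w ^+ 3 = n%:R by rewrite -wX divff ?powRr1 ?ltW // pnatr_eq0.
pose t := w^-1; have t0 : 0 < t by rewrite invr_gt0.
have tw : t * w = 1 by rewrite mulVf // lt0r_neq0.
have nt : n%:R * t ^+ 3 = 1 by rewrite -w3 -exprMn mulfV ?expr1n // lt0r_neq0.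
(* The tenth power of n^(1/30) is n^(1/3) = 1/t. *)
have at1 : a ^+ 10 * t <= 1.
  rewrite ler_pdivrMr // mul1r; apply: (@le_trans _ _ ((n%:R `^ (1 / 30)) ^+ 10)).
    rewrite lerXn2r ?nnegrE ?(ltW a0) ?powR_ge0 //.
    by move: hn; rewrite !ger0_norm ?powR_ge0 // ltW.
  rewrite -powR_mulrn ?powR_ge0 // -powRrM /w le_eqVlt; apply/orP; left; apply/eqP.
  by congr (_ `^ _); field.
have reg : regime n t a l (p n).
  split=> //; first by split=> //; apply: le_trans aA.
  - exact: hl.
  - rewrite hp // (wX 4%N) -w3 -/l /t; field; rewrite lt0r_neq0 //.
have PE k : (a * n%:R `^ (2 / 3) < k%:R) = (a < k%:R * t ^+ 2).
  by rewrite (wX 2%N) -ltr_pdivlMr ?exprn_gt0 // /t exprVn.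
have [hC hM] := large_component_bounds (P := fun k => a * n%:R `^ (2 / 3) < k%:R) reg aA PE.
have eE : - (a ^+ 3 / 8) + l * a ^+ 2 / 2 - l ^+ 2 * a / 2 = - rate l a.
  by rewrite /rate; ring.
have aE1 : a `^ (1 / 2) = Num.sqrt a by rewrite div1r powR12_sqrt // ltW.
have aE2 : a `^ (3 / 2) = a * Num.sqrt a.
  have -> : 3 / 2 = 1 + 1 / 2 :> R by field.
  rewrite powRD ?powRr1 ?(ltW a0) ?aE1 //; apply/implyP => _; exact: lt0r_neq0.
rewrite /= eE aE1 aE2 -/w.
have sa0 : 0 < Num.sqrt a by rewrite sqrtr_gt0.
have E1 c : c / (Num.sqrt a * w) * expR (- rate l a) = c * (t / Num.sqrt a * expR (- rate l a)).
  by rewrite /t; field; rewrite !lt0r_neq0.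
have E2 c : c / (a * Num.sqrt a) * expR (- rate l a) = c * (expR (- rate l a) / (a * Num.sqrt a)).
  by field; rewrite !lt0r_neq0.
rewrite !E1 !E2; split.
  move=> v; have /andP[h1 h2] := hC v; split=> //.
  apply: le_trans h1; rewrite ler_wpM2r //; last by lra.
  by rewrite mulr_ge0 ?expR_ge0 // divr_ge0 ?ltW.
by move/andP: hM.
Unshelve. all: end_near.
Qed.
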